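(* Let $\rho$ be the Lyubich representation, and let $S$ be a $\rho$-right-amenable semigroup (under composition) of rational maps of $\overline{\mathbb{C}}$ containing a non-exceptional rational map which is not Möbius conjugate to a polynomial. Then: (1) there exists a probability measure $\mu$ on $\overline{\mathbb{C}}$ invariant under $S$ (i.e. $s_*\mu=\mu$ for every $s\in S$); (2) if $P\in S$ and $\deg(P)>1$, then $\mu$ is the measure of maximal entropy of $P$.
   Context: Rational maps are non-constant. A rational map is exceptional if it has degree $1$ or is Möbius conjugate to $z^n$ ($n\in\mathbb{Z}$), to $\pm$ a Chebyshev polynomial, or to a Lattès map. For a semigroup $S$, $L_\infty(S)$ is the Banach space of bounded complex-valued functions on $S$ with the supremum norm. A mean is a continuous linear functional $M$ on $L_\infty(S)$ with $M(\phi)\ge 0$ whenever $\phi\ge 0$ and $\|M\|=M(\chi_S)=1$, where $\chi_S$ is the constant function $1$. Put $r_s(\phi)(x)=\phi(xs)$ for $s,x\in S$. Let $B$ be a Banach space and $\rho:S\to End(B)$ a bounded homomorphism into the continuous linear endomorphisms of $B$. For $(b,b^* )\in B\times B^*$ put $f_{(b,b^* )}(s)=b^*(\rho(s)(b))$; let $Y_\rho\subset L_\infty(S)$ be the closure of the linear span of all $f_{(b,b^* )}$ and $X_\rho$ the space generated by $Y_\rho$ and the constant functions. $S$ is $\rho$-right-amenable if there is a mean $M$ on $L_\infty(S)$ with $M(r_s\phi)=M(\phi)$ for all $\phi\in X_\rho$, $s\in S$. The Lyubich representation $\rho$ sends a rational map $R$ to the operator $L_R$ on $C(\overline{\mathbb{C}})$,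 $L_R(\phi)(y)=\frac{1}{\deg R}\sum_{R(x)=y}\phi(x)$ (preimages counted with multiplicity). Every rational map $P$ of degree $>1$ has a unique invariant probability measure of maximal entropy ($=\log\deg P$). *)

(* Defs.v *)
From HB Require Import structures.
From mathcomp Require Import all_boot all_order all_algebra.
From mathcomp Require Import all_classical all_reals all_analysis.
From mathcomp.real_closed Require Import complex.

Set Implicit Arguments.
Unset Strict Implicit.
Unset Printing Implicit Defensive.

Import Order.TTheory GRing.Theory Num.Theory numFieldNormedType.Exports.

Local Open Scope classical_set_scope.
Local Open Scope ring_scope.
Local Open Scope complex_scope.

(* The regular algebra [R[i]^o] is the copy of the complex numbers that carries
   the canonical topological and normed-module structures. *)
Notation Cplx R := (R[i]^o).

(* [complex.Re `|z| ] is the modulus of [z] as an element of [R]: the norm of a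
   normed module over [R[i]] takes its values in [R[i]]. *)
Definition rnorm (R : realType) (V : normedModType R[i]) (v : V) : R :=
  complex.Re `|v|.

Section BoundedFunctions.
Context (R : realType) (T : Type).

Definition bounded_pred : {pred T -> Cplx R} :=
  fun f => `[< exists k : R, forall x, rnorm (f x) <= k >].

Lemma rnormE (V : normedModType R[i]) (v : V) : `|v| = (rnorm v)%:C.
Proof.
by rewrite /rnorm RRe_real// ger0_real// normr_ge0.
Qed.

Lemma rnorm_ge0 (V : normedModType R[i]) (v : V) : 0 <= rnorm v.
Proof. by rewrite -ler0c -rnormE. Qed.

Lemma rnormD (V : normedModType R[i]) (u v : V) :
  rnorm (u + v) <= rnorm u + rnorm v.
Proof. by rewrite -lecR rmorphD/= -!rnormE ler_normD. Qed.

Lemma rnormZ (V : normedModType R[i]) (a : Cplx R) (v : V) :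
  rnorm (a *: v) = rnorm a * rnorm v.
Proof. by apply: complexI; rewrite rmorphM/= -!rnormE normrZ. Qed.

Lemma rnorm0_eq0 (V : normedModType R[i]) (v : V) : rnorm v = 0 -> v = 0.
Proof. by move=> v0; apply: normr0_eq0; rewrite rnormE v0. Qed.

Lemma bounded_submod : submod_closed bounded_pred.
Proof.
split.
  apply/asboolP; exists 0 => x /=.
  by rewrite -lecR -rnormE normr0.
move=> a f g /asboolP[k fk] /asboolP[l gl]; apply/asboolP.
exists (rnorm (a : Cplx R) * k + l) => x; apply: (le_trans (rnormD _ _)).
by rewrite rnormZ lerD// ler_wpM2l// rnorm_ge0.
Qed.

HB.instance Definition _ :=
  GRing.isSubmodClosed.Build R[i] (T -> Cplx R) bounded_pred bounded_submod.
End BoundedFunctions.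

(* [Linf T] is the Banach space of bounded functions [T -> C] with the supremum
   norm. *)
Definition Linf (R : realType) (T : Type) : Type :=
  {f : T -> Cplx R | f \in @bounded_pred R T}.

Section LinfNormed.
Context (R : realType) (T : Type).

HB.instance Definition _ := SubChoice.on (Linf R T).
HB.instance Definition _ :=
  [SubChoice_isSubLmodule of Linf R T by <:].

Definition fun_of_Linf (f : Linf R T) : T -> Cplx R := val f.
Coercion fun_of_Linf : Linf >-> Funclass.

Definition supnorm (f : Linf R T) : R := sup [set rnorm (f x) | x in setT].

Lemma Linf_has_ubound (f : Linf R T) :
  has_ubound [set rnorm (f x) | x in setT].
Proof.
by have /asboolP[k fk] := valP f; exists k => _ [x _ <-]; exact: fk.
Qed.

Lemma rnorm_le_supnorm (f : Linf R T) x : rnorm (f x) <= supnorm f.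
Proof. by apply: ub_le_sup; [exact: Linf_has_ubound|exists x]. Qed.

Lemma supnorm_le (f : Linf R T) k :
  0 <= k -> (forall x, rnorm (f x) <= k) -> supnorm f <= k.
Proof.
move=> k0 fk; rewrite /supnorm.
have [->|/set0P fn0] := eqVneq [set rnorm (f x) | x in setT] set0.
  by rewrite sup0.
by apply: ge_sup => // _ [x _ <-]; exact: fk.
Qed.

Lemma supnorm_ge0 (f : Linf R T) : 0 <= supnorm f.
Proof.
have [A0|/set0P[_ [x _ _]]] := eqVneq [set rnorm (f x) | x in setT] set0.
  by rewrite /supnorm A0 sup0.
by apply: le_trans (rnorm_le_supnorm f x); exact: rnorm_ge0.
Qed.

Let nrm (f : Linf R T) : R[i] := (supnorm f)%:C.

Let nrmD (f g : Linf R T) : nrm (f + g) <= nrm f + nrm g.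
Proof.
rewrite /nrm -rmorphD lecR; apply: supnorm_le => [|x].
  by rewrite addr_ge0// supnorm_ge0.
by apply: (le_trans (rnormD _ _)); rewrite lerD// rnorm_le_supnorm.
Qed.

Let nrmZle (a : R[i]) (f : Linf R T) :
  supnorm (a *: f) <= rnorm (a : Cplx R) * supnorm f.
Proof.
apply: supnorm_le => [|x]; first by rewrite mulr_ge0 ?rnorm_ge0 ?supnorm_ge0.
rewrite (_ : fun_of_Linf (a *: f) x = a *: f x)// rnormZ ler_wpM2l ?rnorm_ge0//.
exact: rnorm_le_supnorm.
Qed.

Let nrmZ (a : R[i]) (f : Linf R T) : nrm (a *: f) = `|a| * nrm f.
Proof.
rewrite /nrm (rnormE (a : Cplx R)) -rmorphM/=; congr (_%:C).
apply/eqP; rewrite eq_le nrmZle/=.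
have [->|a0] := eqVneq a 0.
  by rewrite /rnorm normr0/= mul0r supnorm_ge0.
have ra0 : 0 < rnorm (a : Cplx R) by rewrite -ltcR -rnormE normr_gt0.
have := nrmZle a^-1 (a *: f); rewrite scalerA mulVf// scale1r => h.
have -> : supnorm (a *: f) =
    rnorm (a : Cplx R) * (rnorm (a^-1 : Cplx R) * supnorm (a *: f)).
  rewrite mulrA -(@rnormZ _ _ a (a^-1 : Cplx R)).
  by rewrite (_ : a *: (a^-1 : Cplx R) = a * a^-1)// mulfV// /rnorm normr1 mul1r.
by rewrite ler_wpM2l ?rnorm_ge0.
Qed.

Let nrm0_eq0 (f : Linf R T) : nrm f = 0 -> f = 0.
Proof.
move=> /complexI f0; apply: val_inj; apply/funext => x /=.
apply: rnorm0_eq0; apply/eqP; rewrite eq_le rnorm_ge0 andbT -f0.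
exact: rnorm_le_supnorm.
Qed.

HB.instance Definition _ :=
  Lmodule_isNormed.Build R[i] (Linf R T) nrmD nrmZ nrm0_eq0.

Fact mem_bounded (f : T -> Cplx R) :
  (exists k : R, forall x, rnorm (f x) <= k) -> f \in @bounded_pred R T.
Proof. by move=> fb; apply/asboolP. Qed.

Definition mkLinf (f : T -> Cplx R)
  (fb : exists k : R, forall x, rnorm (f x) <= k) : Linf R T :=
  exist _ f (mem_bounded fb).

Fact cst_bounded (c : Cplx R) :
  exists k : R, forall x : T, rnorm (cst c x) <= k.
Proof. by exists (rnorm c). Qed.

Definition Linf_cst (c : Cplx R) : Linf R T := mkLinf (cst_bounded c).
End LinfNormed.

(* [Cb X] is the Banach space of bounded continuous functions [X -> C] with the
   supremum norm; for [X] compact it is the space [C(X)] of all continuous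
   functions. *)
Section ContinuousFunctions.
Context (R : realType) (X : topologicalType).

Definition continuous_pred : {pred Linf R X} :=
  fun f => `[< continuous (f : X -> Cplx R) >].

Lemma continuous_submod : submod_closed continuous_pred.
Proof.
split; first by apply/asboolP => x; exact: cvg_cst.
move=> a f g /asboolP fc /asboolP gc; apply/asboolP => x.
by apply: cvgD; [apply: cvgZr; exact: fc|exact: gc].
Qed.

HB.instance Definition _ :=
  GRing.isSubmodClosed.Build R[i] (Linf R X) continuous_pred continuous_submod.
End ContinuousFunctions.

Definition Cb (R : realType) (X : topologicalType) : Type :=
  {f : Linf R X | f \in @continuous_pred R X}.

Section CbNormed.
Context (R : realType) (X : topologicalType).

HB.instance Definition _ := SubChoice.on (Cb R X).
HB.instance Definition _ := [SubChoice_isSubLmodule of Cb R X by <:].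

Definition fun_of_Cb (f : Cb R X) : X -> Cplx R := fun_of_Linf (val f).
Coercion fun_of_Cb : Cb >-> Funclass.

Let nrm (f : Cb R X) : R[i] := `|val f|.

Let nrmD (f g : Cb R X) : nrm (f + g) <= nrm f + nrm g.
Proof. exact: ler_normD. Qed.

Let nrmZ (a : R[i]) (f : Cb R X) : nrm (a *: f) = `|a| * nrm f.
Proof. exact: normrZ. Qed.

Let nrm0_eq0 (f : Cb R X) : nrm f = 0 -> f = 0.
Proof. by move=> /normr0_eq0 f0; exact: val_inj. Qed.

HB.instance Definition _ :=
  Lmodule_isNormed.Build R[i] (Cb R X) nrmD nrmZ nrm0_eq0.
End CbNormed.

Section Amenability.
Context (R : realType).

Definition lspan (V : lmodType R[i]) (A : set V) : set V :=
  [set v | exists (n : nat) (a : 'I_n -> R[i]) (u : 'I_n -> V),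
    (forall i, A (u i)) /\ v = \sum_(i < n) a i *: u i].

Definition opnorm (V : normedModType R[i]) (M : V -> Cplx R) : R :=
  sup [set rnorm (M v) | v in [set v | rnorm v <= 1]].

(* [0 <= z] in the partial order of [R[i]] means that [z] is real and
   nonnegative. *)
Definition is_mean (S : Type) (M : {linear Linf R S -> Cplx R}) : Prop :=
  [/\ continuous M,
      forall phi : Linf R S, (forall x, 0 <= phi x) -> 0 <= M phi,
      opnorm M = 1 &
      M (Linf_cst S (1 : Cplx R)) = 1].

Fact rtranslate_bounded (S : semigroupType) (s : S) (phi : Linf R S) :
  exists k : R, forall x, rnorm (phi (x * s)%g) <= k.
Proof. by exists (supnorm phi) => x; exact: rnorm_le_supnorm. Qed.

Definition rtranslate (S : semigroupType) (s : S) (phi : Linf R S) : Linf R S :=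
  mkLinf (rtranslate_bounded s phi).

Section Representation.
Context (S : semigroupType) (B : normedModType R[i]) (rho : S -> B -> B).

Definition matrix_coeffs : set (Linf R S) :=
  [set phi | exists (b : B) (b' : {linear B -> Cplx R}),
    continuous b' /\ forall s, phi s = b' (rho s b)].

Definition Yspace : set (Linf R S) := closure (lspan matrix_coeffs).

Definition Xspace : set (Linf R S) :=
  lspan (Yspace `|` range (@Linf_cst R S)).

Definition right_amenable : Prop :=
  exists M : {linear Linf R S -> Cplx R}, is_mean M /\
    forall phi s, Xspace phi -> M (rtranslate s phi) = M phi.
End Representation.
End Amenability.

Section RationalMaps.
Context (R : realType).

(* The Riemann sphere; [None] is the point at infinity. *)
Definition sphere : Type := one_point_compactification (Cplx R).
HB.instance Definition _ := Topological.on sphere.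
HB.instance Definition _ := Pointed.on sphere.

(* The map [p / q] for coprime [p] and [q]; at infinity it is the quotient of
   the coefficients of degree [max (deg p) (deg q)]. *)
Definition ratfun (p q : {poly R[i]}) (z : sphere) : sphere :=
  let quot (a b : R[i]) : sphere := if b == 0 then None else Some (a / b) in
  match z with
  | Some x => quot p.[x] q.[x]
  | None => let d := (maxn (size p) (size q)).-1 in quot p`_d q`_d
  end.

(* For coprime [p] and [q] the size condition says that [p / q] is not
   constant. *)
Definition ratrep (f : sphere -> sphere) : set ({poly R[i]} * {poly R[i]}) :=
  [set pq | [/\ coprimep pq.1 pq.2, (1 < maxn (size pq.1) (size pq.2))%N &
               f = ratfun pq.1 pq.2]].

Definition rational_map (f : sphere -> sphere) : Prop := ratrep f !=set0.

(* A representation of [f], which is unique up to a common scalar factor. *)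
Definition numden (f : sphere -> sphere) : {poly R[i]} * {poly R[i]} :=
  xget (0, 0) (ratrep f).

Definition ratdeg (f : sphere -> sphere) : nat :=
  (maxn (size (numden f).1) (size (numden f).2)).-1.

(* The multiplicity of [x] as a preimage of [f x]: the preimages of a finite [y]
   (resp. of infinity) under [p / q] are the zeros of [p - y q] (resp. of [q])
   seen as a form of degree [ratdeg f]. *)
Definition preim_mult (f : sphere -> sphere) (x : sphere) : nat :=
  let: (p, q) := numden f in
  let N := if f x is Some y then p - y *: q else q in
  match x with
  | Some z => mup z N
  | None => ((ratdeg f).+1 - size N)%N
  end.

Definition lyubich_fun (f : sphere -> sphere) (phi : sphere -> Cplx R)
    (y : sphere) : Cplx R :=
  (ratdeg f)%:R^-1 * \sum_(x \in f @^-1` [set y]) (preim_mult f x)%:R * phi x.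

(* For a rational map [f], [lyubich_fun f phi] is continuous, hence is the
   function underlying [lyubich f phi]; the default value [0] is not used. *)
Definition lyubich (f : sphere -> sphere) (phi : Cb R sphere) : Cb R sphere :=
  xget 0 [set psi : Cb R sphere | forall y, psi y = lyubich_fun f phi y].

Record ratsemigroup := RatSemigroup {
  ratsg_set :> set (sphere -> sphere);
  ratsg_rational : ratsg_set `<=` rational_map;
  ratsg_comp : forall s t, ratsg_set s -> ratsg_set t -> ratsg_set (s \o t) }.

Definition ratsg_elt (S : ratsemigroup) : Type := set_type S.

Section Semigroup.
Context (S : ratsemigroup).

HB.instance Definition _ := Choice.on (ratsg_elt S).

Fact ratsg_mul_subproof (s t : ratsg_elt S) : val s \o val t \in (S : set _).
Proof. by apply/mem_set/ratsg_comp; [exact: set_valP|exact: set_valP]. Qed.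

Definition ratsg_mul (s t : ratsg_elt S) : ratsg_elt S :=
  exist _ (val s \o val t) (ratsg_mul_subproof s t).

Fact ratsg_mulA : associative ratsg_mul.
Proof. by move=> s t u; exact: val_inj. Qed.

HB.instance Definition _ := isSemigroup.Build (ratsg_elt S) ratsg_mulA.
End Semigroup.

Definition lyubich_rep (S : ratsemigroup) (s : ratsg_elt S) :
  Cb R sphere -> Cb R sphere := lyubich (val s).

Definition mobius (m : sphere -> sphere) : Prop :=
  rational_map m /\ ratdeg m = 1%N.

Definition mobius_conj (f g : sphere -> sphere) : Prop :=
  exists2 m, mobius m & m \o f = g \o m.

Definition polymap (p : {poly R[i]}) : sphere -> sphere := ratfun p 1.

Definition powmap (n : int) : sphere -> sphere :=
  match n with
  | Posz m => ratfun ('X ^+ m) 1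
  | Negz m => ratfun 1 ('X ^+ m.+1)
  end.

(* [T_n (cos t) = cos (n t)]. *)
Fixpoint chebyshev (n : nat) : {poly R[i]} :=
  match n with
  | 0 => 1
  | n'.+1 => match n' with
             | 0 => 'X
             | m.+1 => 'X * chebyshev n' *+ 2 - chebyshev m
             end
  end.

(* Holomorphy of maps from the plane to the sphere, read in the charts [z] and
   [1 / z] of the target. *)
Definition holomorphic (Theta : Cplx R -> sphere) : Prop :=
  forall z, [/\ {for z, continuous Theta},
    Theta z <> None ->
      derivable (fun u => odflt 0 (Theta u) : Cplx R) z 1 &
    Theta z <> Some 0 ->
      derivable (fun u => oapp (fun w : Cplx R => w^-1) 0 (Theta u) : Cplx R)
        z 1].

Definition period_lattice (w1 w2 : R[i]) : set R[i] :=
  [set l | exists m n : int, l = m%:~R * w1 + n%:~R * w2].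

Definition real_independent (w1 w2 : R[i]) : Prop :=
  forall x y : R, x%:C * w1 + y%:C * w2 = 0 -> x = 0 /\ y = 0.

(* A map of degree at least 2 is a Lattes map when it is a quotient of an affine
   self-map [z |-> a z + b] of a complex torus [C / L], the quotient being a
   nonconstant holomorphic map [C / L -> sphere], here lifted to [C]. *)
Definition lattes (f : sphere -> sphere) : Prop :=
  [/\ rational_map f, (1 < ratdeg f)%N &
    exists (w1 w2 a b : R[i]) (Theta : Cplx R -> sphere),
      [/\ real_independent w1 w2,
          forall l, period_lattice w1 w2 l -> period_lattice w1 w2 (a * l),
          [/\ holomorphic Theta, (exists u v, Theta u <> Theta v) &
              forall z l, period_lattice w1 w2 l -> Theta (z + l) = Theta z] &
          forall z, f (Theta z) = Theta (a * z + b)]].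

Definition exceptional (f : sphere -> sphere) : Prop :=
  [\/ ratdeg f = 1%N,
      exists n : int, mobius_conj f (powmap n),
      exists n : nat, mobius_conj f (polymap (chebyshev n)) \/
                      mobius_conj f (polymap (- chebyshev n)) |
      exists2 g, lattes g & mobius_conj f g].

End RationalMaps.

Arguments lyubich_rep {R} S s.

Section Entropy.
Context (R : realType) (d : measure_display) (X : measurableType d).
Implicit Types (mu : probability X R) (T : X -> X).

Definition invariant_measure mu T : Prop :=
  forall A, measurable A -> pushforward mu T A = mu A.

(* A finite measurable partition is given by its labelling [xi : X -> 'I_k]; the
   cells of its join with its preimages under [T, ..., T^(n-1)] are the fibres
   of [itinerary T xi n]. *)
Definition itinerary T k (xi : X -> 'I_k) (n : nat) (x : X) :
    {ffun 'I_n -> 'I_k} := [ffun i : 'I_n => xi (iter i T x)].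

Definition partition_entropy mu (J : finType) (xi : X -> J) : R :=
  - \sum_(j : J) fine (mu (xi @^-1` [set j])) * ln (fine (mu (xi @^-1` [set j]))).

Definition entropy_wrt mu T k (xi : X -> 'I_k) : R :=
  limn (fun n => partition_entropy mu (itinerary T xi n) / n%:R).

Definition KS_entropy mu T : \bar R :=
  ereal_sup [set h | exists (k : nat) (xi : X -> 'I_k),
    (forall j, measurable (xi @^-1` [set j])) /\ h = (entropy_wrt mu T xi)%:E].

Definition maximal_entropy mu T : Prop :=
  invariant_measure mu T /\
  forall nu : probability X R, invariant_measure nu T ->
    (KS_entropy nu T <= KS_entropy mu T)%E.
End Entropy.

(* The Riemann sphere with its Borel sigma-algebra. *)
Definition borel_sphere (R : realType) : Type :=
  g_sigma_algebraType (@open (sphere R)).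

(* Main.v *)
(* Evaluating the operators at a point turns the invariant mean into a positive
   functional [Lam] on [C(sphere)] with [Lam (L_s phi) = Lam phi] for [s] in [S], and
   the Riesz measure [mu] of [Lam] is invariant and balanced: a set on which [s] is
   injective has measure at most [mu (s A) / deg s]. An atom of [mu] of maximal
   mass would lie on a cycle of totally ramified points of the given nonexceptional
   map, and this map would be conjugate to a polynomial or to a power map.
   So [mu] has no atoms. Let [P] in [S] have degree [d > 1].
   Lower bound: outside a small neighbourhood of the critical points, which are
   not charged, the sphere is partitioned into cells on which [P] is injective;
   conditioning on [P] then gains at least [ln d] on each cell, and [h_mu(P)] is at
   least [(1 - e) ln d].
   Upper bound: any finite partition is approximated by one into sets cut out by
   finitely many lines, and the number of itineraries of length [n] of such a
   partition is at most [c n^2 d^n]: sample points for the components of the set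
   of the points whose first [n] iterates avoid the lines can be pulled back by
   [P], at the cost of a factor [d], and the lines are cut by algebraic
   equations of degree [O(d^n)]. So [h_nu(P)] is at most [ln d] for every invariant
   [nu]. *)
Require Import Defs.
From HB Require Import structures.
From mathcomp Require Import all_boot all_order all_algebra.
From mathcomp Require Import all_classical all_reals all_analysis.
From mathcomp.real_closed Require Import complex.
From mathcomp Require Import ring lra zify.
Set Implicit Arguments.
Unset Strict Implicit.
Unset Printing Implicit Defensive.
Import Order.TTheory GRing.Theory Num.Theory numFieldNormedType.Exports.
Local Open Scope classical_set_scope.
Local Open Scope ring_scope.
Local Open Scope complex_scope.

(** * Binary forms, rational maps and their fibres *)

(** Fibres are lists of [ratdeg f] points with multiplicity, infinity included, obtained by
    factoring binary forms. Their continuity rests on an upper bound for the number of preimages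
    near a point, and the same bound supplies the open sets for which the balance inequality is
    stated. That inequality is one-sided because it comes from [L_s phi <= k / deg s] for test
    functions; this suffices both for the atoms and for the lower bound. In the upper bound the
    measure [nu] may charge the lines of the grid, so orbits that meet them are counted as well. An
    orbit is cut at the first time it meets a line or infinity: before that time its itinerary is
    locally constant in the starting point, afterwards it is the itinerary of a point of finitely
    many lines, along which itineraries change only at real zeros of polynomials. The choice of the
    cutting time gives one factor [n]; the other is the linear factor in the number of samples.
    Components are never formed: a finite set is required to meet every nonempty relatively open and
    closed part, and this property is pulled back by open maps that are closed. *)

Section Forms.
Context (R : realType).
Local Notation C := R[i].
Local Notation sphere := (sphere R).
Implicit Types (p q N P Q : {poly C}) (u v z : C) (x y : sphere).

(** Homogeneous coordinates [[u : v]]. The pair [(0, 0)] is sent to [None] as well, hence the side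
    condition [(u != 0) || (v != 0)] in what follows. *)
Definition pt u v : sphere := if v == 0 then None else Some (u / v).

Definition nume x : C := if x is Some z then z else 1.
Definition deno x : C := if x is Some z then 1 else 0.

Lemma pt_ratio x : pt (nume x) (deno x) = x.
Proof. by case: x => [z|]; rewrite /pt/= ?oner_eq0 ?eqxx ?divr1. Qed.

Lemma ratio_neq0 x : (nume x != 0) || (deno x != 0).
Proof. by case: x => [z|] /=; rewrite oner_eq0 ?orbT. Qed.

Lemma ptZ z u v : z != 0 -> pt (z * u) (z * v) = pt u v.
Proof.
move=> z0; rewrite /pt mulf_eq0 (negbTE z0)/=; case: ifP => // v0.
by rewrite -mulf_div divff// mul1r.
Qed.

Lemma pt_eqE u v u' v' : (u != 0) || (v != 0) -> (u' != 0) || (v' != 0) ->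
  (pt u v == pt u' v') = (u * v' == u' * v).
Proof.
rewrite /pt; have [->|v0] := eqVneq v 0; have [->|v'0] := eqVneq v' 0.
- by rewrite !mulr0 !eqxx.
- by rewrite mulr0 orbF mulf_eq0 (negbTE v'0) orbF => /negbTE->.
- rewrite mulr0 orbF => _ /negbTE u'0.
  by rewrite [RHS]eq_sym mulf_eq0 u'0 (negbTE v0).
by rewrite (inj_eq Some_inj) eqr_div.
Qed.

Lemma pt_surj x : exists u v, ((u != 0) || (v != 0)) /\ x = pt u v.
Proof. by exists (nume x), (deno x); rewrite ratio_neq0 pt_ratio. Qed.

(* A binary form of degree [d] is encoded by [d] and its dehomogenization [N]. *)
Definition phom d N P Q : {poly C} :=
  \sum_(i < d.+1) N`_i *: (P ^+ i * Q ^+ (d - i)).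

Definition hom d N u v : C := \sum_(i < d.+1) N`_i * (u ^+ i * v ^+ (d - i)).

Lemma horner_phom d N P Q z :
  (phom d N P Q).[z] = hom d N P.[z] Q.[z].
Proof. by rewrite horner_sum; apply: eq_bigr => i _; rewrite !hornerE. Qed.

Lemma homE d N u v :
  hom d N u v = (phom d N u%:P v%:P).[0].
Proof. by rewrite horner_phom !hornerE. Qed.

Lemma phomX1 d N : (size N <= d.+1)%N -> phom d N 'X 1 = N.
Proof.
move=> s; rewrite /phom; under eq_bigr do rewrite expr1n mulr1.
by rewrite -poly_def; apply/polyP => i; rewrite coef_poly; case: ltnP => // h;
  rewrite nth_default// (leq_trans s).
Qed.

Lemma phom_linear d a b N N' P Q :
  phom d (a *: N + b *: N') P Q = a *: phom d N P Q + b *: phom d N' P Q.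
Proof.
rewrite /phom !scaler_sumr -big_split/=; apply: eq_bigr => i _.
by rewrite !coefE scalerDl !scalerA.
Qed.

Lemma hom_linear d a b N N' u v :
  hom d (a *: N + b *: N') u v = a * hom d N u v + b * hom d N' u v.
Proof. by rewrite !homE phom_linear !hornerE. Qed.

Lemma phomZ d a N P Q : phom d (a *: N) P Q = a *: phom d N P Q.
Proof. by rewrite -[X in phom _ X]addr0 -(scale0r N) phom_linear scale0r addr0. Qed.

Lemma homZ d a u v N : hom d N (a * u) (a * v) = a ^+ d * hom d N u v.
Proof.
rewrite /hom mulr_sumr; apply: eq_bigr => i _.
rewrite !exprMn mulrACA -exprD subnKC; last by rewrite -ltnS.
by rewrite [RHS]mulrCA.
Qed.

Lemma hom_v0 d N u : hom d N u 0 = N`_d * u ^+ d.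
Proof.
rewrite /hom big_ord_recr/= subnn expr0 mulr1 big1 ?add0r// => i _.
by rewrite expr0n subn_eq0 leqNgt ltn_ord !mulr0.
Qed.

Lemma hom_v1 d N u : (size N <= d.+1)%N -> hom d N u 1 = N.[u].
Proof. by move=> s; rewrite -{2}(phomX1 s) horner_phom !hornerE. Qed.

(* The linear form vanishing at [x]; for [x] at infinity it dehomogenizes to [1]. *)
Definition lin x : {poly C} := if x is Some z then 'X - z%:P else 1.
(** [lin x] with the pair [(P, Q)] substituted; as a form, it vanishes at the points that [P / Q]
    sends to [x]. *)
Definition plin x P Q : {poly C} := if x is Some z then P - z *: Q else Q.

Definition linprod (rs : seq sphere) : {poly C} := \prod_(x <- rs) lin x.

Lemma linprod_cons x rs : linprod (x :: rs) = lin x * linprod rs.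
Proof. exact: big_cons. Qed.

Lemma linprod_nil : linprod [::] = 1.
Proof. exact: big_nil. Qed.

Lemma lin_neq0 x : lin x != 0.
Proof. by case: x => [w|]/=; rewrite ?oner_eq0// polyXsubC_eq0. Qed.

Lemma linprod_neq0 rs : linprod rs != 0.
Proof.
elim: rs => [|w s IHs]; first by rewrite linprod_nil oner_eq0.
by rewrite linprod_cons mulf_neq0// lin_neq0.
Qed.

(** A linear factor comes out of the substitution. The degree grows by one even for [x] at infinity,
    where [lin x = 1] but the factor is [Q]. *)
Lemma phomM_lin d x N P Q : (size N <= d.+1)%N ->
  phom d.+1 (lin x * N) P Q = plin x P Q * phom d N P Q.
Proof.
move=> sN; case: x => [z|] /=; last first.
  rewrite mul1r /phom big_ord_recr/= [N`__]nth_default// scale0r addr0.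
  rewrite mulr_sumr; apply: eq_bigr => i _; rewrite -scalerAr subSn ?exprS.
    by rewrite (mulrCA Q).
  by rewrite -ltnS.
have -> : ('X - z%:P) * N = 1 *: ('X * N) + (- z) *: N.
  by rewrite scale1r scaleNr -mul_polyC mulrBl.
rewrite phom_linear scale1r scaleNr mulrBl; congr (_ - _).
  rewrite /phom big_ord_recl/= coefXM eqxx scale0r add0r mulr_sumr.
  apply: eq_bigr => i _; rewrite coefXM/= -scalerAr; congr (_ *: _).
  by rewrite exprS mulrA subSS.
rewrite -scalerAl; congr (_ *: _).
rewrite /phom big_ord_recr/= [N`__]nth_default// scale0r addr0 mulr_sumr.
apply: eq_bigr => i _; rewrite -scalerAr subSn ?exprS; last by rewrite -ltnS.
by rewrite (mulrCA Q).
Qed.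

Lemma size_prod_lin (rs : seq sphere) :
  (size (linprod rs) <= (size rs).+1)%N.
Proof.
elim: rs => [|x rs IH]; first by rewrite linprod_nil size_poly1.
rewrite linprod_cons; apply: leq_trans (size_polyMleq _ _) _.
have : (size (lin x) <= 2)%N by case: x => [z|] /=; rewrite ?size_XsubC ?size_poly1.
move=> h /=; move: h IH; move: (size (lin x)) (size (linprod rs)) (size rs); lia.
Qed.

Lemma phom_prod_lin (rs : seq sphere) P Q :
  phom (size rs) (linprod rs) P Q = \prod_(x <- rs) plin x P Q.
Proof.
elim: rs => [|x rs IH].
  by rewrite linprod_nil big_nil /phom big_ord1 coef1 eqxx scale1r !expr0 mulr1.
by rewrite linprod_cons big_cons/= phomM_lin ?IH// size_prod_lin.
Qed.

(** The gap between the degree of [N] and [d] is filled with roots at infinity. *)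
Lemma form_roots d N : N != 0 -> (size N <= d.+1)%N ->
  {rs : seq sphere | size rs = d & N = lead_coef N *: linprod rs}.
Proof.
move=> N0 sN; have [r Nr] := closed_field_poly_normal N.
have sr : (size r).+1 = size N.
  rewrite [in RHS]Nr size_scale ?lead_coef_eq0// size_prod_XsubC//.
exists (map Some r ++ nseq (d - size r) None).
  by rewrite size_cat size_map size_nseq subnKC// -ltnS sr.
rewrite {1}Nr; congr (_ *: _); rewrite /linprod big_cat/= big_map/= big_nseq.
by rewrite iter_fix ?mulr1//= mulr1.
Qed.

Lemma prod_lin_mup (rs : seq sphere) z :
  mup z (linprod rs) = count_mem (Some z : sphere) rs.
Proof.
elim: rs => [|x rs IH]; first by rewrite linprod_nil mupNroot// root1.
rewrite linprod_cons mupM ?IH// ?lin_neq0 ?linprod_neq0//=.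
congr addn; case: x => [w|] /=; last by rewrite mupNroot// root1.
rewrite (inj_eq Some_inj) eq_sym; have [->|wz] := eqVneq z w.
  by rewrite -['X - _]expr1 mup_XsubCX eqxx.
by rewrite mupNroot// root_XsubC.
Qed.

Lemma prod_lin_size (rs : seq sphere) :
  ((size rs).+1 - size (linprod rs))%N = count_mem (None : sphere) rs.
Proof.
elim: rs => [|x rs IH]; first by rewrite linprod_nil size_poly1.
rewrite linprod_cons/= -IH; case: x => [w|] /=.
  by rewrite size_monicM ?monicXsubC ?linprod_neq0// (size_XsubC (w : C)).
by rewrite mul1r add1n subSn//; apply: leq_trans (size_prod_lin _) _.
Qed.

Lemma mupZl (c z : C) N : c != 0 -> mup z (c *: N) = mup z N.
Proof.
move=> c0; have [->|N0] := eqVneq N 0; first by rewrite scaler0.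
by rewrite -mul_polyC mupM ?polyC_eq0// mupNroot// rootC.
Qed.

(** Multiplicities are read off the product: [mup] counts a finite root, the defect of the size
    counts infinity. *)
Lemma prod_lin_perm (rs rs' : seq sphere) (c c' : C) : c != 0 ->
  size rs = size rs' ->
  c *: linprod rs = c' *: linprod rs' -> perm_eq rs rs'.
Proof.
move=> c0 srs E.
have c'0 : c' != 0.
  apply: contra_eqN E => /eqP ->; rewrite scale0r scaler_eq0 negb_or c0/=.
  exact: linprod_neq0.
apply/allP => -[z|] _ /=; apply/eqP.
  by rewrite -!prod_lin_mup -(mupZl _ _ c0) E mupZl.
by rewrite -!prod_lin_size -(size_scale _ c0) E size_scale// srs.
Qed.
Lemma hom_div d N u v : (size N <= d.+1)%N -> v != 0 ->
  hom d N u v = v ^+ d * N.[u / v].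
Proof.
move=> sN v0; rewrite -(hom_v1 _ sN) -homZ mulr1.
by rewrite mulrCA divff// mulr1.
Qed.

(* [f] is the quotient of the forms of degree [d] with no common zero obtained
   by homogenizing [p] and [q]. *)
Definition hrep d p q (f : sphere -> sphere) := [/\ (0 < d)%N,
  (size p <= d.+1)%N, (size q <= d.+1)%N,
  (forall u v, hom d p u v = 0 -> hom d q u v = 0 -> u = 0 /\ v = 0) &
  forall u v, (u != 0) || (v != 0) -> f (pt u v) = pt (hom d p u v) (hom d q u v)].

Lemma hrep_ratfun p q : coprimep p q -> (1 < maxn (size p) (size q))%N ->
  hrep (maxn (size p) (size q)).-1 p q (ratfun p q).
Proof.
move=> cpq m1; set d := (maxn _ _).-1.
have dE : d.+1 = maxn (size p) (size q) by rewrite /d; case: maxn m1.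
have sp : (size p <= d.+1)%N by rewrite dE leq_maxl.
have sq : (size q <= d.+1)%N by rewrite dE leq_maxr.
split=> //; first by rewrite -ltnS dE.
- move=> u v; have [->|v0] := eqVneq v 0.
    rewrite !hom_v0 => /eqP + /eqP; have [->//|u0] := eqVneq u 0.
    rewrite !mulf_eq0 expf_eq0 (negbTE u0) andbF !orbF => pd qd.
    exfalso; move: dE; rewrite /maxn; case: ifP => _ dE.
      by move: qd; rewrite -[d]/(d.+1.-1) dE -lead_coefE lead_coef_eq0 -size_poly_eq0 -dE.
    by move: pd; rewrite -[d]/(d.+1.-1) dE -lead_coefE lead_coef_eq0 -size_poly_eq0 -dE.
  rewrite !hom_div// => /eqP + /eqP.
  rewrite !mulf_eq0 expf_eq0 (negbTE v0) andbF/= => pr qr.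
  by have := coprimep_root cpq pr; rewrite qr.
- move=> u v uv; rewrite {1}/pt; have [v0|v0] := eqVneq v 0.
    rewrite v0 eqxx orbF in uv *; rewrite !hom_v0 /= /pt -/d mulf_eq0 expf_eq0 (negbTE uv) andbF orbF.
    by case: ifP => // qd; rewrite -mulf_div divff ?mulr1// expf_neq0.
  rewrite /= !hom_div// ptZ ?expf_neq0//.
Qed.

(** The absence of common zeros gives both conditions of [ratrep]: at [(z, 1)] it excludes a common
    root, at [(1, 0)] a drop of both degrees. *)
Lemma hrep_ratrep d p q f : hrep d p q f ->
  ratrep f (p, q) /\ maxn (size p) (size q) = d.+1.
Proof.
case=> d0 sp sq nz fE.
have pq0 u v : (u != 0) || (v != 0) -> (hom d p u v != 0) || (hom d q u v != 0).
  by rewrite -negb_and => uv; rewrite -negb_and; apply: contra uv => /andP[/eqP a /eqP b];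
    have [-> ->] := nz _ _ a b; rewrite eqxx.
have mx : maxn (size p) (size q) = d.+1.
  apply/eqP; rewrite eqn_leq geq_max sp sq/=.
  have := pq0 1 0; rewrite oner_eq0 !hom_v0 expr1n !mulr1 leq_max => /(_ isT).
  by move=> /orP[] h; apply/orP; [left|right]; rewrite ltnNge;
    apply: contra h => h; rewrite nth_default.
have cpq : coprimep p q.
  apply/contraT => /negbTE ncp; have : size (gcdp p q) != 1 by rewrite -coprimep_def ncp.
  move=> /closed_rootP[z]; rewrite root_gcd => /andP[pz qz].
  have := pq0 z 1; rewrite oner_eq0 orbT !hom_v1// => /(_ isT).
  by rewrite -!rootE pz qz.
split=> //; split; rewrite ?mx//=; apply/funext => x.
have [_ _ _ _ gE] := hrep_ratfun cpq (etrans (congr1 (leq 2) mx) d0).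
have [u [v [uv ->]]] := pt_surj x.
by rewrite gE// mx fE.
Qed.

(** Comparing the values at finite points gives [p q' = p' q]; coprimality then makes [p] and [p']
    divide each other. *)
Lemma ratrep_inj f p q p' q' : ratrep f (p, q) -> ratrep f (p', q') ->
  exists2 c, c != 0 & p' = c *: p /\ q' = c *: q.
Proof.
move=> [/= cpq m1 fE] [/= cpq' m1' fE'].
have [d0 sp sq nz gE] := hrep_ratfun cpq m1.
have [d0' sp' sq' nz' gE'] := hrep_ratfun cpq' m1'.
have X : p * q' = p' * q.
  apply/eqP; rewrite -subr_eq0; apply/negPn/negP => /closed_nonrootP[z].
  rewrite rootE !hornerE subr_eq0 => /negP; apply.
  have z1 : (z != 0) || (1 != 0 :> C) by rewrite oner_eq0 orbT.
  rewrite -(hom_v1 z sp) -(hom_v1 z sq) -(hom_v1 z sp') -(hom_v1 z sq').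
  rewrite -pt_eqE.
  - by rewrite -gE// -gE'// -fE -fE'.
  - rewrite -negb_and; apply/andP => -[/eqP a /eqP b].
    by have [_ /eqP] := nz _ _ a b; rewrite oner_eq0.
  - rewrite -negb_and; apply/andP => -[/eqP a /eqP b].
    by have [_ /eqP] := nz' _ _ a b; rewrite oner_eq0.
have nz0 (a b : {poly C}) : coprimep a b -> (1 < maxn (size a) (size b))%N -> b = 0 -> size a = 1%N /\ False.
  by move=> cab + b0; move: cab; rewrite b0 coprimep0 size_poly0 maxn0 -size_poly_eq1 => /eqP ->.
have p0 : p != 0 by apply/negP => /eqP /(nz0 q p); rewrite coprimep_sym maxnC => -[].
have q0 : q != 0 by apply/negP => /eqP /(nz0 p q) [].
have p0' : p' != 0 by apply/negP => /eqP /(nz0 q' p'); rewrite coprimep_sym maxnC => -[].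
have q0' : q' != 0 by apply/negP => /eqP /(nz0 p' q') [].
have : p %= p'.
  rewrite /eqp -(Gauss_dvdpl p' cpq) -X dvdp_mulr//=.
  by rewrite -(Gauss_dvdpl p cpq') X dvdp_mulr.
move=> /eqpP[[a b] /= /andP[a0 b0] E].
exists (b^-1 * a); first by rewrite mulf_neq0// invr_eq0.
have E' : p' = (b^-1 * a) *: p by rewrite -scalerA E scalerA mulVf// scale1r.
split=> //; apply: (mulfI p0); rewrite X {1}E' -scalerAl -scalerAr//.
Qed.

Lemma numdenP f : rational_map f ->
  hrep (ratdeg f) (numden f).1 (numden f).2 f.
Proof.
move=> -[pq rf]; have : ratrep f (numden f) by rewrite /numden; apply: xgetPex; exists pq.
by rewrite /ratdeg; case: (numden f) => p q /= [/= cpq m1 {1}->]; exact: hrep_ratfun.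
Qed.

(** Any pair of forms without common zero computes the degree, so compositions and Möbius maps can
    be described by convenient forms rather than by [numden]. *)
Lemma hrep_rational d p q f : hrep d p q f -> rational_map f /\ ratdeg f = d.
Proof.
move=> rf; have [rr m] := hrep_ratrep rf.
have rat : rational_map f by exists (p, q).
split=> //; have /hrep_ratrep [] := numdenP rat.
case E : (numden f) => [p' q'] /= rr' _.
have [c c0 [pE qE]] := ratrep_inj rr rr'.
by rewrite /ratdeg E /= pE qE !size_scale// m.
Qed.

Definition cross x u v : C := if x is Some z then u - z * v else v.

Lemma cross_eq0 x u v : (u != 0) || (v != 0) -> (cross x u v == 0) = (pt u v == x).
Proof.
case: x => [z|] /=; rewrite /pt.
  have [->|v0 _] := eqVneq v 0; first by rewrite orbF mulr0 subr0 => /negbTE ->.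
  rewrite (inj_eq Some_inj); apply/eqP/eqP => [/subr0_eq ->|<-].
    by rewrite mulfK.
  by rewrite divfK// subrr.
by case: (v == 0).
Qed.

Lemma hom_plin d y p q u v : hom d (plin y p q) u v = cross y (hom d p u v) (hom d q u v).
Proof.
by case: y => [z|]//=; rewrite -scaleNr -[p in LHS]scale1r hom_linear mul1r mulNr.
Qed.

Lemma hom_linprod rs u v : hom (size rs) (linprod rs) u v = \prod_(x <- rs) cross x u v.
Proof.
rewrite homE phom_prod_lin horner_prod; apply: eq_bigr => -[z|] _ /=.
  by rewrite -mul_polyC !hornerE.
by rewrite hornerE.
Qed.

Lemma linprod_mem rs u v : (u != 0) || (v != 0) ->
  (hom (size rs) (linprod rs) u v == 0) = (pt u v \in rs).
Proof.
move=> uv; rewrite hom_linprod; elim: rs => [|x rs IH].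
  by rewrite big_nil oner_eq0.
by rewrite big_cons mulf_eq0 IH cross_eq0// in_cons.
Qed.

(** * Fibres as lists of points with multiplicity *)

Definition fibre_spec f d y (rs : seq sphere) := size rs = d /\
  exists2 c, c != 0 & plin y (numden f).1 (numden f).2 = c *: linprod rs.

(** The list is chosen once for each [y] and determined up to permutation ([fib_perm]); sums over
    preimages become sums over lists of fixed length. *)
Definition fib f y : seq sphere := xget [::] [set rs | fibre_spec f (ratdeg f) y rs].

Lemma size_plin d y p q : (size p <= d.+1)%N -> (size q <= d.+1)%N ->
  (size (plin y p q) <= d.+1)%N.
Proof.
case: y => [z|]//= sp sq; apply: leq_trans (size_polyD _ _) _.
by rewrite geq_max sp size_polyN (leq_trans (size_scale_leq _ _)).
Qed.

Lemma hrep_neq0 d p q f u v : hrep d p q f -> (u != 0) || (v != 0) ->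
  (hom d p u v != 0) || (hom d q u v != 0).
Proof.
move=> [d0 sp sq nz fE]; rewrite -negb_and => uv; rewrite -negb_and.
apply: contra uv => /andP[/eqP a /eqP b].
by have [-> ->] := nz _ _ a b; rewrite eqxx.
Qed.

(** If the form of the fibre vanished, one of two coprime polynomials would be a multiple of the
    other, and both would be constant. *)
Lemma hrep_plin_neq0 d p q f y : hrep d p q f -> plin y p q != 0.
Proof.
move=> rf; have [d0 sp sq nz fE] := rf; apply/negP => /eqP N0.
have E u v : (u != 0) || (v != 0) -> f (pt u v) = y.
  move=> uv; apply/eqP; rewrite fE// -cross_eq0; last exact: hrep_neq0 rf _.
  by rewrite -hom_plin N0 /hom; apply/eqP; apply: big1 => i _; rewrite coef0 mul0r.
have [u [v [uv zE]]] : exists u v, ((u != 0) || (v != 0)) /\ pt u v = if y is Some _ then None else Some 0.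
  by case: (y) => [_|]; [exists 1, 0|exists 0, 1]; rewrite /pt ?eqxx oner_eq0 ?mul0r ?orbT.
have [cpq m1] := hrep_ratrep rf.
have : (size p <= 1)%N /\ (size q <= 1)%N.
  case: cpq => /= cpq _ _; case: (y) N0 cpq => [a|] /=.
    move/eqP; rewrite subr_eq0 => /eqP ->.
    have [->|a0] := eqVneq a 0; first by rewrite scale0r coprime0p size_poly0 => /eqp_size; rewrite size_poly1 => ->.
    by rewrite coprimepZl// coprimepp => /eqP sq1; rewrite size_scale// sq1.
  by move=> ->; rewrite coprimep0 size_poly0 => /eqp_size; rewrite size_poly1 => ->.
by move: m1 d0; rewrite /maxn; case: ifP; lia.
Qed.

Lemma fibP f y : rational_map f -> fibre_spec f (ratdeg f) y (fib f y).
Proof.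
move=> rat; have rf := numdenP rat; have [d0 sp sq nz fE] := rf.
rewrite /fib; apply: xgetPex.
have N0 := hrep_plin_neq0 y rf.
have [rs srs NE] := form_roots N0 (size_plin y sp sq).
by exists rs; split=> //; exists (lead_coef (plin y (numden f).1 (numden f).2)); rewrite ?lead_coef_eq0.
Qed.

Lemma size_fib f y : rational_map f -> size (fib f y) = ratdeg f.
Proof. by move=> /(fibP y)[]. Qed.

Lemma mem_fib f y x : rational_map f -> (x \in fib f y) = (f x == y).
Proof.
move=> rat; have rf := numdenP rat; have [d0 sp sq nz fE] := rf.
have [srs [c c0 NE]] := fibP y rat.
have [u [v [uv ->]]] := pt_surj x.
rewrite fE// -cross_eq0; last exact: hrep_neq0 rf _.
rewrite -hom_plin NE -(addr0 (_ *: _)) -(scale0r 0) hom_linear mul0r addr0 mulf_eq0 (negbTE c0)/=.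
by rewrite -srs linprod_mem.
Qed.

Lemma count_fib f x : rational_map f ->
  count_mem x (fib f (f x)) = preim_mult f x.
Proof.
move=> rat; have rf := numdenP rat; have [d0 sp sq nz fE] := rf.
have [srs [c c0 NE]] := fibP (f x) rat.
rewrite /preim_mult; case: (numden f) NE => p q /= NE.
have -> : (if f x is Some y then p - y *: q else q) = plin (f x) p q by [].
rewrite NE; case: x {NE} (fib _ _) srs => [z|] rs srs.
  by rewrite mupZl// prod_lin_mup.
by rewrite size_scale// -srs prod_lin_size.
Qed.

Lemma fib_perm f y rs : rational_map f -> fibre_spec f (ratdeg f) y rs ->
  perm_eq (fib f y) rs.
Proof.
move=> rat [srs [c c0 NE]]; have [srs' [c' c'0 NE']] := fibP y rat.
by apply: (prod_lin_perm c'0); rewrite ?srs' ?srs// -NE' NE.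
Qed.

Lemma lyubich_funE f (phi : sphere -> Cplx R) y : rational_map f ->
  lyubich_fun f phi y = (ratdeg f)%:R^-1 * \sum_(x <- fib f y) phi x.
Proof.
move=> rat; rewrite /lyubich_fun; congr (_ * _).
rewrite -[RHS]big_undup_iterop_count/=.
have -> : f @^-1` [set y] = [set` undup (fib f y)].
  apply/seteqP; split => x /=; first by move=> <-; rewrite mem_undup mem_fib.
  by rewrite mem_undup mem_fib// => /eqP.
rewrite -fsbig_seq ?undup_uniq//; rewrite !big_seq; apply: eq_bigr => x.
rewrite mem_undup mem_fib// => /eqP fx.
by rewrite -fx count_fib// mulr_natl.
Qed.

Lemma ratdeg_gt0 (f : sphere -> sphere) : rational_map f -> (0 < ratdeg f)%N.
Proof. by move=> /numdenP[]. Qed.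

Lemma linprod_cat rs rs' : linprod (rs ++ rs') = linprod rs * linprod rs'.
Proof. exact: big_cat. Qed.

Lemma ratio_pt u v : (u != 0) || (v != 0) ->
  exists2 c, c != 0 & u = c * nume (pt u v) /\ v = c * deno (pt u v).
Proof.
rewrite /pt; have [->|v0 _] := eqVneq v 0 => /=.
  by rewrite orbF => uv; exists u => //; rewrite mulr1 mulr0.
by exists v => //; rewrite mulr1 mulrC divfK.
Qed.

Lemma size_phom d d' N P Q : (size P <= d'.+1)%N -> (size Q <= d'.+1)%N ->
  (size (phom d N P Q) <= (d * d').+1)%N.
Proof.
move=> sP sQ; apply: (leq_trans (size_sum _ _ _)).
apply/bigmax_leqP => i _; apply: (leq_trans (size_scale_leq _ _)).
apply: (leq_trans (size_polyMleq _ _)).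
have := size_poly_exp_leq P i; have := size_poly_exp_leq Q (d - i).
have hi : (i <= d)%N by rewrite -ltnS.
have a : ((size P).-1 * i <= d' * i)%N by rewrite leq_mul2r; case: (size P) sP; lia.
have b : ((size Q).-1 * (d - i) <= d' * (d - i))%N by rewrite leq_mul2r; case: (size Q) sQ; lia.
have half_disc : (d' * i + d' * (d - i) = d * d')%N by rewrite -mulnDr subnKC// mulnC.
move: a b half_disc; move: (_.-1 * _)%N (_.-1 * _)%N (d' * _)%N (d' * _)%N (d * d')%N (size (P ^+ i)) (size (Q ^+ (d - i))).
lia.
Qed.

Lemma coefM_top a b P Q : (size P <= a.+1)%N -> (size Q <= b.+1)%N ->
  (P * Q)`_(a + b) = P`_a * Q`_b.
Proof.
move=> sP sQ; have ia : (a < (a + b).+1)%N by rewrite ltnS leq_addr.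
rewrite coefM (bigD1 (Ordinal ia))//= addKn big1 ?addr0// => i.
rewrite -val_eqE/= neq_ltn => /orP[] h.
  by rewrite [Q`__]nth_default ?mulr0//; apply: (leq_trans sQ); lia.
by rewrite [P`__]nth_default ?mul0r//; apply: (leq_trans sP); lia.
Qed.

Lemma coefX_top a P n : (size P <= a.+1)%N ->
  (P ^+ n)`_(a * n) = P`_a ^+ n.
Proof.
move=> sP; elim: n => [|n IH]; first by rewrite muln0 !expr0 coef1 eqxx.
rewrite mulnS !exprS coefM_top ?IH//.
apply: (leq_trans (size_poly_exp_leq _ _)); rewrite ltnS leq_mul2r.
by case: (size P) sP; lia.
Qed.

(** Away from [v = 0] this is evaluation at [u / v]; at infinity the coefficients of top degree are
    compared, which are multiplicative once the degree bounds are fixed. *)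
Lemma hom_phom d d' N P Q u v : (size P <= d'.+1)%N -> (size Q <= d'.+1)%N ->
  hom (d * d') (phom d N P Q) u v = hom d N (hom d' P u v) (hom d' Q u v).
Proof.
move=> sP sQ; have [->|v0] := eqVneq v 0; last first.
  rewrite hom_div ?size_phom// horner_phom (hom_div _ sP)// (hom_div _ sQ)// homZ.
  by rewrite mulnC exprM.
rewrite !hom_v0 ![_`_d' * _]mulrC homZ -exprM [(d' * d)%N]mulnC mulrC.
congr (_ * _); rewrite /phom coef_sum; apply: eq_bigr => i _.
have hi : (i <= d)%N by rewrite -ltnS.
rewrite coefZ; congr (_ * _).
have -> : (d * d' = d' * i + d' * (d - i))%N by rewrite -mulnDr subnKC// mulnC.
rewrite coefM_top ?coefX_top//.
- apply: (leq_trans (size_poly_exp_leq _ _)); rewrite ltnS leq_mul2r.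
  by case: (size P) sP; lia.
- apply: (leq_trans (size_poly_exp_leq _ _)); rewrite ltnS leq_mul2r.
  by case: (size Q) sQ; lia.
Qed.

Lemma hrep_comp d p q f d' p' q' g : hrep d p q f -> hrep d' p' q' g ->
  hrep (d * d') (phom d p p' q') (phom d q p' q') (f \o g).
Proof.
move=> rf rg; have [d0 sp sq nz fE] := rf; have [d0' sp' sq' nz' gE] := rg.
split; rewrite ?muln_gt0 ?d0 ?size_phom//.
- by move=> u v; rewrite !hom_phom// => a b; have [] := nz _ _ a b; exact: nz'.
- move=> u v uv /=; rewrite gE// fE; last exact: hrep_neq0 rg _.
  by rewrite !hom_phom.
Qed.

Lemma rational_comp (f g : sphere -> sphere) : rational_map f -> rational_map g ->
  rational_map (f \o g) /\ ratdeg (f \o g) = (ratdeg f * ratdeg g)%N.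
Proof. by move=> /numdenP rf /numdenP rg; exact: hrep_rational (hrep_comp rf rg). Qed.

Lemma plin_linear y a P Q : plin y (a *: P) (a *: Q) = a *: plin y P Q.
Proof. by case: y => //= z; rewrite scalerBr !scalerA mulrC. Qed.

Lemma plin_phom y d p q P Q : plin y (phom d p P Q) (phom d q P Q) = phom d (plin y p q) P Q.
Proof.
by case: y => //= z; rewrite -[in RHS]scaleNr -[X in phom _ (X + _)]scale1r phom_linear scale1r scaleNr.
Qed.

(** Substituting the forms of [g] into the factorization of the fibre of [f] over [y] turns each
    factor into the form of a fibre of [g]; this keeps track of multiplicities. *)
Lemma fib_comp f g y : rational_map f -> rational_map g ->
  perm_eq (fib (f \o g) y) (flatten [seq fib g x | x <- fib f y]).
Proof.
move=> rf rg; have [rfg dfg] := rational_comp rf rg.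
have [hf hg] := (numdenP rf, numdenP rg).
apply: fib_perm => //; split.
  rewrite dfg -(size_fib y rf) size_flatten /shape -map_comp.
  elim: (fib f y) => //= x s ->; rewrite (size_fib x rg) mulSn//.
have [] := hrep_ratrep (hrep_comp hf hg).
case: (numdenP rfg) => _ _ _ _ _ h _.
have /(ratrep_inj h) : ratrep (f \o g) (numden (f \o g)).
  by rewrite /numden; apply: xgetPex; case: rfg => pq ?; exists pq.
case: (numden (f \o g)) => p q /= [c c0 [-> ->]].
rewrite plin_linear plin_phom.
have [srs [c' c'0 ->]] := fibP y rf.
rewrite phomZ -srs phom_prod_lin.
elim: (fib f y) => /= [|x s [c'' c''0 /(congr1 (fun P => plin x (numden g).1 (numden g).2 * P))]].
  by exists (c * c'); rewrite ?mulf_neq0// big_nil linprod_nil scalerA.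
rewrite big_cons linprod_cat.
have [_ [c3 c30 NE]] := fibP x rg; rewrite NE -!scalerAr => E.
exists (c3 * c''); first by rewrite mulf_neq0.
by rewrite E -!scalerAl !scalerA [c'' * _]mulrC.
Qed.

End Forms.

(** * Topology of the sphere and continuity of fibres *)

Section SphereTopology.
Context (R : realType).
Local Notation C := (Cplx R).
Local Notation sphere := (sphere R).
Local Notation N := (@rnorm R C).

Lemma rnorm0 : N 0 = 0. Proof. by rewrite /rnorm normr0. Qed.

Lemma rnormM (z w : C) : N ((z : R[i]) * w) = N z * N w.
Proof. exact: rnormZ. Qed.

Lemma rnormN (z : C) : N (- z) = N z.
Proof. by rewrite /rnorm normrN. Qed.

Lemma rnorm_distC (z w : C) : N (z - w) = N (w - z).
Proof. by rewrite -rnormN opprB. Qed.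

Lemma rnorm_eq0 (z : C) : (N z == 0) = (z == 0).
Proof. by apply/eqP/eqP => [/rnorm0_eq0//|->]; rewrite rnorm0. Qed.

Lemma rnorm_gt0 (z : C) : (0 < N z) = (z != 0).
Proof. by rewrite lt_def rnorm_ge0 andbT rnorm_eq0. Qed.

Lemma rnormR (x : R) : N x%:C = `|x|.
Proof. by rewrite /rnorm normc_def/= expr0n addr0 sqrtr_sqr. Qed.

Lemma rnorm_complex (x y : R) : N (x +i* y) <= `|x| + `|y|.
Proof.
rewrite (complexE (x +i* y))/=; apply: (le_trans (rnormD _ _)).
rewrite rnormR rnormM rnormR lerD2l.
by rewrite {1}/rnorm normc_def/= expr0n expr1n add0r sqrtr1 mul1r.
Qed.

Lemma Re_rnorm (z : C) : `|complex.Re z| <= N z.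
Proof. by rewrite -lecR -rnormE; exact: normc_ge_Re. Qed.

Lemma Im_rnorm (z : C) : `|complex.Im z| <= N z.
Proof.
have := Re_rnorm ((z : R[i]) * 'i%C); rewrite ReiNIm normrN => /le_trans; apply.
by rewrite rnormM [N 'i]/rnorm normc_def/= expr0n expr1n add0r sqrtr1 mulr1.
Qed.

Lemma rnormV (z : C) : N (z : R[i])^-1 = (N z)^-1.
Proof.
have [->|z0] := eqVneq z 0; first by rewrite invr0 rnorm0 invr0.
apply: (mulfI (x := N z)); first by rewrite rnorm_eq0.
by rewrite -rnormM !divff ?rnorm_eq0// rnormR normr1.
Qed.

Lemma nbhs_rnorm (z : C) (A : set C) :
  nbhs z A <-> exists2 r : R, 0 < r & forall w, N (w - z) < r -> A w.
Proof.
split=> [/nbhs_ballP[e /= e0 eA]|[r r0 rA]].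
  exists (complex.Re e); first by move: e0; rewrite ltcE => /andP[].
  move=> w wz; apply: eA; rewrite -ball_normE/= rnormE rnorm_distC.
  move: e0; rewrite ltcE/= => /andP[/eqP e0 _]; rewrite ltcE/= e0 eqxx//.
apply/nbhs_ballP; exists r%:C; first by rewrite /= ltcR.
move=> w; rewrite -ball_normE/= rnormE ltcR rnorm_distC; exact: rA.
Qed.

Lemma lipschitz_continuous (f : C -> R) :
  (forall z w, `|f w - f z| <= N (w - z)) -> continuous f.
Proof.
move=> fL z A /nbhs_ballP[e /= e0 eA]; apply/nbhs_rnorm; exists e => // w wz.
by apply: eA; rewrite -ball_normE/= distrC; exact: le_lt_trans (fL _ _) wz.
Qed.

Lemma continuous_rnorm : continuous N.
Proof.
apply: lipschitz_continuous => z w; rewrite ler_norml; apply/andP; split.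
  by rewrite lerNl opprB lerBlDr rnorm_distC; apply: le_trans (rnormD _ _); rewrite subrK.
by rewrite lerBlDr; apply: le_trans (rnormD _ _); rewrite subrK.
Qed.

Lemma continuous_Re : continuous (fun z : C => complex.Re z).
Proof.
by apply: lipschitz_continuous => z w; apply: le_trans (Re_rnorm _); rewrite raddfB.
Qed.

Lemma continuous_complex : continuous (fun xy : R * R => (xy.1 +i* xy.2)%C : C).
Proof.
move=> -[x y] A /nbhs_rnorm[r r0 rA].
rewrite nbhs_simpl/=; exists (ball x (r / 2), ball y (r / 2)).
  by split; apply: nbhsx_ballx; rewrite divr_gt0.
move=> [x' y'] /= [hx hy]; apply: rA; rewrite [_ - _]/=.
apply: le_lt_trans (rnorm_complex _ _) _.
move: hx hy; rewrite -!ball_normE/= => hx hy.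
by rewrite [X in _ < X](splitr r); apply: ltrD; rewrite distrC.
Qed.

Lemma compact_rnorm (r : R) : compact [set z : C | N z <= r].
Proof.
have K : compact ((fun xy : R * R => (xy.1 +i* xy.2)%C : C) @` (`[- r, r] `*` `[- r, r])).
  apply: continuous_compact; first by apply: continuous_subspaceT; exact: continuous_complex.
  by apply: compact_setX; exact: segment_compact.
apply: subclosed_compact K _.
  apply: (@preimage_closed _ _ _ [set x | x <= r]); last exact: closed_le.
  by move=> z _; exact: continuous_rnorm.
move=> z /= zr; exists (complex.Re z, complex.Im z); last by case: z {zr}.
split; rewrite /= in_itv/= -ler_norml; apply: le_trans zr.
  exact: Re_rnorm.
exact: Im_rnorm.
Qed.

Lemma Cplx_hausdorff : hausdorff_space C.
Proof. exact: norm_hausdorff. Qed.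

Lemma Cplx_locally_compact : locally_compact [set: C].
Proof.
move=> z _; exists [set w | N w <= N z + 1].
  rewrite withinET; apply/nbhs_rnorm; exists 1 => // w wz /=.
  rewrite -lerBlDl; apply: le_trans (ltW wz).
  by rewrite lerBlDr; apply: le_trans (rnormD _ _); rewrite subrK.
split; first exact: compact_rnorm.
apply: (@preimage_closed _ _ _ [set x | x <= N z + 1]); last exact: closed_le.
by move=> w _; exact: continuous_rnorm.
Qed.

Lemma sphere_compact : compact [set: sphere].
Proof. exact: one_point_compactification_compact. Qed.

Lemma sphere_hausdorff : hausdorff_space sphere.
Proof.
exact: one_point_compactification_hausdorff Cplx_locally_compact Cplx_hausdorff.
Qed.

Lemma sphere_creg : completely_regular_space sphere.
Proof.
refine (@one_point_compactification_completely_reg C R Cplx_locally_compact Cplx_hausdorff).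
Qed.

Lemma nbhs_Some (z : C) (A : set sphere) :
  nbhs (Some z : sphere) A <-> nbhs z (Some @^-1` A).
Proof. by []. Qed.

Lemma nbhs_None (A : set sphere) : nbhs (None : sphere) A <->
  A None /\ exists r : R, forall z, r < N z -> A (Some z).
Proof.
split=> [[K [cK clK] KA]|[A0 [r rA]]].
  split; first by apply: KA; right.
  have cNK : compact (N @` K).
    by apply: continuous_compact cK; apply: continuous_subspaceT; exact: continuous_rnorm.
  have [M [_ hM]] := compact_bounded cNK.
  exists (M + 1) => z hz; apply: KA; left; exists z => //= Kz.
  have := hM (M + 1); rewrite ltrDl ltr01 => /(_ isT (N z)).
  by move=> /(_ (ex_intro2 _ _ z Kz erefl)) /=; rewrite ger0_norm ?rnorm_ge0// leNgt hz.
exists [set z | N z <= r].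
  split; first exact: compact_rnorm.
  apply: (@preimage_closed _ _ _ [set x | x <= r]); last exact: closed_le.
  by move=> w _; exact: continuous_rnorm.
move=> [z|] [[w /= hw [<-]]|]//; apply: rA; rewrite ltNge; exact/negP.
Qed.

(** * Charts of the sphere and continuity of rational maps *)

Definition chu (x : sphere) (w : C) : C := if x is Some z then z + w else 1.
Definition chv (x : sphere) (w : C) : C := if x is Some z then 1 else w.
(* A coordinate of the sphere centred at [x]. *)
Definition chart (x : sphere) (w : C) : sphere := pt (chu x w) (chv x w).

Lemma ptz1 (z : C) : pt z 1 = Some z.
Proof. by rewrite /pt oner_eq0 divr1. Qed.

Lemma chuv_neq0 x w : (chu x w != 0) || (chv x w != 0).
Proof. by case: x => [z|] /=; rewrite oner_eq0 ?orbT. Qed.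

Lemma chart0 x : chart x 0 = x.
Proof. by case: x => [z|] /=; rewrite /chart/= ?addr0 ?ptz1// /pt eqxx. Qed.

(** Local statements at any point, infinity included, thereby become statements about polynomials
    near [0]. *)
Lemma nbhs_chart x (A : set sphere) :
  nbhs x A <-> nbhs (0 : C) (fun w => A (chart x w)).
Proof.
case: x => [z|] /=.
  split => [/nbhs_Some|] /nbhs_rnorm[r r0 rA].
    apply/nbhs_rnorm; exists r => // w; rewrite subr0 => wr.
    by rewrite /chart/= ptz1; apply: rA; rewrite addrC addKr.
  apply/nbhs_Some/nbhs_rnorm; exists r => // w wr; rewrite /=.
  by have := rA (w - z); rewrite subr0 /chart/= ptz1 [z + _]addrC subrK; apply.
split => [/nbhs_None[A0 [r rA]]|/nbhs_rnorm[r r0 rA]].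
  apply/nbhs_rnorm; exists (`|r| + 1)^-1; first by rewrite invr_gt0 ltr_wpDl.
  move=> w; rewrite subr0 /chart /pt/=; case: eqVneq => // w0 wr.
  apply: rA; rewrite div1r rnormV; apply: (@lt_trans _ _ (`|r| + 1)).
    by rewrite (le_lt_trans (ler_norm _))// ltrDl.
  by rewrite -ltf_pV2 ?invrK ?posrE ?invr_gt0 ?rnorm_gt0// ltr_wpDl.
apply/nbhs_None; split.
  by have := rA 0; rewrite subr0 rnorm0 /chart /pt/= eqxx => /(_ r0).
exists r^-1 => z rz.
have z0 : z != 0.
  by rewrite -rnorm_gt0 (lt_trans _ rz)// invr_gt0.
have := rA ((z : R[i])^-1 : C); rewrite subr0 rnormV /chart /pt/= invr_eq0 (negbTE z0) invrK mul1r; apply.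
by rewrite -[X in _ < X]invrK ltf_pV2 ?posrE ?invr_gt0 ?rnorm_gt0.
Qed.

Lemma cvgC_M (T : Type) (F : set_system T) (FF : Filter F) (f g : T -> C) (a b : C) :
  f @ F --> a -> g @ F --> b -> (fun t => (f t : R[i]) * g t : C) @ F --> ((a : R[i]) * b : C).
Proof. by move=> fa gb; exact: (@cvgM R[i] T F FF f g a b fa gb). Qed.

Lemma cvgC_V (T : Type) (F : set_system T) (FF : Filter F) (g : T -> C) (b : C) :
  b != 0 -> g @ F --> b -> (fun t => (g t : R[i])^-1 : C) @ F --> ((b : R[i])^-1 : C).
Proof. by move=> b0 gb; exact: (@cvgV R[i] T F FF g b b0 gb). Qed.

(** A finite limit is a limit of quotients [f / g]; a limit at infinity is read on [g / f], the
    coordinate there. *)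
Lemma cvg_pt (T : Type) (F : set_system T) (FF : Filter F) (f g : T -> C) (a b : C) :
  f @ F --> a -> g @ F --> b -> (a != 0) || (b != 0) ->
  (fun t => pt (f t) (g t)) @ F --> (pt a b : sphere).
Proof.
move=> fa gb.
have nz (h : T -> C) (c : C) : h @ F --> c -> c != 0 -> \forall t \near F, h t != 0.
  move=> hc c0; have : nbhs c [set w : C | w != 0]; last by exact: hc.
  apply/nbhs_rnorm; exists (N c); first by rewrite rnorm_gt0.
  by move=> w; apply: contraTneq => ->; rewrite sub0r rnormN ltxx.
have [b0|b0] := eqVneq b 0; last first.
  move=> _ A; rewrite /pt (negbTE b0) => /nbhs_Some nA.
  have : (fun t => (f t : R[i]) / g t) @ F --> ((a : R[i]) / b : C).
    exact: (@cvgC_M T F FF f (fun t => (g t : R[i])^-1) a ((b : R[i])^-1) fa (@cvgC_V T F FF g b b0 gb)).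
  move=> /(_ _ nA) /=; apply: filterS2 (nz _ _ gb b0) => t gt0 /=.
  by rewrite (negbTE gt0).
rewrite b0 orbF => a0 A; rewrite /pt eqxx => /nbhs_chart /= nA.
have : (fun t => (g t : R[i]) / f t) @ F --> (0 : C).
  by rewrite -(mul0r (a : R[i])^-1) -b0; exact: (@cvgC_M T F FF g (fun t => (f t : R[i])^-1) b ((a : R[i])^-1) gb (@cvgC_V T F FF f a a0 fa)).
move=> /(_ _ nA) /=; apply: filterS2 (nz _ _ fa a0) => t ft0 /=.
suff -> : chart None ((g t : R[i]) / f t) = pt (f t) (g t) by [].
by rewrite /chart/= -(ptZ _ _ ft0) mulr1 mulrC divfK.
Qed.

Lemma continuous_horner (p : {poly R[i]}) : continuous (fun z : C => p.[z] : C).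
Proof.
elim/poly_ind: p => [|p c IH] z; rewrite /continuous_at.
  have -> : (fun z : C => (0 : {poly R[i]}).[z] : C) = cst 0 by apply/funext => w; rewrite horner0.
  by rewrite horner0; exact: (@cvg_cst C 0 C (nbhs z) _).
have -> : (fun z : C => (p * 'X + c%:P).[z] : C) = (fun z => p.[z] * z + c).
  by apply/funext => w; rewrite hornerMXaddC.
rewrite /= hornerMXaddC.
have FF : Filter (nbhs (z : C)) by exact: nbhs_filter.
have h1 := @cvgC_M C (nbhs (z : C)) FF _ _ _ _ (IH z) (fun A nA => nA).
have h2 := @cvg_cst C c C (nbhs (z : C)) FF.
exact: (@cvgD R[i] C C (nbhs (z : C)) FF _ _ _ _ h1 h2).
Qed.

Definition revp d (p : {poly R[i]}) := \poly_(i < d.+1) p`_(d - i).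

(* The form of degree [d] given by [p], read in the coordinate [chart x]. *)
Definition loc (x : sphere) d (p : {poly R[i]}) : {poly R[i]} :=
  if x is Some z then p \Po ('X + z%:P) else revp d p.

Lemma horner_loc x d (p : {poly R[i]}) (w : R[i]) : (size p <= d.+1)%N ->
  (loc x d p).[w] = hom d p (chu x w) (chv x w).
Proof.
move=> sp; case: x => [z|] /=.
  by rewrite hom_v1// horner_comp !hornerE addrC.
rewrite horner_poly /hom (reindex_inj rev_ord_inj)/=; apply: eq_bigr => i _.
by rewrite expr1n mul1r subSS; congr (p`_ _ * _); rewrite subKn// -ltnS.
Qed.

Lemma loc_linear x d a b (p q : {poly R[i]}) :
  loc x d (a *: p + b *: q) = a *: loc x d p + b *: loc x d q.
Proof.
case: x => [z|] /=; first by rewrite comp_polyD !comp_polyZ.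
by apply/polyP => i; rewrite !coefE; case: ifP; rewrite ?mulr0 ?addr0// !coefE.
Qed.

Lemma size_loc x d (p : {poly R[i]}) : (size p <= d.+1)%N -> (size (loc x d p) <= d.+1)%N.
Proof.
move=> sp; case: x => [z|] /=; last exact: size_poly.
apply: leq_trans sp; rewrite size_comp_poly2// -[z%:P]opprK -polyCN; exact: size_XsubC.
Qed.

Lemma rational_continuous (f : sphere -> sphere) : rational_map f -> continuous f.
Proof.
move=> /numdenP rf; have [d0 sp sq nz fE] := rf; move=> x A.
move=> nA; apply/nbhs_chart.
pose P := loc x (ratdeg f) (numden f).1; pose Q := loc x (ratdeg f) (numden f).2.
have E w : f (chart x w) = pt P.[w] Q.[w].
  by rewrite /chart fE ?chuv_neq0// !horner_loc.
have nz0 : (P.[0] != 0) || (Q.[0] != 0).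
  by rewrite !horner_loc// (hrep_neq0 rf)// chuv_neq0.
have := @cvg_pt C (nbhs (0 : C)) _ _ _ _ _ (continuous_horner (p:=P) (x:=0)) (continuous_horner (p:=Q) (x:=0)) nz0.
rewrite -E chart0 => /(_ (nbhs_filter _) _ nA) /=.
have -> : (fun w => A (f (chart x w))) = (fun w => A (pt P.[w] Q.[w])).
  by apply/funext => w; rewrite E.
by [].
Qed.

(** * Semicontinuity of multiplicities and continuity of fibres *)

Lemma poly_ext (p q : {poly R[i]}) : (forall w, p.[w] = q.[w]) -> p = q.
Proof.
move=> h; apply/eqP; rewrite -subr_eq0; apply/negPn/negP => /closed_nonrootP[w].
by rewrite rootE !hornerE h subrr eqxx.
Qed.

(* If [F] has more than [m] roots near [0], then its coefficient of degree [m] is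
   small; this makes the multiplicity of a root upper semicontinuous. *)
Lemma coef_small_roots (s : seq R[i]) m (F G : {poly R[i]}) (B r : R) :
  size s = m.+1 -> F = \prod_(w <- s) ('X - w%:P) * G ->
  (forall i, N F`_i <= B) -> (forall w, w \in s -> N w <= r) -> r <= 2^-1 ->
  N F`_m <= r * 4 ^+ m.+1 * B.
Proof.
elim: s m F B => // w s IH m F B [sm] FE FB sr r2.
have B0 : 0 <= B by apply: le_trans (FB 0%N); exact: rnorm_ge0.
have r0 : 0 <= r by apply: le_trans (sr w (mem_head _ _)); exact: rnorm_ge0.
pose F' := \prod_(w <- s) ('X - w%:P) * G.
have FF' : F = ('X - w%:P) * F' by rewrite FE big_cons mulrA.
have wr : N w <= r by apply: sr; rewrite mem_head.
have rec i : F`_i.+1 = F'`_i - w * F'`_i.+1.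
  by rewrite FF' mulrBl coefB coefXM coefCM.
(* Division by [X - w] with [|w| <= 1/2] at most doubles the bound: descending induction along
   [F'_i = F_(i+1) + w F'_(i+1)], started where [F'_i = 0]. *)
have F'B i : N F'`_i <= 2 * B.
  have [k] := ubnP (size F' - i); elim: k i => // k IHk i ki.
  have [si|si] := leqP (size F') i.
    by rewrite nth_default// rnorm0 mulr_ge0.
  have -> : F'`_i = F`_i.+1 + w * F'`_i.+1 by rewrite rec subrK.
  apply: (le_trans (rnormD _ _)); rewrite mulrDl mul1r lerD//.
  rewrite rnormM; apply: (@le_trans _ _ (2^-1 * (2 * B))); last by rewrite mulKf.
  apply: ler_pM; rewrite ?rnorm_ge0//; first exact: le_trans wr r2.
  by apply: IHk; lia.
case: m sm => [/size0nil s0|m sm].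
  rewrite FF' mulrBl coefB coefXM coefCM sub0r rnormN rnormM expr1 -mulrA.
  apply: ler_pM; rewrite ?rnorm_ge0//; apply: (le_trans (F'B _)).
  by rewrite ler_wpM2r// ler_nat.
rewrite rec; apply: (le_trans (rnormD _ _)); rewrite rnormN rnormM.
have h1 : N F'`_m <= r * 4 ^+ m.+1 * (2 * B).
  by apply: IH => // v vs; apply: sr; rewrite in_cons vs orbT.
have h2 : N w * N F'`_m.+1 <= r * (2 * B) by apply: ler_pM; rewrite ?rnorm_ge0.
apply: (le_trans (lerD h1 h2)).
(* One factor [4] per root: half of it pays for the doubled bound on [F'], the other half dominates
   the term [w F'_(m+1)]. *)
have -> : r * 4 ^+ m.+2 * B = r * 4 ^+ m.+1 * (2 * B) + r * (4 ^+ m.+1 * (2 * B)).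
  by rewrite exprSr; ring.
rewrite lerD2l ler_wpM2l// ler_peMl ?mulr_ge0// exprn_ege1// ler1n//.
Qed.

(** The factor [lin x] in the coordinate centred at [x0]; it vanishes at [0] exactly when
    [x = x0]. *)
Definition lloc (x0 x : sphere) : {poly R[i]} :=
  if x0 is Some z then (if x is Some z' then 'X - (z' - z)%:P else 1)
  else (if x is Some z' then 1 - z'%:P * 'X else 'X).

Lemma horner_lloc x0 x w : (lloc x0 x).[w] = cross x (chu x0 w) (chv x0 w).
Proof.
case: x0 => [z|]; case: x => [z'|] //=; rewrite !hornerE//.
by rewrite opprB addrA [w + z]addrC.
Qed.

Lemma loc_linprod x0 c (rs : seq sphere) :
  loc x0 (size rs) (c *: linprod rs) = c *: \prod_(x <- rs) lloc x0 x.
Proof.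
apply: poly_ext => w; rewrite horner_loc; last first.
  by apply: leq_trans (size_scale_leq _ _) (size_prod_lin _).
rewrite -(addr0 (_ *: _)) -(scale0r 0) hom_linear mul0r addr0 hom_linprod.
by rewrite hornerZ horner_prod; congr (_ * _); apply: eq_bigr => x _; rewrite horner_lloc.
Qed.

Lemma lloc_prod_centre x0 (rs : seq sphere) : exists2 G : {poly R[i]}, G.[0] != 0 &
  \prod_(x <- rs) lloc x0 x = 'X^(count_mem x0 rs) * G.
Proof.
elim: rs => [|x rs [G G0 IH]].
  by exists 1; rewrite ?hornerC ?oner_eq0// big_nil expr0 mulr1.
rewrite big_cons IH /=; have [->|xx0] := eqVneq x x0.
  exists G => //; rewrite add1n exprS -mulrA; congr (_ * _).
  by case: x0 {IH} => [z|] //=; rewrite subrr subr0.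
exists (lloc x0 x * G); last by rewrite add0n mulrCA.
rewrite hornerM mulf_neq0// horner_lloc cross_eq0 ?chuv_neq0//.
by rewrite -/(chart x0 0) chart0 eq_sym.
Qed.

Definition cdisc (x0 : sphere) (r : R) : set sphere :=
  [set x | exists2 w : C, N w < r & x = chart x0 w].

Lemma nbhs_cdisc x0 r : 0 < r -> nbhs x0 (cdisc x0 r).
Proof.
move=> r0; apply/nbhs_chart/nbhs_rnorm; exists r => // w.
by rewrite subr0 => wr; exists w.
Qed.

Lemma lloc_prod_disc x0 r (rs : seq sphere) :
  exists s (G : {poly R[i]}), [/\ size s = count (fun x => `[< cdisc x0 r x >]) rs,
    (forall w, w \in s -> N w <= r) &
    \prod_(x <- rs) lloc x0 x = \prod_(w <- s) ('X - w%:P) * G].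
Proof.
elim: rs => [|x rs [s [G [ss sr IH]]]].
  by exists [::], 1; rewrite !big_nil mulr1.
rewrite big_cons IH /=; case: asboolP => [[w wr xE]|_]; last first.
  by exists s, (lloc x0 x * G); rewrite ss mulrCA.
have [k kE] : exists k, lloc x0 x = k *: ('X - w%:P).
  rewrite xE; case: x0 {wr xE IH ss} => [z|].
    by exists 1; rewrite /chart/= ptz1 [z + w]addrC addrK scale1r.
  rewrite /chart/= /pt; have [->|w0] := eqVneq w 0.
    by exists 1; rewrite subr0 scale1r.
  exists (- w^-1); rewrite div1r scalerBr !scaleNr opprK addrC mul_polyC.
  by rewrite -mul_polyC -[w^-1 *: w%:P]mul_polyC -polyCM mulVf.
exists (w :: s), (k *: G); split; first by rewrite /= ss.
  by move=> v; rewrite in_cons => /orP[/eqP->|/sr//]; exact: ltW.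
by rewrite big_cons kE -scalerAl -!scalerAr mulrA.
Qed.

Lemma plin_pt (u v : R[i]) (p q : {poly R[i]}) : (u != 0) || (v != 0) ->
  exists2 k, k != 0 & v *: p - u *: q = k *: plin (pt u v) p q.
Proof.
rewrite /pt; have [->|v0 _] := eqVneq v 0 => /=.
  by rewrite orbF => u0; exists (- u); rewrite ?oppr_eq0// scale0r sub0r scaleNr.
by exists v => //; rewrite scalerBr scalerA mulrCA divff// mulr1.
Qed.

Lemma gt0_quarters (k : R) : 0 < k -> k / 4 + k / 4 < k.
Proof. by lra. Qed.

(** Let [m] be the multiplicity of [x0] in its fibre. In the coordinate at [x0], the coefficient of
    degree [m] of the form of the fibre is nonzero for [y = f x0] and moves little with [y]; more
    than [m] roots in a small disc would force it to be small. *)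
Lemma count_near (f : sphere -> sphere) x0 : rational_map f ->
  exists r V, [/\ 0 < r, nbhs (f x0) V & forall y, V y ->
    (count (fun x => `[< cdisc x0 r x >]) (fib f y) <= count_mem x0 (fib f (f x0)))%N].
Proof.
move=> rat; have rf := numdenP rat; have [d0 sp sq nz fE] := rf.
set y0 := f x0; set d := ratdeg f; set p := (numden f).1; set q := (numden f).2.
(* The form of the fibre over the point of coordinate [s] at [y0]; it is affine in [s], with slope
   [D]. *)
pose L s := loc x0 d (chv y0 s *: p - chu y0 s *: q).
have LE s : exists2 c, c != 0 & L s = c *: \prod_(x <- fib f (chart y0 s)) lloc x0 x.
  have [k k0 kE] := plin_pt p q (chuv_neq0 y0 s).
  have [sr [c c0 cE]] := fibP (chart y0 s) rat.
  exists (k * c); first by rewrite mulf_neq0.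
  by rewrite /L kE cE scalerA -[d]sr loc_linprod.
pose D := if y0 is Some _ then - loc x0 d q else loc x0 d p.
have LD s : L s = L 0 + s *: D.
  rewrite /L -!scaleNr !loc_linear /D; case: (y0) => [z|] /=.
    by rewrite addr0 scalerN opprD scalerDl -scaleNr addrA.
  by rewrite scale0r add0r addrC.
set m := count_mem x0 (fib f y0).
have [c c0 L0E] := LE 0; rewrite chart0 in L0E.
have [G G0 GE] := lloc_prod_centre x0 (fib f y0).
pose K := N (L 0)`_m.
have K0 : 0 < K.
  rewrite /K L0E GE coefZ coefXnM ltnn subnn rnorm_gt0 mulf_neq0//.
  by rewrite -horner_coef0.
have sL s : (size (L s) <= d.+1)%N.
  apply: size_loc; rewrite -scaleNr; apply: leq_trans (size_polyD _ _) _.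
  by rewrite geq_max !(leq_trans (size_scale_leq _ _)).
have sD : (size D <= d.+1)%N.
  by rewrite /D; case: (y0) => [_|]; rewrite ?size_polyN; exact: size_loc.
pose S (p : {poly R[i]}) := \sum_(i < d.+1) N p`_i.
have SB (P : {poly R[i]}) i : (size P <= d.+1)%N -> N P`_i <= S P.
  move=> sP; have [id|id] := ltnP i d.+1; last first.
    rewrite nth_default ?(leq_trans sP)// rnorm0.
    by apply: sumr_ge0 => j _; exact: rnorm_ge0.
  rewrite /S (bigD1 (Ordinal id))//= lerDl.
  by apply: sumr_ge0 => j _; exact: rnorm_ge0.
(* For [|s| <= 1], [B] bounds all coefficients of [L s]. With [eta] and [r] as below, the
   perturbation [s D] and the bound of [coef_small_roots] are each at most [K / 4], while [K] is the
   modulus of the coefficient at [s = 0]. *)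
pose B := 1 + S (L 0) + S D.
have S0 P : 0 <= S P by apply: sumr_ge0 => j _; exact: rnorm_ge0.
have B0 : 0 < B by rewrite /B -addrA ltr_wpDr// addr_ge0.
pose eta := Num.min 1 (K / 4 / B).
pose r := Num.min 2^-1 (K / 4 / (4 ^+ m.+1 * B)).
exists r, (cdisc y0 eta); split.
- by rewrite /r lt_min invr_gt0 ltr0n/= !divr_gt0// mulr_gt0// exprn_gt0.
- by apply: nbhs_cdisc; rewrite /eta lt_min ltr01 !divr_gt0.
move=> y [s sE ->]; rewrite leqNgt; apply/negP => cm.
have [c' c'0 L'E] := LE s.
have [t [G' [st tr G'E]]] := lloc_prod_disc x0 r (fib f (chart y0 s)).
have s1 : N s <= 1 by apply: le_trans (ltW sE) _; rewrite ge_min lexx.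
have bnd : N (L s)`_m <= r * 4 ^+ m.+1 * B.
  apply: (@coef_small_roots (take m.+1 t) _ _ (c' *: (\prod_(w <- drop m.+1 t) ('X - w%:P) * G'))).
  - by rewrite size_takel// st.
  - rewrite L'E G'E -[in LHS](cat_take_drop m.+1 t) big_cat/= -scalerAr; congr (_ *: _).
    by rewrite mulrA.
  - move=> i; rewrite LD coefD coefZ; apply: (le_trans (rnormD _ _)).
    rewrite /B; apply: lerD; first by rewrite ler_wpDl// SB.
    rewrite rnormM; apply: le_trans (SB _ i sD).
    by rewrite ler_piMl// rnorm_ge0.
  - by move=> w /mem_take; exact: tr.
  - by rewrite /r ge_min lexx.
have b1 : r * 4 ^+ m.+1 * B <= K / 4.
  rewrite -mulrA -ler_pdivlMr ?mulr_gt0 ?exprn_gt0//.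
  by rewrite /r ge_min lexx orbT.
have b2 : N s * N D`_m <= K / 4.
  have sB : N s <= K / 4 / B by apply: le_trans (ltW sE) _; rewrite ge_min lexx orbT.
  apply: (@le_trans _ _ (K / 4 / B * B)); last by rewrite divfK// gt_eqF.
  apply: ler_pM; rewrite ?rnorm_ge0//; apply: le_trans (SB _ _ sD) _.
  by rewrite /B lerDr addr_ge0.
have : K <= K / 4 + K / 4.
  apply: le_trans (lerD (le_trans bnd b1) b2).
  rewrite -rnormM -[X in _ + X]rnormN LD coefD coefZ.
  by apply: le_trans (rnormD _ _); rewrite addrK.
by rewrite leNgt gt0_quarters.
Qed.
(** With equal sizes, one-sided bounds on all multiplicities are equalities: this turns upper
    semicontinuity into continuity of fibres. *)
Lemma perm_eq_count_le (T : eqType) (s t : seq T) : size s = size t ->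
  (forall x, (count_mem x s <= count_mem x t)%N) -> perm_eq s t.
Proof.
elim: s t => [|x s IH] t; first by move=> /esym/size0nil->.
move=> st h; have xt : x \in t.
  by rewrite -has_pred1 has_count; apply: leq_trans (h x); rewrite /= eqxx.
rewrite perm_sym (perm_trans (perm_to_rem xt))// perm_cons perm_sym; apply: IH.
  by rewrite size_rem// -st.
move=> z; have := h z; rewrite (permP (perm_to_rem xt)) /=.
by rewrite leq_add2l.
Qed.

Lemma sub_in_count (T : eqType) (a b : pred T) (s : seq T) :
  (forall x, x \in s -> a x -> b x) -> (count a s <= count b s)%N.
Proof.
elim: s => //= x s IH h; apply: leq_add; last first.
  by apply: IH => y ys; apply: h; rewrite in_cons ys orbT.
by have := h x (mem_head _ _); case: (a x) => // /(_ isT) ->.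
Qed.

(** The complement of [U] is compact, so its image is closed; it misses [y0], hence a neighbourhood
    of [y0]. *)
Lemma fib_tube (f : sphere -> sphere) y0 (U : set sphere) : continuous f -> open U ->
  (forall x, f x = y0 -> U x) -> \forall y \near y0, forall x, f x = y -> U x.
Proof.
move=> fc oU Uy0.
have cK : compact (~` U).
  by apply: (@subclosed_compact _ _ setT) => //; [exact: open_closedC|exact: sphere_compact].
have cfK : closed (f @` (~` U)).
  apply: compact_closed; first exact: sphere_hausdorff.
  by apply: continuous_compact cK; exact: continuous_subspaceT.
have : open (~` (f @` (~` U))) by rewrite openC.
rewrite openE => /(_ y0); rewrite /interior => h.
have /h : (~` (f @` (~` U))) y0 by move=> [x nUx fx]; apply: nUx; exact: Uy0.
apply: filterS => y ny x fx; apply: contrapT => nUx; apply: ny.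
by exists x.
Qed.

Lemma near_seq (I : eqType) (s : seq I) (T : topologicalType) (P : I -> set T) (y : T) :
  (forall x, x \in s -> nbhs y (P x)) -> \forall z \near y, forall x, x \in s -> P x z.
Proof.
elim: s => [|x s IH] h; first by apply: nearW.
have h1 := h x (mem_head _ _).
have h2 : \forall z \near y, forall x, x \in s -> P x z.
  by apply: IH => z zs; apply: h; rewrite in_cons zs orbT.
by apply: filterS2 h1 h2 => z a b w; rewrite in_cons => /orP[/eqP->|/b].
Qed.

(** Here [g] matches each point of a nearby fibre with a point of the fibre over [y0] close to it.
    Semicontinuity bounds how often each value is taken, and the two fibres have the same size. *)
Lemma fib_near (f : sphere -> sphere) y0 (A : sphere -> set sphere) :
  rational_map f -> (forall x, nbhs x (A x)) ->
  \forall y \near y0, exists g : sphere -> sphere,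
    perm_eq (map g (fib f y)) (fib f y0) /\ forall x, x \in fib f y -> A (g x) x.
Proof.
move=> rat nA; have fc := rational_continuous rat.
have /choice[rV hrV] : forall x, exists rV : R * set sphere, [/\ 0 < rV.1, nbhs (f x) rV.2 & forall y, rV.2 y ->
    (count (fun x' => `[< cdisc x rV.1 x' >]) (fib f y) <= count_mem x (fib f (f x)))%N].
  by move=> x; have [r [V h]] := count_near x rat; exists (r, V).
pose U := undup (fib f y0).
pose W x := cdisc x (rV x).1 `&` A x.
have nW x : nbhs x (W x).
  by apply: filterI => //; apply: nbhs_cdisc; have [] := hrV x.
have nV : \forall y \near y0, forall x, x \in U -> (rV x).2 y.
  have : forall x, x \in U -> nbhs y0 (rV x).2.
    by move=> x; rewrite mem_undup mem_fib// => /eqP <-; have [] := hrV x.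
  by move=> h; exact: near_seq.
have nT : \forall y \near y0, forall x, f x = y -> exists2 x', x' \in U & W x' x.
  apply: filterS (@fib_tube f y0 (\bigcup_(x in [set` U]) (W x)^°) fc _ _).
  - by move=> y h x /h [x' /= x'U] /interior_subset Wx; exists x'.
  - by apply: bigcup_open => x _; exact: open_interior.
  - by move=> x fx; exists x; [rewrite /= mem_undup mem_fib// fx|exact: nW].
apply: filterS2 nV nT => y yV yT.
pose g x := nth x U (find (fun x' => `[< W x' x >]) U).
have gP x : x \in fib f y -> g x \in U /\ W (g x) x.
  rewrite mem_fib// => /eqP /yT[x' x'U Wx].
  have hs : has (fun x' => `[< W x' x >]) U by apply/hasP; exists x' => //; exact/asboolP.
  by split; [rewrite mem_nth// -has_find|have /asboolP := nth_find x hs].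
exists g; split; last by move=> x /gP[_ []].
apply: perm_eq_count_le; first by rewrite size_map !size_fib.
move=> x; have [xU|xU] := boolP (x \in U); last first.
  rewrite (_ : count_mem x _ = 0%N)//; apply/count_memPn/mapP => -[x' /gP[+ _] E].
  by rewrite -E (negbTE xU).
have [_ _ /(_ _ (yV _ xU))] := hrV x.
have -> : f x = y0 by move: xU; rewrite mem_undup mem_fib// => /eqP.
apply: leq_trans; rewrite count_map.
apply: sub_in_count => x' x'y /eqP gx; apply/asboolP.
by have [_ [Wx _]] := gP _ x'y; rewrite gx in Wx.
Qed.

Lemma rational_open (f : sphere -> sphere) (U : set sphere) :
  rational_map f -> open U -> open (f @` U).
Proof.
move=> rat oU; rewrite openE => _ [x0 Ux0 <-]; rewrite /interior.
(* The neighbourhood is prescribed at points of [U] only; the point matched with [x0] then lies in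
   [U]. *)
have nA x : nbhs x (if `[< U x >] then U else setT).
  by case: asboolP => Ux; [exact: open_nbhs_nbhs|exact: filterT].
apply: filterS (fib_near (f x0) rat nA) => y [g [pg gA]].
have : x0 \in map g (fib f y) by rewrite (perm_mem pg) mem_fib.
case/mapP => x xy xE; exists x; last by apply/eqP; rewrite -mem_fib.
by have := gA _ xy; rewrite -xE; case: asboolP.
Qed.

(** The bound is wanted for every [y], as in [balanced]; cutting the disc by the preimage of the
    interior of [V] leaves nothing in the fibres over the points outside [V]. *)
Lemma fib_count_open (f : sphere -> sphere) x0 : rational_map f ->
  exists W : set sphere, [/\ open W, W x0 & forall y,
    (count (fun x => `[< W x >]) (fib f y) <= count_mem x0 (fib f (f x0)))%N].
Proof.
move=> rat; have fc := rational_continuous rat.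
have [r [V [r0 nV h]]] := count_near x0 rat.
exists ((cdisc x0 r)^° `&` f @^-1` V^°); split.
- apply: openI; first exact: open_interior.
  by apply: open_comp => [x _|]; [exact: fc|exact: open_interior].
- by split; [exact: nbhs_cdisc|exact: nV].
move=> y; have [Vy|nVy] := pselect (V y).
  apply: leq_trans (h _ Vy); apply: sub_count => x /asboolP[+ _].
  by move=> /interior_subset ?; apply/asboolP.
apply: (@leq_trans 0) => //; rewrite leqn0 eqn0Ngt -has_count; apply/hasPn => x.
by rewrite mem_fib// => /eqP fx; apply/asboolP => -[_ /interior_subset]; rewrite /= fx.
Qed.

Lemma sphere_bounded (h : sphere -> C) : continuous h ->
  exists k : R, forall x, N (h x) <= k.
Proof.
move=> hc; have cK : compact ((fun x => N (h x)) @` [set: sphere]).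
  apply: continuous_compact sphere_compact; apply: continuous_subspaceT => x.
  by apply: continuous_comp; [exact: hc|exact: continuous_rnorm].
have [M [_ hM]] := compact_bounded cK.
exists (M + 1) => x; have := hM (M + 1); rewrite ltrDl ltr01 => /(_ isT (N (h x))).
by move=> /(_ (ex_intro2 _ _ x I erefl)) /=; rewrite ger0_norm ?rnorm_ge0.
Qed.

Lemma mem_continuous (h : sphere -> C) (hc : continuous h) :
  mkLinf (sphere_bounded hc) \in @continuous_pred R sphere.
Proof. exact/asboolP. Qed.

Definition mkCb (h : sphere -> C) (hc : continuous h) : Cb R sphere :=
  exist _ (mkLinf (sphere_bounded hc)) (mem_continuous hc).

Lemma Cb_continuous (phi : Cb R sphere) : continuous (phi : sphere -> C).
Proof. by have /asboolP := valP phi. Qed.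

Lemma continuousC (T : topologicalType) (h : T -> C) :
  (forall x (e : R), 0 < e -> \forall y \near x, N (h y - h x) < e) -> continuous h.
Proof.
move=> hh x A /nbhs_rnorm[r r0 rA]; apply: filterS (hh x r r0) => y; exact: rA.
Qed.

Lemma continuousC_near (T : topologicalType) (h : T -> C) x (e : R) :
  continuous h -> 0 < e -> \forall y \near x, N (h y - h x) < e.
Proof.
move=> hc e0; have : nbhs (h x) [set w | N (w - h x) < e].
  by apply/nbhs_rnorm; exists e.
exact: hc.
Qed.

Lemma rnorm_sum_le (I : Type) (s : seq I) (F : I -> C) :
  N (\sum_(i <- s) F i) <= \sum_(i <- s) N (F i).
Proof.
elim: s => [|i s IH]; first by rewrite !big_nil rnorm0.
by rewrite !big_cons; apply: (le_trans (rnormD _ _)); rewrite lerD2l.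
Qed.

Lemma rnorm_nat n : N (n%:R : R[i]) = n%:R.
Proof. by rewrite -(rmorph_nat (real_complex R)) rnormR ger0_norm. Qed.

(** [fib_near] matches the terms of the two sums one by one, each pair differing by less than
    [e]. *)
Lemma lyubich_fun_continuous (f : sphere -> sphere) (phi : sphere -> C) :
  rational_map f -> continuous phi -> continuous (lyubich_fun f phi).
Proof.
move=> rat pc; apply: continuousC => y0 e e0.
have nA x : nbhs x [set x' | N (phi x' - phi x) < e] by exact: continuousC_near.
apply: filterS (fib_near y0 rat nA) => y [g [pg gA]].
rewrite !lyubich_funE// -mulrBr -(perm_big _ pg)/= big_map -sumrB rnormM rnormV rnorm_nat.
rewrite mulrC ltr_pdivrMr ?ltr0n ?ratdeg_gt0//.
apply: (le_lt_trans (rnorm_sum_le _ _)).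
rewrite -(size_fib y rat) big_seq.
have : (0 < size (fib f y))%N by rewrite size_fib// ratdeg_gt0.
rewrite -big_seq mulr_natr; elim: (fib f y) gA => // x s IH gA _.
rewrite big_cons /= mulrS; case: s IH gA => [|z s] IH gA.
  by rewrite big_nil !addr0; exact/gA/mem_head.
apply: ltrD; first exact/gA/mem_head.
by apply: IH => // w ws; apply: gA; rewrite in_cons ws orbT.
Qed.

Lemma lyubichE (f : sphere -> sphere) (phi : Cb R sphere) y : rational_map f ->
  lyubich f phi y = (ratdeg f)%:R^-1 * \sum_(x <- fib f y) phi x.
Proof.
move=> rat; rewrite -(lyubich_funE _ _ rat) /lyubich.
have := @xgetPex _ 0 [set psi : Cb R sphere | forall y, psi y = lyubich_fun f phi y].
move=> /(_ _) h; apply: h.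
by exists (mkCb (lyubich_fun_continuous rat (Cb_continuous (phi:=phi)))).
Qed.
End SphereTopology.

(** * Riesz representation on a compact space *)

Section Riesz.
Context (R : realType) (T : ptopologicalType).
Hypothesis cT : compact [set: T].
Hypothesis crT : completely_regular_space T.
Variable Lam : (T -> R) -> R.
Hypothesis LamD : forall f g : T -> R, continuous f -> continuous g ->
  Lam (fun x => f x + g x) = Lam f + Lam g.
Hypothesis Lam_le : forall f g : T -> R, continuous f -> continuous g ->
  (forall x, f x <= g x) -> Lam f <= Lam g.
Hypothesis Lam_cst : forall c : R, Lam (fun=> c) = c.

(** Test functions vanish off [U] but need not have compact support there; replacing [f] by
    [max (f - e) 0] makes up for this at a cost of [e] ([Lam_cut]). *)
Definition below (U : set T) (f : T -> R) :=
  [/\ continuous f, (forall x, 0 <= f x <= 1) & forall x, ~ U x -> f x = 0].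

Definition lam (U : set T) : R := sup (Lam @` below U).

Lemma continuous_cstR (c : R) : continuous ((fun=> c) : T -> R).
Proof. by move=> x; exact: cvg_cst. Qed.

Lemma below0 U : below U (fun=> 0).
Proof. by split=> [|x|//]; [exact: continuous_cstR|rewrite lexx ler01]. Qed.

Lemma Lam_below01 U f : below U f -> 0 <= Lam f <= 1.
Proof.
move=> [fc f01 _]; apply/andP; split.
  rewrite -(Lam_cst 0); apply: Lam_le => // [|x]; first exact: continuous_cstR.
  by have /andP[] := f01 x.
rewrite -(Lam_cst 1); apply: Lam_le => // [|x]; first exact: continuous_cstR.
by have /andP[] := f01 x.
Qed.

Lemma lam_has_sup U : has_sup (Lam @` below U).
Proof.
split; first by exists (Lam (fun=> 0)), (fun=> 0) => //; exact: below0.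
by exists 1 => _ [f bf <-]; have /andP[] := Lam_below01 bf.
Qed.

Lemma Lam_le_lam U f : below U f -> Lam f <= lam U.
Proof. by move=> bf; apply: ub_le_sup; [have [] := lam_has_sup U|exists f]. Qed.

Lemma lam_le U c : (forall f, below U f -> Lam f <= c) -> lam U <= c.
Proof.
by move=> h; apply: ge_sup; [have [] := lam_has_sup U|move=> _ [f bf <-]; exact: h].
Qed.

Lemma lam_ge0 U : 0 <= lam U.
Proof. by rewrite -[X in X <= _](Lam_cst 0); apply/Lam_le_lam/below0. Qed.

Lemma below_sub U V f : U `<=` V -> below U f -> below V f.
Proof. by move=> UV [fc f01 f0]; split=> // x nV; apply: f0 => /UV. Qed.

Lemma lam_sub U V : U `<=` V -> lam U <= lam V.
Proof. by move=> UV; apply: lam_le => f bf; apply/Lam_le_lam/below_sub/bf. Qed.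

Lemma lam0 : lam set0 = 0.
Proof.
apply/eqP; rewrite eq_le lam_ge0 andbT; apply: lam_le => f [fc _ f0].
rewrite -[X in _ <= X](Lam_cst 0); apply: Lam_le => // [|x]; first exact: continuous_cstR.
by rewrite f0.
Qed.

Lemma lamT : lam setT = 1.
Proof.
apply/eqP; rewrite eq_le; apply/andP; split.
  by apply: lam_le => f /Lam_below01 /andP[].
by rewrite -[X in X <= _](Lam_cst 1); apply: Lam_le_lam; split=> [|x|x /(_ I)//]; [exact: continuous_cstR|rewrite lexx ler01].
Qed.

Lemma continuous_sub_gt0 (f : T -> R) (e : R) : continuous f ->
  continuous (fun x => Num.max (f x - e) 0).
Proof.
move=> fc x; have c1 : continuous (fun x => f x - e).
  by move=> y; apply: cvgB; [exact: fc|exact: cvg_cst].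
exact: (@continuous_max R T (fun x => f x - e) (fun=> 0) x (c1 x) (continuous_cstR (c:=0) (x:=x))).
Qed.

Lemma Lam_cut (f : T -> R) (e : R) : 0 <= e -> continuous f ->
  Lam f <= Lam (fun x => Num.max (f x - e) 0) + e.
Proof.
move=> e0 fc; rewrite -{2}(Lam_cst e) -LamD; first last.
- exact: continuous_cstR.
- exact: continuous_sub_gt0.
apply: Lam_le => //.
  by move=> x; apply: cvgD; [exact: continuous_sub_gt0|exact: cvg_cst].
by move=> x; rewrite -lerBlDr le_max lexx.
Qed.

Lemma open_ltf (f : T -> R) (e : R) : continuous f -> open [set x | f x < e].
Proof. by move=> fc; apply: (@open_comp _ _ f [set y | y < e]); [move=> x _; exact: fc|exact: open_lt]. Qed.

Lemma urysohn_at (U : set T) x : open U -> U x -> exists g : T -> R,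
  [/\ continuous g, (forall y, 0 <= g y), g x = 1 & forall y, ~ U y -> g y = 0].
Proof.
move=> oU Ux; have us : uniform_separator [set x] (~` U).
  by apply: crT; [exact: open_closedC|exact].
have /uniform_separatorP := us => /(_ R)[f [fc f01 fx fU]].
exists (fun y => 1 - f y); split.
- by move=> y; apply: cvgB; [exact: cvg_cst|exact: fc].
- by move=> y; rewrite subr_ge0; have := f01 (f y) (ex_intro2 _ _ y I erefl); rewrite /= in_itv/= => /andP[].
- by have -> : f x = 0; rewrite ?subr0//; apply: (fx (f x)); exists x.
- by move=> y nUy; have -> : f y = 1; rewrite ?subrr//; apply: (fU (f y)); exists y.
Qed.

Lemma continuous_sum_seq (I : Type) (s : seq I) (F : I -> T -> R) :
  (forall i, continuous (F i)) -> continuous (fun x => \sum_(i <- s) F i x).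
Proof.
move=> Fc; elim: s => [|i s IH].
  have -> : (fun x => \sum_(i <- [::]) F i x) = (fun=> 0) by apply/funext => x; rewrite big_nil.
  exact: continuous_cstR.
have -> : (fun x => \sum_(j <- i :: s) F j x) = (fun x => F i x + \sum_(j <- s) F j x).
  by apply/funext => x; rewrite big_cons.
by move=> x; apply: cvgD; [exact: Fc|exact: IH].
Qed.

Lemma min_below U (f g : T -> R) : continuous g -> (forall x, 0 <= g x) ->
  (forall x, ~ U x -> g x = 0) -> below setT f -> below U (fun x => Num.min (f x) (g x)).
Proof.
move=> gc g0 gU [fc f01 _]; split.
- by move=> x; exact: (@continuous_min R T f g x (fc x) (gc x)).
- by move=> x; have /andP[f0 f1] := f01 x; rewrite le_min f0 g0/= ge_min f1.
- by move=> x /gU ->; have /andP[f0 f1] := f01 x; rewrite min_r.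
Qed.

(** By compactness, finitely many bump functions give [f <= e + g + k] with [g] vanishing off [U]
    and [k] off [V]; then [f <= e + min f g + min f k], which plays the part of a partition of
    unity. *)
Lemma lamU U V : open U -> open V -> lam (U `|` V) <= lam U + lam V.
Proof.
move=> oU oV; apply: lam_le => f bf; have [fc f01 f0] := bf.
apply/ler_addgt0Pr => e e0.
have : forall x, exists gk : (T -> R) * (T -> R), [/\ continuous gk.1, continuous gk.2,
    (forall y, 0 <= gk.1 y) /\ (forall y, 0 <= gk.2 y),
    (forall y, ~ U y -> gk.1 y = 0) /\ (forall y, ~ V y -> gk.2 y = 0) & f x < e + gk.1 x + gk.2 x].
  move=> x; have [Ux|nUx] := pselect (U x).
    have [g [gc g0 gx gU]] := urysohn_at oU Ux.
    exists (g, fun=> 0); split=> //=; first exact: continuous_cstR.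
    rewrite gx addr0.
    by have /andP[_ f1] := f01 x; apply: le_lt_trans f1 _; rewrite ltrDr.
  have [Vx|nVx] := pselect (V x).
    have [g [gc g0 gx gV]] := urysohn_at oV Vx.
    exists (fun=> 0, g); split=> //=; first exact: continuous_cstR.
    rewrite gx addr0.
    by have /andP[_ f1] := f01 x; apply: le_lt_trans f1 _; rewrite ltrDr.
  exists (fun=> 0, fun=> 0); split=> //=; [exact: continuous_cstR|exact: continuous_cstR|].
  by rewrite !addr0 f0// => -[].
move=> /choice[G hG].
pose O x := [set y | f y - (G x).1 y - (G x).2 y < e].
have oO x : open (O x).
  apply: (@open_ltf (fun y => f y - (G x).1 y - (G x).2 y)).
  have [g1 g2 _ _ _] := hG x.
  by move=> y; apply: cvgB; [apply: cvgB; [exact: fc|exact: g1]|exact: g2].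
move: cT; rewrite compact_cover => /(_ T setT O (fun x _ => oO x)).
case; first by move=> x _; exists x => //; have [_ _ _ _] := hG x; rewrite /O /= !ltrBlDr addrAC.
move=> D _ cD.
pose s := finmap.enum_fset D.
pose g y := \sum_(x <- s) (G x).1 y; pose k y := \sum_(x <- s) (G x).2 y.
have gc : continuous g by apply: continuous_sum_seq => x; have [] := hG x.
have kc : continuous k by apply: continuous_sum_seq => x; have [] := hG x.
have g0 y : 0 <= g y by apply: sumr_ge0 => x _; have [_ _ [h _] _ _] := hG x; exact: h.
have k0 y : 0 <= k y by apply: sumr_ge0 => x _; have [_ _ [_ h] _ _] := hG x; exact: h.
have gU y : ~ U y -> g y = 0 by move=> nU; apply: big1 => x _; have [_ _ _ [h _] _] := hG x; exact: h.
have kV y : ~ V y -> k y = 0 by move=> nU; apply: big1 => x _; have [_ _ _ [_ h] _] := hG x; exact: h.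
have fgk y : f y <= e + g y + k y.
  have [x xD Oy] := cD y I; move: Oy; rewrite /O /= !ltrBlDr addrAC => /ltW/le_trans; apply.
  rewrite -!addrA lerD2l /g /k !(@big_rem _ _ _ _ s x _ _ xD)/= [X in _ <= X]addrACA lerDl.
  by apply: addr_ge0; apply: sumr_ge0 => z _; have [_ _ [h1 h2] _ _] := hG z.
have bfT : below setT f by split=> // y nT; case: (nT I).
have b1 := min_below gc g0 gU bfT; have b2 := min_below kc k0 kV bfT.
apply: le_trans (lerD (lerD (Lam_le_lam b1) (Lam_le_lam b2)) (lexx e)).
have [c1 _ _] := b1; have [c2 _ _] := b2.
have c3 : continuous (fun y => Num.min (f y) (g y) + Num.min (f y) (k y)).
  by move=> y; apply: cvgD; [exact: c1|exact: c2].
rewrite -LamD// -[X in _ <= _ + X](Lam_cst e) -LamD//; last exact: continuous_cstR.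
apply: Lam_le => //.
  by move=> y; apply: cvgD; [exact: c3|exact: cvg_cst].
move=> y; have := fgk y; have /andP[+ _] := f01 y; move: (g0 y) (k0 y).
move: (f y) (g y) (k y) => a b c b0 c0 a0.
by rewrite /Num.min; case: ifP; case: ifP; lra.
Qed.

Lemma lam_bigU (U : (set T)^nat) n : (forall i, open (U i)) ->
  lam (\bigcup_(i < n) U i) <= \sum_(i < n) lam (U i).
Proof.
move=> oU; elim: n => [|n IH]; first by rewrite bigcup_mkord big_ord0 lam0 big_ord0.
rewrite bigcup_mkord big_ord_recr/= [X in _ <= X]big_ord_recr/= -bigcup_mkord.
apply: le_trans (lamU _ _) _ => //; last by rewrite lerD2r.
exact: bigcup_open.
Qed.

(** The set [f < e] and finitely many of the [U i] cover the compact space, so [max (f - e) 0]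
    already vanishes off a finite union. *)
Lemma lam_bigcup (U : (set T)^nat) : (forall i, open (U i)) ->
  forall f, below (\bigcup_i U i) f -> forall e, 0 < e ->
  exists n, Lam f <= \sum_(i < n) lam (U i) + e.
Proof.
move=> oU f [fc f01 f0] e e0.
pose O n := [set x | f x < e] `|` \bigcup_(i < n) U i.
have oO n : open (O n) by apply: openU; [exact: open_ltf|exact: bigcup_open].
move: cT; rewrite compact_cover => /(_ nat setT O (fun x _ => oO x)).
case.
  move=> x _; have [[i _ Ui]|nU] := pselect ((\bigcup_i U i) x).
    by exists i.+1 => //; right; exists i => /=.
  by exists 0%N => //; left; rewrite /= f0.
move=> D _ cD; pose n := \max_(i <- finmap.enum_fset D) i.
have cn x : O n x.
  have [i /= iD [Oi|[j /= ji Uj]]] := cD x I; [by left|right; exists j => //=].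
  by apply: (leq_trans ji); apply: leq_bigmax_seq.
exists n; apply: le_trans (Lam_cut (ltW e0) fc) _; rewrite lerD2r.
apply: le_trans (lam_bigU n oU); apply: Lam_le_lam; split.
- exact: continuous_sub_gt0.
- move=> x; have /andP[a b] := f01 x; rewrite le_max lexx orbT ge_max ler01 andbT.
  by rewrite lerBlDr (le_trans b)// lerDl ltW.
- by move=> x nU; have [/= /ltW h|//] := cn x; rewrite max_r// subr_le0.
Qed.

(** * The outer measure and the Riesz measure *)

Definition outr (A : set T) : R := inf [set lam U | U in [set U | open U /\ A `<=` U]].

Lemma outr_has_inf A : has_inf [set lam U | U in [set U | open U /\ A `<=` U]].
Proof.
split; first by exists (lam setT), setT => //; split=> //; exact: openT.
by exists 0 => _ [U _ <-]; exact: lam_ge0.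
Qed.

Lemma outr_le U A : open U -> A `<=` U -> outr A <= lam U.
Proof. by move=> oU AU; apply: ge_inf; [have [] := outr_has_inf A|exists U]. Qed.

Lemma outr_ge A c : (forall U, open U -> A `<=` U -> c <= lam U) -> c <= outr A.
Proof.
by move=> h; apply: lb_le_inf; [have [] := outr_has_inf A|move=> _ [U [oU AU] <-]; exact: h].
Qed.

Lemma outr_ge0 A : 0 <= outr A.
Proof. by apply: outr_ge => U _ _; exact: lam_ge0. Qed.

Lemma outr_open U : open U -> outr U = lam U.
Proof.
move=> oU; apply/eqP; rewrite eq_le outr_le//=.
by apply: outr_ge => V _; exact: lam_sub.
Qed.

Lemma outr_sub A B : A `<=` B -> outr A <= outr B.
Proof. by move=> AB; apply: outr_ge => U oU BU; apply: outr_le => // x /AB /BU. Qed.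

Lemma outr_near A e : 0 < e -> exists U, [/\ open U, A `<=` U & lam U < outr A + e].
Proof.
move=> e0; have [_ [U [oU AU] <-] h] := inf_adherent e0 (outr_has_inf A).
by exists U.
Qed.

Definition outm (A : set T) : \bar R := (outr A)%:E.

Local Open Scope ereal_scope.

Lemma outm0 : outm set0 = 0.
Proof. by rewrite /outm outr_open ?lam0//; exact: open0. Qed.

Lemma outm_ge0 A : 0 <= outm A.
Proof. by rewrite lee_fin outr_ge0. Qed.

Lemma le_outm : {homo outm : A B / A `<=` B >-> A <= B}.
Proof. by move=> A B AB; rewrite lee_fin outr_sub. Qed.

Lemma outm_sigma_subadditive : sigma_subadditive outm.
Proof.
move=> A; apply/lee_addgt0Pr => e e0.
(* One half of [e] is spread over the covers [U n], the other half is spent in [lam_bigcup]. *)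
have en n : (0 < e / 2 / (2 ^ n.+1)%:R)%R by rewrite !divr_gt0// ltr0n expn_gt0.
have /choice[U hU] : forall n, exists U, [/\ open U, A n `<=` U & (lam U < outr (A n) + e / 2 / (2 ^ n.+1)%:R)%R].
  by move=> n; exact: outr_near.
have oU n : open (U n) by have [] := hU n.
have e20 : (0 <= e / 2)%R by rewrite divr_ge0// ltW.
have h := @epsilon_trick R (fun n => outm (A n)) (e / 2)%R xpredT (fun n => outm_ge0 (A n)) e20.
rewrite [in X in _ <= X](splitr e) EFinD addeA.
apply: (@le_trans _ _ ((\sum_(0 <= n <oo) (lam (U n))%:E) + (e / 2)%:E)); last first.
  rewrite leeD2r//; apply: le_trans h; apply: lee_nneseries => n _ //.
    by rewrite lee_fin lam_ge0.
  by rewrite /outm -EFinD lee_fin ltW//; have [] := hU n.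
have ob : open (\bigcup_n U n) by apply: bigcup_open => n _.
apply: (@le_trans _ _ (lam (\bigcup_n U n))%:E).
  rewrite -(outr_open ob); apply: le_outm => x [n _ Ax]; exists n => //.
  by have [_ + _] := hU n; exact.
have fin : \sum_(0 <= n <oo) (lam (U n))%:E = +oo \/ exists r : R, \sum_(0 <= n <oo) (lam (U n))%:E = r%:E.
  have : 0 <= \sum_(0 <= n <oo) (lam (U n))%:E.
    by apply: nneseries_ge0 => n _ _; rewrite lee_fin lam_ge0.
  by case: (\sum_(_ <= _ <oo) _) => [r|//|//] _; [right; exists r|left].
case: fin => [->|[r rE]]; first by rewrite leey.
rewrite rE -EFinD lee_fin; apply: lam_le => f bf.
have e2 : (0 < e / 2)%R by rewrite divr_gt0.
have [n hn] := lam_bigcup oU bf e2.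
apply: (le_trans hn); rewrite lerD2r -lee_fin -rE -sumEFin -(big_mkord xpredT (fun i => (lam (U i))%:E)).
by apply: nneseries_lim_ge => k _ _; rewrite lee_fin lam_ge0.
Qed.

HB.instance Definition _ := isOuterMeasure.Build R T outm outm0 outm_ge0
  le_outm outm_sigma_subadditive.

(** Let [f] vanish off the intersection of [V] and [U], and [g] off the part of [V] where [f < e].
    Then [max (f - e) 0 + g] is still at most [1], since its terms are never both nonzero; and that
    part of [V] is open and contains [V] minus [U]. *)
Lemma open_caratheodory U : open U -> outm.-caratheodory U.
Proof.
move=> oU; apply: le_caratheodory_measurable => X.
rewrite /= /outm -EFinD lee_fin; apply: outr_ge => V oV XV.
apply: (@le_trans _ _ (lam (V `&` U) + outr (V `&` ~` U))%R).
  apply: lerD; last by apply: outr_sub; exact: setSI.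
  by rewrite -outr_open; [apply: outr_sub; exact: setSI|exact: openI].
rewrite -lerBrDr; apply: lam_le => f bf; rewrite lerBrDr.
apply/ler_addgt0Pr => e e0; have [fc f01 f0] := bf.
pose W := V `&` [set x | (f x < e)%R].
have oW : open W by apply: openI => //; exact: open_ltf.
have : (outr (V `&` ~` U) <= lam W)%R.
  apply: outr_le => // x [Vx nUx]; split=> //=; rewrite f0// => -[] //.
move=> /(lerD (Lam_cut (ltW e0) fc)) /le_trans; apply.
rewrite addrAC lerD2r -lerBrDl; apply: lam_le => g [gc g01 g0]; rewrite lerBrDl.
have mc := continuous_sub_gt0 (e:=e) fc.
rewrite -LamD//; apply: Lam_le_lam; split.
- by move=> x; apply: cvgD; [exact: mc|exact: gc].
- move=> x; have /andP[a b] := g01 x; have /andP[a' b'] := f01 x.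
  have [fe|fe] := ltP (f x) e.
    by rewrite max_r ?add0r ?a//; lra.
  rewrite [g x]g0; last by move=> [_ /=]; lra.
  by rewrite addr0 le_max lexx orbT ge_max ler01 andbT; lra.
- move=> x nV; rewrite f0; last by move=> [].
  by rewrite g0; [rewrite addr0 max_r//; lra|move=> []].
Qed.

Definition BT := g_sigma_algebraType (@open T).

Lemma borel_caratheodory (A : set BT) : measurable A -> outm.-caratheodory A.
Proof.
move=> mA; apply: (@smallest_sub _ (sigma_algebra setT) _ (@measurable _ (caratheodory_type outm))) mA.
  exact: sigma_algebra_measurable.
by move=> U oU; exact: open_caratheodory.
Qed.

Definition riesz (A : set BT) : \bar R := outm A.

Lemma riesz0 : riesz set0 = 0. Proof. exact: outm0. Qed.

Lemma riesz_ge0 A : 0 <= riesz A. Proof. exact: outm_ge0. Qed.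

Lemma riesz_sigma_additive : semi_sigma_additive riesz.
Proof.
move=> F mF tF mUF.
apply: (@caratheodory_measure_sigma_additive R T outm F) => //.
- by move=> i; exact: borel_caratheodory.
- exact: borel_caratheodory.
Qed.

HB.instance Definition _ := isMeasure.Build _ BT R riesz
  riesz0 riesz_ge0 riesz_sigma_additive.

Lemma rieszT : riesz setT = 1.
Proof. by rewrite /riesz /outm outr_open ?lamT//; exact: openT. Qed.

HB.instance Definition _ := Measure_isProbability.Build _ BT R riesz rieszT.

(** What is kept of the construction: comparison with [Lam] on open sets in both directions, and
    outer regularity, which holds for every set because [mu] is given by the outer measure. *)
Lemma riesz_representation : exists mu : probability BT R,
  (forall U f, open U -> below U f -> (Lam f)%:E <= mu U) /\
  (forall (U : set T) (c : R), open U -> (forall f, below U f -> (Lam f <= c)%R) -> mu U <= c%:E) /\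
  (forall (A : set T) (c : R), mu A < c%:E -> exists U : set T, [/\ open U, A `<=` U & mu U < c%:E]).
Proof.
exists (riesz : probability BT R); split; [|split].
- by move=> U f oU bf; rewrite /= /riesz /outm lee_fin outr_open// Lam_le_lam.
- by move=> U c oU h; rewrite /= /riesz /outm lee_fin outr_open// lam_le.
- move=> A c; rewrite /= /riesz /outm lte_fin -subr_gt0 => /outr_near h.
  have [U [oU AU hU]] := h A; exists U; split=> //.
  by rewrite /outm lte_fin outr_open//; move: hU; rewrite addrC subrK.
Qed.
Local Close Scope ereal_scope.
End Riesz.

Lemma continuousRD (R : realType) (T : topologicalType) (f g : T -> R) :
  continuous f -> continuous g -> continuous (fun x => f x + g x).
Proof. by move=> fc gc x; apply: cvgD; [exact: fc|exact: gc]. Qed.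

Lemma continuousRB (R : realType) (T : topologicalType) (f g : T -> R) :
  continuous f -> continuous g -> continuous (fun x => f x - g x).
Proof. by move=> fc gc x; apply: cvgB; [exact: fc|exact: gc]. Qed.

Lemma continuousRM (R : realType) (T : topologicalType) (f g : T -> R) :
  continuous f -> continuous g -> continuous (fun x => f x * g x).
Proof. by move=> fc gc x; apply: cvgM; [exact: fc|exact: gc]. Qed.

(** * The functional given by an invariant mean *)

Section MeanFunctional.
Context (R : realType).
Local Notation C := (Cplx R).
Local Notation sphere := (sphere R).
Implicit Types (f : sphere -> sphere) (b c : Cb R sphere).

Lemma Cb_ext b c : (forall x, b x = c x) -> b = c.
Proof. by move=> h; do 2 apply: val_inj; apply/funext. Qed.

Lemma Linf_ext (T : Type) (u v : Linf R T) : (forall x, u x = v x) -> u = v.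
Proof. by move=> h; apply: val_inj; apply/funext. Qed.

Lemma CbD b c x : fun_of_Cb (b + c) x = b x + c x. Proof. by []. Qed.
Lemma CbZ (a : R[i]) b x : fun_of_Cb (a *: b) x = a * b x. Proof. by []. Qed.

Lemma lyubich_linear f (a : R[i]) b c : rational_map f ->
  lyubich f (a *: b + c) = a *: lyubich f b + lyubich f c.
Proof.
move=> rf; apply: Cb_ext => y; rewrite CbD CbZ !lyubichE//.
rewrite mulrCA -mulrDr; congr (_ * _); rewrite mulr_sumr -big_split/=.
by apply: eq_bigr => x _; rewrite CbD CbZ.
Qed.

Lemma lyubich_comp f g b : rational_map f -> rational_map g ->
  lyubich (f \o g) b = lyubich f (lyubich g b).
Proof.
move=> rf rg; have [rfg dfg] := rational_comp rf rg.
apply: Cb_ext => y; rewrite !lyubichE// dfg natrM invfM (perm_big _ (fib_comp y rf rg))/=.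
rewrite big_flatten big_map/= -mulrA; congr (_ * _).
by rewrite mulr_sumr; apply: eq_bigr => x _; rewrite lyubichE.
Qed.

Definition evalCb (x : sphere) (b : Cb R sphere) : C := b x.

Lemma evalCb_linear x : linear (evalCb x).
Proof. by move=> a b c; rewrite /evalCb CbD CbZ. Qed.

HB.instance Definition _ x := GRing.isLinear.Build R[i] (Cb R sphere) C *:%R (evalCb x)
  (evalCb_linear x).

Lemma rnorm_evalCb x b : rnorm (b x) <= supnorm (val b).
Proof. exact: (rnorm_le_supnorm (val b) x). Qed.

Lemma evalCb_continuous x : continuous (evalCb x).
Proof.
move=> b A /nbhs_rnorm[r r0 rA]; apply/nbhs_ballP; exists r%:C; first by rewrite /= ltcR.
move=> c; rewrite -ball_normE/= => bc; apply: rA.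
rewrite -[evalCb x c - evalCb x b]/(evalCb x (c - b)).
apply: le_lt_trans (rnorm_evalCb _ _) _.
by rewrite -ltcR; move: bc; rewrite distrC.
Qed.

Variable S : ratsemigroup R.

Lemma rational_elt (s : ratsg_elt S) : rational_map (val s).
Proof. by apply: ratsg_rational; exact: set_valP. Qed.

Lemma coef_bounded x0 b : exists k : R, forall s : ratsg_elt S, rnorm (lyubich (val s) b x0) <= k.
Proof.
exists (supnorm (val b)) => s; have rs := rational_elt s.
rewrite lyubichE// rnormM rnormV rnorm_nat mulrC ler_pdivrMr ?ltr0n ?ratdeg_gt0//.
apply: (le_trans (rnorm_sum_le _ _)); rewrite -(size_fib x0 rs) mulr_natr.
elim: (fib _ _) => [|x l IH]; first by rewrite big_nil.
by rewrite big_cons mulrS lerD// rnorm_evalCb.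
Qed.

Definition coef x0 b : Linf R (ratsg_elt S) := mkLinf (coef_bounded x0 b).

Lemma coef_linear x0 (a : R[i]) b c : coef x0 (a *: b + c) = a *: coef x0 b + coef x0 c.
Proof.
apply: Linf_ext => s.
rewrite -[RHS]/(a * lyubich (val s) b x0 + lyubich (val s) c x0).
by rewrite -CbZ -CbD -lyubich_linear//; exact: rational_elt.
Qed.

(** Evaluation at [x0] is a continuous functional, so [coef x0 b] is a matrix coefficient and falls
    under the invariance of the mean. *)
Lemma coef_Xspace x0 b : Xspace (lyubich_rep S) (coef x0 b).
Proof.
exists 1%N, (fun=> 1), (fun=> coef x0 b); split; last by rewrite big_ord1 scale1r.
move=> _; left; apply: subset_closure.
exists 1%N, (fun=> 1), (fun=> coef x0 b); split; last by rewrite big_ord1 scale1r.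
by move=> _; exists b, (evalCb x0); split => //; exact: evalCb_continuous.
Qed.

(** [L_(t o s) = L_t L_s], so translation on the right by [s] acts on [b] and leaves [x0] alone:
    this is how right amenability yields a functional invariant under all [L_s]. *)
Lemma rtranslate_coef x0 (s : ratsg_elt S) b :
  rtranslate s (coef x0 b) = coef x0 (lyubich (val s) b).
Proof.
apply: Linf_ext => t; rewrite -[LHS]/(lyubich (val t \o val s) b x0).
by rewrite lyubich_comp//; exact: rational_elt.
Qed.

Lemma continuousRC (phi : sphere -> R) : continuous phi ->
  continuous (fun x => (phi x)%:C : C).
Proof.
move=> pc; apply: continuousC => x e e0.
have h : nbhs x (phi @^-1` [set t | `|phi x - t| < e]).
  by apply: pc; apply/nbhs_ballP; exists e => // t; rewrite -ball_normE.
by apply: filterS h => y /= h; rewrite -rmorphB rnormR distrC.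
Qed.

Definition toCb (phi : sphere -> R) : Cb R sphere := xget 0 [set b : Cb R sphere | forall x, b x = (phi x)%:C].

Lemma toCbE (phi : sphere -> R) : continuous phi -> forall x, toCb phi x = (phi x)%:C.
Proof.
move=> pc; have := @xgetPex _ 0 [set b : Cb R sphere | forall x, b x = (phi x)%:C].
by apply; exists (mkCb (continuousRC pc)).
Qed.

Definition Lreal f (phi : sphere -> R) (y : sphere) : R :=
  (ratdeg f)%:R^-1 * \sum_(x <- fib f y) phi x.

Lemma lyubich_toCb f (phi : sphere -> R) y : rational_map f -> continuous phi ->
  lyubich f (toCb phi) y = (Lreal f phi y)%:C.
Proof.
move=> rf pc; rewrite lyubichE// /Lreal rmorphM fmorphV rmorph_nat rmorph_sum/=.
by congr (_ * _); apply: eq_bigr => x _; rewrite toCbE.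
Qed.

Lemma Lreal_continuous f (phi : sphere -> R) : rational_map f -> continuous phi ->
  continuous (Lreal f phi).
Proof.
move=> rf pc; have -> : Lreal f phi = (fun z : C => complex.Re z) \o (lyubich f (toCb phi)).
  by apply/funext => y; rewrite /= lyubich_toCb.
move=> y; apply: continuous_comp; first exact: Cb_continuous.
exact: continuous_Re.
Qed.

Lemma amenable_functional : right_amenable (lyubich_rep S) ->
  exists Lam : (sphere -> R) -> R,
  [/\ (forall f g : sphere -> R, continuous f -> continuous g ->
        Lam (fun x => f x + g x) = Lam f + Lam g),
      (forall f g : sphere -> R, continuous f -> continuous g ->
        (forall x, f x <= g x) -> Lam f <= Lam g),
      (forall c : R, Lam (fun=> c) = c),
      (forall (c : R) (f : sphere -> R), continuous f -> Lam (fun x => c * f x) = c * Lam f) &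
      forall s phi, ratsg_set S s -> continuous phi -> Lam (Lreal s phi) = Lam phi].
Proof.
move=> [M [[_ Mpos _ M1] Minv]].
(* The base point is arbitrary. *)
pose x0 : sphere := None.
pose Lam phi := complex.Re (M (coef x0 (toCb phi))).
have LamD (f g : sphere -> R) : continuous f -> continuous g ->
    Lam (fun x => f x + g x) = Lam f + Lam g.
  move=> fc gc; rewrite /Lam -raddfD -linearD/=; congr (complex.Re (M _)).
  rewrite -[coef x0 (toCb f)]scale1r -coef_linear scale1r; congr (coef _ _).
  apply: Cb_ext => x; rewrite CbD !toCbE// ?rmorphD//.
  exact: continuousRD.
have Lam_pos (f : sphere -> R) : continuous f -> (forall x, 0 <= f x) -> 0 <= Lam f.
  move=> fc f0; have : 0 <= M (coef x0 (toCb f)).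
    apply: Mpos => s; rewrite -[coef _ _ _]/(lyubich (val s) (toCb f) x0).
    rewrite lyubich_toCb//; last exact: rational_elt.
    by rewrite ler0c mulr_ge0// sumr_ge0.
  by rewrite lecE => /andP[_].
exists Lam; split=> //.
- move=> f g fc gc fg; have dc : continuous (fun x => g x - f x).
    exact: continuousRB.
  have -> : g = (fun x => f x + (g x - f x)) by apply/funext => x; rewrite addrC subrK.
  by rewrite LamD// lerDl Lam_pos// => x; rewrite subr_ge0.
- move=> c; rewrite /Lam.
  (* Each [L_s] fixes constants, so this coefficient is a constant function, on which the mean is
     known. *)
  have -> : coef x0 (toCb (fun=> c)) = (c%:C : R[i]) *: Linf_cst _ (1 : C).
    apply: Linf_ext => s; rewrite -[LHS]/(lyubich (val s) (toCb (fun=> c)) x0).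
    have rs := rational_elt s; rewrite lyubich_toCb//; last exact: continuous_cstR.
    rewrite -[RHS]/(c%:C * 1) mulr1 /Lreal big_const_seq count_predT size_fib//.
    by rewrite iter_addr_0 -[c *+ _]mulr_natl mulKf// pnatr_eq0 -lt0n ratdeg_gt0.
  by rewrite linearZ/= M1 -[_ *: _]/(c%:C * 1) mulr1.
- move=> c f fc; rewrite /Lam.
  have -> : toCb (fun x => c * f x) = (c%:C : R[i]) *: toCb f.
    apply: Cb_ext => x; rewrite CbZ !toCbE ?rmorphM//.
    exact: continuousRM (continuous_cstR (c:=c)) fc.
  rewrite -[_ *: _]addr0 coef_linear.
  have -> : coef x0 0 = 0.
    by apply: (addrI (coef x0 0)); rewrite -[X in X + _]scale1r -coef_linear scale1r !addr0.
  rewrite addr0 linearZ/=; case: (M _) => a b; rewrite -[_ *: _]/(c%:C * (a +i* b)).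
  by rewrite /= mul0r subr0.
- move=> s phi Ss pc; have s_in : s \in (S : set _) by exact: mem_set.
  pose s' : ratsg_elt S := exist _ s s_in.
  rewrite /Lam; congr complex.Re.
  rewrite -(Minv (coef x0 (toCb phi)) s' (coef_Xspace x0 _)) rtranslate_coef.
  congr (M (coef _ _)); apply: Cb_ext => y.
  have rs := rational_elt s'.
  by rewrite lyubich_toCb// toCbE//; exact: Lreal_continuous.
Qed.

(** For a test function [phi] of [W] and the preimage of [U], [L_s phi] is at most [k / deg s] and
    vanishes off [U]; a multiple of it is thus a test function of [U], while
    [Lam (L_s phi) = Lam phi]. For invariance, one inequality is the case [W = setT], [k = deg s],
    and the other follows from [L_s (phi o s) = phi]. *)
Lemma amenable_measure : right_amenable (lyubich_rep S) ->
  exists mu : probability (borel_sphere R) R,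
  [/\ (forall (A : set sphere) (c : R), (mu A < c%:E)%E ->
         exists U : set sphere, [/\ open U, A `<=` U & (mu U < c%:E)%E]),
      (forall s (U : set sphere), ratsg_set S s -> open U -> mu (s @^-1` U) = mu U) &
      forall s (U W : set sphere) k, ratsg_set S s -> open U -> open W ->
        (forall y, (count (fun x => `[< W x >]) (fib s y) <= k)%N) ->
        (mu (W `&` s @^-1` U) <= (k%:R / (ratdeg s)%:R)%:E * mu U)%E].
Proof.
move=> /amenable_functional[Lam [LamD Lam_le Lam_cst LamZ LamL]].
have [mu [mu_ge [mu_le mu_out]]] :=
  @riesz_representation R sphere (@sphere_compact R) (@sphere_creg R) Lam LamD Lam_le Lam_cst.
have bal s (U W : set sphere) k : ratsg_set S s -> open U -> open W ->
    (forall y, (count (fun x => `[< W x >]) (fib s y) <= k)%N) ->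
    (mu (W `&` s @^-1` U) <= (k%:R / (ratdeg s)%:R)%:E * mu U)%E.
  move=> Ss oU oW hk; have rs : rational_map s by exact: ratsg_rational Ss.
  have sc := rational_continuous rs; set d := ratdeg s.
  have d0 : 0 < d%:R :> R by rewrite ltr0n ratdeg_gt0.
  have [u uE] : exists u : R, mu U = u%:E.
    by exists (fine (mu U)); rewrite fineK// fin_num_measure//; exact: sub_sigma_algebra.
  have oV : open (W `&` s @^-1` U) by apply: openI => //; apply: open_comp => // x _; exact: sc.
  rewrite uE -EFinM; apply: mu_le => // phi [pc p01 p0].
  have Lc := Lreal_continuous rs pc.
  have L0 y : 0 <= Lreal s phi y.
    by rewrite mulr_ge0// sumr_ge0// => x _; have /andP[] := p01 x.
  have Lk y : Lreal s phi y <= k%:R / d%:R.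
    rewrite /Lreal mulrC ler_wpM2r ?invr_ge0 ?(ltW d0)//.
    apply: (@le_trans _ _ (count (fun x => `[< W x >]) (fib s y))%:R); last by rewrite ler_nat.
    elim: (fib s y) => [|x l IH]; first by rewrite big_nil.
    rewrite big_cons /= natrD lerD//.
    by case: asboolP => Wx; [have /andP[] := p01 x|rewrite p0// => -[]].
  have LU y : ~ U y -> Lreal s phi y = 0.
    move=> nU; rewrite /Lreal big_seq big1 ?mulr0// => x; rewrite mem_fib// => /eqP sx.
    by apply: p0 => -[_ /=]; rewrite sx.
  rewrite -(LamL s)//; have [k0|k0] := posnP k.
    have -> : Lreal s phi = (fun=> 0).
      by apply/funext => y; apply/eqP; rewrite eq_le L0 andbT; have := Lk y; rewrite k0 mul0r.
    by rewrite Lam_cst k0 !mul0r.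
  have kd0 : 0 < k%:R / d%:R :> R by rewrite divr_gt0// ltr0n.
  have -> : Lreal s phi = (fun y => k%:R / d%:R * ((k%:R / d%:R)^-1 * Lreal s phi y)).
    by apply/funext => y; rewrite mulVKf// gt_eqF.
  have gc : continuous (fun y => (k%:R / d%:R)^-1 * Lreal s phi y).
    exact: continuousRM (continuous_cstR (c:=_)) Lc.
  rewrite LamZ// ler_pM2l// -lee_fin -uE; apply: mu_ge => //; split=> //.
    move=> y; by rewrite mulr_ge0 ?invr_ge0 ?(ltW kd0)//= ler_pdivrMl// mulr1.
  by move=> y /LU ->; rewrite mulr0.
exists mu; split => // s U Ss oU.
have rs : rational_map s by exact: ratsg_rational Ss.
have sc := rational_continuous rs.
have oV : open (s @^-1` U) by apply: open_comp => // x _; exact: sc.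
have d0 : (ratdeg s)%:R != 0 :> R by rewrite pnatr_eq0 -lt0n ratdeg_gt0.
apply/eqP; rewrite eq_le; apply/andP; split.
  have := bal s U setT (ratdeg s) Ss oU openT; rewrite divff// mul1e setTI; apply.
  by move=> y; rewrite -(size_fib y rs); exact: count_size.
have [v vE] : exists v : R, mu (s @^-1` U) = v%:E.
  by exists (fine (mu (s @^-1` U))); rewrite fineK// fin_num_measure//; exact: sub_sigma_algebra.
rewrite vE; apply: mu_le => // phi [pc p01 p0].
have psc : continuous (phi \o s) by move=> x; apply: continuous_comp; [exact: sc|exact: pc].
have -> : Lam phi = Lam (phi \o s).
  rewrite -[RHS](LamL s)//; congr Lam; apply/funext => y; rewrite /Lreal big_seq.
  rewrite (eq_bigr (fun=> phi y)); last by move=> x; rewrite mem_fib// => /eqP <-.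
  by rewrite -big_seq big_const_seq count_predT size_fib// iter_addr_0 -[phi y *+ _]mulr_natl mulKf.
rewrite -lee_fin -vE; apply: mu_ge => //; split=> //.
- by move=> x; exact: p01.
- by move=> x; exact: p0.
Qed.
End MeanFunctional.
(** * Balanced measures and their atoms *)

Section Balanced.
Context (R : realType).
Local Notation sphere := (sphere R).
Implicit Types (f s : sphere -> sphere) (mu : probability (borel_sphere R) R).

Lemma open_borel (U : set sphere) : open U -> measurable (U : set (borel_sphere R)).
Proof. exact: sub_sigma_algebra. Qed.

Lemma closed_borel (F : set sphere) : closed F -> measurable (F : set (borel_sphere R)).
Proof.
move=> cF; rewrite -[F]setCK; apply: measurableC; apply: sub_sigma_algebra.
exact: closed_openC.
Qed.

Lemma set1_borel (x : sphere) : measurable ([set x] : set (borel_sphere R)).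
Proof.
apply: closed_borel.
exact: (@accessible_closed_set1 _ (hausdorff_accessible (@sphere_hausdorff R)) x).
Qed.

Lemma continuous_borel s : continuous s ->
  measurable_fun setT (s : borel_sphere R -> borel_sphere R).
Proof.
move=> sc; refine (@measurability _ _ (borel_sphere R) (borel_sphere R) setT s (@open sphere) _ _) => //.
move=> _ [U oU <-]; rewrite setTI; apply: open_borel.
by apply: open_comp => // x _; exact: sc.
Qed.

(** One-sided form of [mu (s A) = deg s * mu A] on sets where [s] is injective; the bound [k] lets
    the same inequality treat ramified points. *)
Definition balanced mu s := forall (A : set (borel_sphere R)) (W : set sphere) k,
  measurable A -> open W ->
  (forall y, (count (fun x => `[< W x >]) (fib s y) <= k)%N) ->
  (mu (W `&` s @^-1` A) <= (k%:R / (ratdeg s)%:R)%:E * mu A)%E.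

Lemma measure_open_unique (m1 m2 : {measure set (borel_sphere R) -> \bar R}) :
  (m1 setT < +oo)%E -> (forall U : set sphere, open U -> m1 U = m2 U) ->
  forall A, measurable A -> m1 A = m2 A.
Proof.
move=> fin h A mA; apply: (@measure_unique _ R (borel_sphere R) (@open sphere) (fun=> setT)) => //.
- by move=> U V; exact: openI.
- by move=> _; exact: openT.
- by rewrite bigcup_const//; exists 0%N.
Qed.

Lemma open_invariant mu s : continuous s ->
  (forall U : set sphere, open U -> mu (s @^-1` U) = mu U) -> invariant_measure mu s.
Proof.
move=> sc h A mA.
have sm : measurable_fun setT (s : borel_sphere R -> borel_sphere R) by exact: continuous_borel.
pose s' := s : borel_sphere R -> borel_sphere R.
refine (@measure_open_unique (pushforward mu s') mu _ _ A mA) => //.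
by rewrite /= /pushforward preimage_setT probability_setT ltry.
Unshelve. exact: sm.
Qed.

Lemma open_balanced mu s : continuous s ->
  (forall (A : set sphere) (c : R), (mu A < c%:E)%E ->
         exists U : set sphere, [/\ open U, A `<=` U & (mu U < c%:E)%E]) ->
  (forall (U W : set sphere) k, open U -> open W ->
        (forall y, (count (fun x => `[< W x >]) (fib s y) <= k)%N) ->
        (mu (W `&` s @^-1` U) <= (k%:R / (ratdeg s)%:R)%:E * mu U)%E) ->
  balanced mu s.
Proof.
move=> sc reg h A W k mA oW hk.
have [a aE] : exists a : R, mu A = a%:E by exists (fine (mu A)); rewrite fineK// fin_num_measure.
have kd0 : 0 <= k%:R / (ratdeg s)%:R :> R by rewrite divr_ge0.
have mpre (B : set sphere) : measurable (B : set (borel_sphere R)) ->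
    measurable (s @^-1` B : set (borel_sphere R)).
  by move=> mB; rewrite -[X in measurable X]setTI; exact: (continuous_borel sc).
rewrite aE -EFinM; apply/lee_addgt0Pr => e e0.
(* The [+ 1] keeps the denominator positive when [k = 0]; multiplied by [k / deg s], the error is
   still at most [e]. *)
have [|U [oU AU Uc]] := reg A (a + e / (k%:R / (ratdeg s)%:R + 1)).
  by rewrite aE lte_fin ltrDl divr_gt0// ltr_wpDl.
apply: (@le_trans _ _ (mu (W `&` s @^-1` U))).
  apply: le_measure; rewrite ?inE.
  - by apply: measurableI; [exact: open_borel|exact: mpre].
  - by apply: measurableI; [exact: open_borel|apply: mpre; exact: open_borel].
  - by apply: setIS => x; exact: AU.
apply: (le_trans (h U W k oU oW hk)).
have [u uE] : exists u : R, mu U = u%:E.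
  by exists (fine (mu U)); rewrite fineK// fin_num_measure//; exact: open_borel.
move: Uc; rewrite uE lte_fin -EFinM -EFinD lee_fin => /ltW Uc.
apply: (le_trans (ler_wpM2l kd0 Uc)); rewrite mulrDr lerD2l.
rewrite mulrCA ler_piMr ?(ltW e0)// ler_pdivrMr ?mul1r ?lerDl// ltr_wpDl//.
Qed.

Lemma balanced_point mu s x : rational_map s -> balanced mu s ->
  (mu [set x] <= ((count_mem x (fib s (s x)))%:R / (ratdeg s)%:R)%:E * mu [set s x])%E.
Proof.
move=> rs bal; have [W [oW Wx hW]] := fib_count_open x rs.
apply: le_trans (bal _ W _ (set1_borel _) oW hW).
have sc := rational_continuous rs.
apply: le_measure; rewrite ?inE; first exact: set1_borel.
  apply: measurableI; first exact: open_borel.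
  by rewrite -[X in measurable X]setTI; apply: (continuous_borel sc) => //; exact: set1_borel.
by move=> _ ->.
Qed.

Lemma set_of_cons (T : eqType) (x : T) (l : seq T) : [set` x :: l] = [set x] `|` [set` l].
Proof.
apply/seteqP; split => y /=; rewrite in_cons.
  by move=> /orP[/eqP ->|yl]; [left|right].
by move=> -[->|->]; rewrite ?eqxx ?orbT.
Qed.

Lemma finite_borel (l : seq sphere) : measurable ([set` l] : set (borel_sphere R)).
Proof.
elim: l => [|x l IH]; first by rewrite set_nil; exact: measurable0.
have -> : [set` x :: l] = [set x] `|` [set` l].
  exact: set_of_cons.
by apply: measurableU => //; exact: set1_borel.
Qed.

Lemma finite_atoms mu (l : seq sphere) (a : R) : uniq l ->
  (forall x, x \in l -> a%:E <= mu [set x])%E -> (size l)%:R * a <= 1.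
Proof.
move=> ul al; rewrite -lee_fin.
suff h : (((size l)%:R * a)%:E <= mu [set` l])%E.
  by apply: le_trans h (probability_le1 _ (finite_borel _)).
elim: l ul al => [|x l IH] /= => [_ _|/andP[xl ul] al].
  by rewrite mul0r measure_ge0.
have -> : [set` x :: l] = [set x] `|` [set` l].
  exact: set_of_cons.
rewrite measureU; first last.
- by apply/seteqP; split => // y [/= ->]; rewrite /= (negbTE xl).
- exact: finite_borel.
- exact: set1_borel.
rewrite -natr1 mulrDl mul1r addrC EFinD leeD//; first by apply: al; rewrite mem_head.
by apply: IH => // y yl; apply: al; rewrite in_cons yl orbT.
Qed.

(** The mass of points does not decrease along the orbit of [x], and only finitely many points have
    mass at least that of [x], so the orbit is finally periodic. On the cycle the mass is constant
    and positive, and [balanced_point] then leaves no room for a multiplicity below the degree. *)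
Lemma atom_cycle mu f x : rational_map f -> balanced mu f -> (0 < mu [set x])%E ->
  exists y n, [/\ (0 < n)%N, iter n f y = y &
    forall k, count_mem (iter k f y) (fib f (iter k.+1 f y)) = ratdeg f].
Proof.
move=> rf bal x0.
have fin y : exists a : R, mu [set y] = a%:E.
  by exists (fine (mu [set y])); rewrite fineK// fin_num_measure//; exact: set1_borel.
have /choice[w wE] := fin.
have d0 : 0 < (ratdeg f)%:R :> R by rewrite ltr0n ratdeg_gt0.
have cd y : (count_mem y (fib f (f y)) <= ratdeg f)%N.
  by rewrite -(size_fib (f y) rf) count_size.
have step y : w y <= (count_mem y (fib f (f y)))%:R / (ratdeg f)%:R * w (f y).
  by rewrite -lee_fin EFinM -!wE; exact: balanced_point.
have w0 y : 0 <= w y by rewrite -lee_fin -wE measure_ge0.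
have mono y : w y <= w (f y).
  apply: le_trans (step y) _; rewrite ler_piMl// ler_pdivrMr// mul1r ler_nat//.
have wx : 0 < w x by rewrite -lte_fin -wE.
have monoi k y : w y <= w (iter k f y).
  by elim: k => //= k IH; apply: le_trans IH (mono _).
(* More than [1 / w x] distinct points of mass at least [w x] would exceed the total mass [1]. *)
pose n := Num.truncn (w x)^-1; pose N := n.+1.
have : ~~ uniq (traject f x N).
  apply/negP => u; have := finite_atoms u (a := w x) (mu := mu).
  have h y : y \in traject f x N -> ((w x)%:E <= mu [set y])%E.
    by move=> /trajectP[k kN ->]; rewrite wE lee_fin.
  move=> /(_ h); rewrite size_traject -ler_pdivlMr// mul1r leNgt => /negP; apply.
  by apply: truncnS_gt; rewrite invr_ge0.
rewrite looping_uniq negbK => /trajectP[m mn mE].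
pose y := iter m f x; exists y, (n - m)%N.
have p0 : (0 < n - m)%N by rewrite subn_gt0.
have yE : iter (n - m) f y = y by rewrite /y -iterD subnK// ltnW.
split=> // k.
have per j : iter (j * (n - m)) f y = y.
  by elim: j => [|j IH]; rewrite ?mul0n// mulSn iterD IH yE.
have wk j : w (iter j f y) = w y.
  apply/eqP; rewrite eq_le monoi andbT -[X in _ <= w X](per j).
  have jp : (j <= j * (n - m))%N by rewrite leq_pmulr.
  by rewrite -(subnK jp) iterD monoi.
have wy : 0 < w y by apply: lt_le_trans wx (monoi m x).
apply/eqP; rewrite eqn_leq cd/=; have := step (iter k f y).
rewrite -[f (iter k f y)]/(iter k.+1 f y) !wk mulrAC -ler_pdivrMr ?invr_gt0//.
by rewrite invrK mulrC ler_pM2r// ler_nat.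
Qed.
End Balanced.

(** * Cycles of totally ramified points *)

Section Exceptional.
Context (R : realType).
Local Notation C := R[i].
Local Notation sphere := (sphere R).
Implicit Types (p q : {poly C}) (u v z : C) (x y : sphere) (f : sphere -> sphere).

(** The determinant of the standard coordinates of [x] and [(u, v)], up to sign. It agrees with
    [cross] up to sign but is given by one formula for all [x], which suits changes of
    coordinates. *)
Definition bracket x u v : C := deno x * u - nume x * v.

Lemma bracket_cross x : exists2 e, e != 0 & forall u v, bracket x u v = e * cross x u v.
Proof.
case: x => [z|] /=; first by exists 1; rewrite ?oner_eq0// => u v; rewrite /bracket/= !mul1r.
by exists (-1); rewrite ?oppr_eq0 ?oner_eq0// => u v; rewrite /bracket/= mul0r sub0r mulN1r mul1r.
Qed.

Lemma bracket_eq0 x u v : (u != 0) || (v != 0) -> (bracket x u v == 0) = (pt u v == x).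
Proof.
move=> uv; have [e e0 ->] := bracket_cross x.
by rewrite mulf_eq0 (negbTE e0) cross_eq0.
Qed.

Lemma bracket_det x y : x != y -> nume x * deno y - deno x * nume y != 0.
Proof.
move=> xy; have := bracket_eq0 y (ratio_neq0 x); rewrite pt_ratio (negbTE xy) => /negbT.
by have -> : nume x * deno y - deno x * nume y = bracket y (nume x) (deno x) by rewrite /bracket; ring.
Qed.

Lemma bracket_solve x y a b : x != y -> exists u v, bracket x u v = a /\ bracket y u v = b.
Proof.
move=> /bracket_det; set D := _ - _ => D0.
exists ((nume x * b - nume y * a) / D), ((deno x * b - deno y * a) / D).
by split; rewrite /bracket !mulrA -mulrBl; apply: (mulIf D0); rewrite divfK// /D; ring.
Qed.

Definition hmap d p q (x : sphere) : sphere :=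
  pt (hom d p (nume x) (deno x)) (hom d q (nume x) (deno x)).

Lemma hrep_hmap d p q : (0 < d)%N -> (size p <= d.+1)%N -> (size q <= d.+1)%N ->
  (forall u v, hom d p u v = 0 -> hom d q u v = 0 -> u = 0 /\ v = 0) ->
  hrep d p q (hmap d p q).
Proof.
move=> d0 sp sq nz; split; [exact: d0|exact: sp|exact: sq|exact: nz|] => u v uv.
have [c c0] := ratio_pt uv; set x := pt u v => -[-> ->].
by rewrite !homZ ptZ// expf_neq0.
Qed.

Definition blin x : {poly C} := deno x *: 'X - (nume x)%:P.

Lemma size_blin x : (size (blin x) <= 2)%N.
Proof.
apply: leq_trans (size_polyD _ _) _; rewrite geq_max size_polyN.
rewrite (leq_trans (size_scale_leq _ _)) ?size_polyX//.
by rewrite (leq_trans (size_polyC_leq1 _)).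
Qed.

Lemma hom_blin x u v : hom 1 (blin x) u v = bracket x u v.
Proof.
by rewrite /hom !big_ord_recr big_ord0/= !coefE/= /bracket; ring.
Qed.

Lemma hom_scale d (a : C) p u v : hom d (a *: p) u v = a * hom d p u v.
Proof. by rewrite -[a *: p]addr0 -[0](scale0r p) hom_linear mul0r addr0. Qed.

Lemma hrep_mobius (a : C) x y : a != 0 -> x != y ->
  hrep 1 (a *: blin x) (blin y) (hmap 1 (a *: blin x) (blin y)).
Proof.
move=> a0 xy; apply: hrep_hmap => //.
- exact: leq_trans (size_scale_leq _ _) (size_blin _).
- exact: size_blin.
move=> u v; rewrite hom_scale !hom_blin.
move=> /eqP; rewrite mulf_eq0 (negbTE a0)/= => bx /eqP by0.
have [uv|] := boolP ((u != 0) || (v != 0)); last first.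
  by rewrite negb_or !negbK => /andP[/eqP -> /eqP ->].
exfalso; move: bx by0; rewrite !bracket_eq0// => /eqP E /eqP E'.
by move: xy; rewrite -E E' eqxx.
Qed.

(** The map takes [x] to [0] and [y] to infinity; [a] is a scaling left free for
    [cycle2_ramified]. *)
Lemma mobiusP (a : C) x y : a != 0 -> x != y ->
  exists2 m : sphere -> sphere, mobius m &
   forall u v, (u != 0) || (v != 0) -> m (pt u v) = pt (a * bracket x u v) (bracket y u v).
Proof.
move=> a0 xy; have rm := hrep_mobius a0 xy.
exists (hmap 1 (a *: blin x) (blin y)); first exact: hrep_rational rm.
have [_ _ _ _ mE] := rm => u v uv; rewrite mE//.
by rewrite hom_scale !hom_blin.
Qed.

Lemma count_full (T : eqType) (x : T) (s : seq T) : count_mem x s = size s -> s = nseq (size s) x.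
Proof.
move=> h; apply/all_pred1P; rewrite all_count h//.
Qed.

Definition totally_ramified f x := count_mem x (fib f (f x)) = ratdeg f.

(** The fibre over [f x] is [x] repeated [ratdeg f] times, so its form is a constant times a power
    of one linear form. *)
Lemma ramified_bracket f x : rational_map f -> totally_ramified f x ->
  exists2 c, c != 0 & forall u v,
    bracket (f x) (hom (ratdeg f) (numden f).1 u v) (hom (ratdeg f) (numden f).2 u v)
      = c * bracket x u v ^+ ratdeg f.
Proof.
move=> rf; rewrite /totally_ramified -(size_fib (f x) rf) => /count_full E.
have [srs [c c0 NE]] := fibP (f x) rf.
have [e e0 eE] := bracket_cross (f x); have [e' e'0 e'E] := bracket_cross x.
exists (e * c * e'^-1 ^+ ratdeg f); first by rewrite !mulf_neq0// expf_neq0// invr_eq0.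
move=> u v; rewrite eE -hom_plin NE hom_scale -{1}srs hom_linprod E big_nseq size_nseq.
rewrite srs iter_mulr_1 e'E exprMn !mulrA.
by rewrite -!mulrA [_^-1 ^+ _ * _]mulrA -exprMn mulVf// expr1n mul1r.
Qed.

Lemma ramified_inj f x y : rational_map f -> totally_ramified f x -> f y = f x -> y = x.
Proof.
move=> rf; rewrite /totally_ramified -(size_fib (f x) rf) => /count_full E fyx.
have : y \in fib f (f x) by rewrite mem_fib// fyx.
by rewrite E mem_nseq => /andP[_ /eqP].
Qed.

(** A root of [1 + X + ... + X^(d-1)], whose value at [1] is [d]. *)
Lemma unity_root_neq1 d : (1 < d)%N -> exists2 z : C, z ^+ d = 1 & z != 1.
Proof.
move=> d1; pose P : {poly C} := \poly_(i < d) 1.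
have /closed_rootP[z Pz] : size P != 1%N by rewrite size_poly_eq ?oner_eq0// gtn_eqF.
have PE w : P.[w] = \sum_(i < d) w ^+ i.
  by rewrite horner_poly; apply: eq_bigr => i _; rewrite mul1r.
exists z.
  by apply/eqP; rewrite -subr_eq0 subrX1 -PE (rootP Pz) mulr0.
apply: contraTneq Pz => ->; rewrite rootE PE.
under eq_bigr do rewrite expr1n.
by rewrite sumr_const card_ord pnatr_eq0 -lt0n ltnW.
Qed.

(** Once [x] is moved to infinity, the denominator of [f] is [c] times the power of the form
    vanishing at infinity, so it dehomogenizes to a constant. *)
Lemma fixed_ramified f x : rational_map f -> totally_ramified f x -> f x = x ->
  exists p, mobius_conj f (polymap p).
Proof.
move=> rf tr fx; have [c c0 cE] := ramified_bracket rf tr; rewrite fx in cE.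
have rep := numdenP rf; have [d0 sp sq nz fE] := rep.
set d := ratdeg f in cE rep d0 sp sq nz fE *.
set p := (numden f).1 in cE rep sp sq nz fE *; set q := (numden f).2 in cE rep sp sq nz fE *.
have [x' xx'] : exists x', x' != x by case: (x) => [z|]; [exists None|exists (Some 0)].
have [m mm mE] := mobiusP (oner_neq0 C) xx'.
have D0 := bracket_det xx'; set D := _ - _ in D0.
(* inverse of the coordinate change [(u, v) |-> (bracket x' u v, bracket x u v)] *)
pose A : {poly C} := D^-1 *: ((nume x')%:P - nume x *: 'X).
pose B : {poly C} := D^-1 *: ((deno x')%:P - deno x *: 'X).
have sA : (size A <= 2)%N.
  apply: leq_trans (size_scale_leq _ _) _; apply: leq_trans (size_polyD _ _) _.
  by rewrite geq_max size_polyN (leq_trans (size_polyC_leq1 _))// (leq_trans (size_scale_leq _ _)) ?size_polyX.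
have sB : (size B <= 2)%N.
  apply: leq_trans (size_scale_leq _ _) _; apply: leq_trans (size_polyD _ _) _.
  by rewrite geq_max size_polyN (leq_trans (size_polyC_leq1 _))// (leq_trans (size_scale_leq _ _)) ?size_polyX.
have AE u v : hom 1 A (bracket x' u v) (bracket x u v) = u.
  rewrite /hom !big_ord_recr big_ord0/= !coefE/= /bracket; apply: (mulfI D0).
  by rewrite /D; field.
have BE u v : hom 1 B (bracket x' u v) (bracket x u v) = v.
  rewrite /hom !big_ord_recr big_ord0/= !coefE/= /bracket; apply: (mulfI D0).
  by rewrite /D; field.
pose N := deno x' *: p + (- nume x') *: q.
(* The numerator in the new coordinates, divided by [c] to make the denominator [1]. *)
pose P := c^-1 *: phom d N A B.
have PE u v : hom d P (bracket x' u v) (bracket x u v) = c^-1 * bracket x' (hom d p u v) (hom d q u v).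
  rewrite hom_scale -{1}[d]muln1 hom_phom//.
  by rewrite AE BE /N hom_linear /bracket mulNr.
have sP : (size P <= d.+1)%N.
  apply: leq_trans (size_scale_leq _ _) _; rewrite -{2}[d]muln1; exact: size_phom.
(* The leading coefficient is read at the point [x]; it is nonzero because [f x = x] differs from
   [x']. *)
have Pd : P`_d != 0.
  have [u [v [ux vx]]] := bracket_solve 1 0 xx'.
  have uv : (u != 0) || (v != 0).
    apply: contraT; rewrite negb_or !negbK => /andP[/eqP u0 /eqP v0].
    by move: ux; rewrite u0 v0 /bracket !mulr0 subr0 => /eqP; rewrite eq_sym oner_eq0.
  have := PE u v; rewrite ux vx hom_v0 expr1n mulr1 => ->.
  rewrite mulf_neq0 ?invr_eq0// bracket_eq0 ?(hrep_neq0 rep)// -fE//.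
  have -> : pt u v = x by apply/eqP; rewrite -bracket_eq0// vx.
  by rewrite fx eq_sym.
have sPE : size P = d.+1.
  by apply/eqP; rewrite eqn_leq sP/= ltnNge; apply: contra Pd => h; rewrite nth_default.
have mx : maxn (size P) (size (1 : {poly C})) = d.+1.
  by rewrite sPE size_poly1; apply/maxn_idPl.
have rg : hrep d P 1 (ratfun P 1).
  by have := @hrep_ratfun R P 1 (coprimep1 _); rewrite mx; apply; rewrite ltnS.
have [_ _ _ _ gE] := rg.
exists P, m => //; apply/funext => y; have [u [v [uv ->]]] := pt_surj y.
have h1 : (1 * bracket x' u v != 0) || (bracket x u v != 0).
  rewrite -negb_and mul1r !bracket_eq0//; apply/andP => -[/eqP E /eqP E'].
  by move: xx'; rewrite -E E' eqxx.
rewrite /= /polymap fE// mE ?(hrep_neq0 rep)// mE// gE//.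
rewrite !mul1r PE cE -(ptZ _ _ (invr_neq0 c0)) [c^-1 * (c * _)]mulrA mulVf// mul1r.
congr pt; rewrite /hom big_ord_recl coef1 eqxx mul1r expr0 mul1r subn0 big1 ?addr0//.
by move=> i _; rewrite coef1 mul0r.
Qed.

(** With [x] at [0] and [y] at infinity, [f] becomes a constant times [w^(-d)]; the scaling [l],
    with [l^(d+1) = c / e], removes the constant. *)
Lemma cycle2_ramified f x y : rational_map f -> x != y ->
  totally_ramified f x -> totally_ramified f y -> f x = y -> f y = x ->
  exists n : int, mobius_conj f (powmap n).
Proof.
move=> rf xy tx ty fx fy.
have [c c0 cE] := ramified_bracket rf tx; rewrite fx in cE.
have [e e0 eE] := ramified_bracket rf ty; rewrite fy in eE.
have rep := numdenP rf; have [d0 sp sq nz fE] := rep.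
set d := ratdeg f in cE eE rep d0 sp sq nz fE *.
pose P : {poly C} := 'X^(d.+1) - (c / e)%:P.
have /closed_rootP[l] : size P != 1%N by rewrite size_XnsubC.
rewrite rootE !hornerE subr_eq0 => /eqP lE.
have l0 : l != 0.
  apply: contra_eq_neq lE => ->; rewrite expr0n eq_sym mulf_neq0 ?invr_eq0//.
have [m mm mE] := mobiusP l0 xy.
(* [Negz d.-1] is the integer [-d]. *)
exists (Negz d.-1), m => //; rewrite /powmap prednK//.
have mx : maxn (size (1 : {poly C})) (size ('X^d : {poly C})) = d.+1.
  by rewrite size_poly1 size_polyXn; apply/maxn_idPr.
have rg : hrep d 1 'X^d (ratfun (1 : {poly C}) 'X^d).
  by have := @hrep_ratfun R 1 'X^d (coprime1p _); rewrite mx; apply; rewrite ltnS.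
have [_ _ _ _ gE] := rg.
apply/funext => z; have [u [v [uv ->]]] := pt_surj z.
have h1 : (l * bracket x u v != 0) || (bracket y u v != 0).
  rewrite -negb_and mulf_eq0 (negbTE l0)/= !bracket_eq0//; apply/andP => -[/eqP E /eqP E'].
  by move: xy; rewrite -E E' eqxx.
rewrite /= fE// mE ?(hrep_neq0 rep)// mE// gE// eE cE.
have -> a b : hom d 1 a b = b ^+ d.
  rewrite /hom big_ord_recl coef1 eqxx mul1r expr0 mul1r subn0 big1 ?addr0//.
  by move=> i _; rewrite coef1 mul0r.
have -> a b : hom d 'X^d a b = a ^+ d.
  rewrite /hom big_ord_recr/= coefXn eqxx mul1r subnn mulr1 big1 ?add0r// => i _.
  by rewrite coefXn ltn_eqF ?mul0r.
have ce : c = l ^+ d.+1 * e by rewrite lE divfK.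
rewrite ce exprMn exprS -!mulrA ptZ// [_ * (e * _)]mulrCA ptZ//.
Qed.

(** A direct substitute for the Riemann-Hurwitz bound. In the coordinates [bracket x] and
    [bracket x2], total ramification makes [f] depend on [d]-th powers only; multiplying one
    coordinate of [x3] by a root of unity gives another point with the same image, against total
    ramification at [x3]. *)
Lemma cycle3_ramified f x : rational_map f -> (1 < ratdeg f)%N ->
  (forall k, totally_ramified f (iter k f x)) -> f x != x -> f (f x) != x -> False.
Proof.
move=> rf d1 tr; pose x2 := f x; pose x3 := f x2; pose x4 := f x3 => n1 n2.
have t1 := tr 0%N; have t2 := tr 1%N; have t3 := tr 2.
have n23 : x3 != x2 by apply: contra n1 => /eqP E; apply/eqP/(ramified_inj rf t1).
have n34 : x4 != x3 by apply: contra n23 => /eqP E; apply/eqP/(ramified_inj rf t2).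
have n24 : x4 != x2 by apply: contra n2 => /eqP E; apply/eqP/(ramified_inj rf t1).
have [c c0 cE] := ramified_bracket rf t1.
have [e e0 eE] := ramified_bracket rf t2.
have rep := numdenP rf; have [d0 sp sq nz fE] := rep.
set d := ratdeg f in cE eE rep d0 sp sq nz fE d1 *.
have [z zd z1] := unity_root_neq1 d1.
have nx12 : x != x2 by rewrite eq_sym.
pose a := bracket x (nume x3) (deno x3); pose b := bracket x2 (nume x3) (deno x3).
have a0 : a != 0 by rewrite bracket_eq0 ?ratio_neq0// pt_ratio.
have b0 : b != 0 by rewrite bracket_eq0 ?ratio_neq0// pt_ratio.
have [u [v [uE vE]]] := bracket_solve (z * a) b nx12.
have uv : (u != 0) || (v != 0).
  apply: contraT; rewrite negb_or !negbK => /andP[/eqP u0 /eqP v0].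
  by move: vE; rewrite u0 v0 /bracket !mulr0 subr0 => /esym/eqP; rewrite (negbTE b0).
pose F w := hom d (numden f).1 w; pose G w := hom d (numden f).2 w.
have h2 : bracket x2 (F u v) (G u v) = bracket x2 (F (nume x3) (deno x3)) (G (nume x3) (deno x3)).
  by rewrite [LHS]cE [RHS]cE uE exprMn zd mul1r.
have h3 : bracket x3 (F u v) (G u v) = bracket x3 (F (nume x3) (deno x3)) (G (nume x3) (deno x3)).
  by rewrite [LHS]eE [RHS]eE vE.
have : f (pt u v) = f x3.
  rewrite -[in RHS](pt_ratio x3) (fE _ _ uv) (fE _ _ (ratio_neq0 x3)).
  have n32 : x2 != x3 by rewrite eq_sym.
  have D0 := bracket_det n32.
  suff [e1 e2] : F u v = F (nume x3) (deno x3) /\ G u v = G (nume x3) (deno x3).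
    by congr pt; [exact: e1|exact: e2].
  move: h2 h3; rewrite /bracket; set F1 := F u v; set G1 := G u v; set F2 := F _ _; set G2 := G _ _.
  move=> h2 h3; split; apply: (mulfI D0).
    transitivity (nume x2 * (deno x3 * F1 - nume x3 * G1) - nume x3 * (deno x2 * F1 - nume x2 * G1)); first by ring.
    by rewrite h2 h3; ring.
  transitivity (deno x2 * (deno x3 * F1 - nume x3 * G1) - deno x3 * (deno x2 * F1 - nume x2 * G1)); first by ring.
  by rewrite h2 h3; ring.
move=> /(ramified_inj rf t3) E.
have [k k0 [uk vk]] := ratio_pt uv; rewrite E -/x2 -/x3 in uk vk.
have bl y w w' : bracket y (k * w) (k * w') = k * bracket y w w' by rewrite /bracket; ring.
move: uE vE; rewrite uk vk !bl -/a -/b => /(mulIf a0) kz /eqP.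
by rewrite -subr_eq0 -[X in _ - X]mul1r -mulrBl mulf_eq0 (negbTE b0) orbF subr_eq0 kz (negbTE z1).
Qed.

(** Length one is the polynomial case, length two the power case, and longer cycles are excluded by
    [cycle3_ramified]. *)
Lemma no_ramified_cycle f y n : rational_map f -> ~ exceptional f ->
  ~ (exists p, mobius_conj f (polymap p)) ->
  (0 < n)%N -> iter n f y = y -> ~ (forall k, totally_ramified f (iter k f y)).
Proof.
move=> rf nex npol n0 yn tr.
have d1 : (1 < ratdeg f)%N.
  rewrite ltn_neqAle ratdeg_gt0// andbT; apply/negP => /eqP d1.
  by apply: nex; apply: Or41.
have [fy|fy] := eqVneq (f y) y.
  by apply: npol; exact: fixed_ramified (tr 0%N) fy.
have [ffy|ffy] := eqVneq (f (f y)) y; last exact: cycle3_ramified tr fy ffy.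
apply: nex; apply: Or42; apply: (cycle2_ramified rf _ (tr 0%N) (tr 1%N)) => //=.
by rewrite eq_sym.
Qed.
End Exceptional.

(** * Entropy of finite partitions *)

Section FiniteEntropy.
Context (R : realType) (J : finType) (p : J -> R).
Hypothesis p0 : forall j, 0 <= p j.
Implicit Types (A B D : eqType).

Definition cell A (g : J -> A) (j : J) : R := \sum_(i | g i == g j) p i.

(* The entropy of the partition of [J] into the fibres of [g], for the weights
   [p]: the mean of the information function. *)
Definition fibre_entropy A (g : J -> A) : R := - \sum_j p j * ln (cell g j).

Lemma cell_ge A (g : J -> A) j : p j <= cell g j.
Proof. by rewrite /cell (bigD1 j)//= lerDl sumr_ge0. Qed.

Lemma cell_gt0 A (g : J -> A) j : 0 < p j -> 0 < cell g j.
Proof. by move=> h; apply: lt_le_trans h (cell_ge _ _). Qed.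

Lemma cell_ge0 A (g : J -> A) j : 0 <= cell g j.
Proof. exact: sumr_ge0. Qed.

Lemma cell_fine A B (g : J -> A) (h : J -> B) j :
  (forall i k, g i = g k -> h i = h k) -> cell g j <= cell h j.
Proof.
move=> gh; rewrite /cell [X in X <= _]big_mkcond [X in _ <= X]big_mkcond/=.
by apply: ler_sum => i _; case: eqP => [/gh ->|_]; [rewrite eqxx|case: ifP].
Qed.

Lemma eq_cell A B (g : J -> A) (h : J -> B) j :
  (forall i k, g i = g k <-> h i = h k) -> cell g j = cell h j.
Proof. by move=> gh; apply/eqP; rewrite eq_le !cell_fine// => i k /gh. Qed.

Lemma eq_Hk A B (g : J -> A) (h : J -> B) :
  (forall i k, g i = g k <-> h i = h k) -> fibre_entropy g = fibre_entropy h.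
Proof. by move=> gh; congr (- _); apply: eq_bigr => j _; rewrite (eq_cell _ gh). Qed.

Lemma le_Hk A B (g : J -> A) (h : J -> B) :
  (forall i k, h i = h k -> g i = g k) -> fibre_entropy g <= fibre_entropy h.
Proof.
move=> gh; rewrite lerN2; apply: ler_sum => j _.
have [pj|] := ltP 0 (p j); last first.
  by move=> pj; have -> : p j = 0; [apply/eqP; rewrite eq_le pj p0|rewrite !mul0r].
by rewrite ler_wpM2l// ler_ln ?posrE ?cell_gt0// cell_fine.
Qed.

Lemma ln_le_sub1 (t : R) : 0 < t -> ln t <= t - 1.
Proof. by move=> t0; rewrite -[X in ln X](subrK 1) addrC le_ln1Dx// ltrBrDl subrr. Qed.

(** Grouping the indices by the values [(x, y, z)] cancels the mass of the triple; what remains is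
    the sum of [P(x, y) P(y, z) / P(y)], the weights of a Markov chain. This is the mean that the
    Gibbs inequality needs for [strong_subadditivity]. *)
Lemma sum_cell_ratio (A B D : finType) (a : J -> A) (b : J -> B) (d : J -> D) :
  \sum_j p j * (cell (fun i => (a i, b i)) j * cell (fun i => (b i, d i)) j /
     (cell (fun i => (a i, b i, d i)) j * cell b j)) <= \sum_j p j.
Proof.
pose Pab x y := \sum_(i | (a i == x) && (b i == y)) p i.
pose Pbd y z := \sum_(i | (b i == y) && (d i == z)) p i.
pose Pb y := \sum_(i | b i == y) p i.
pose Pabd x y z := \sum_(i | [&& a i == x, b i == y & d i == z]) p i.
have Pab0 x y : 0 <= Pab x y by exact: sumr_ge0.
have Pbd0 x y : 0 <= Pbd x y by exact: sumr_ge0.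
have Pb0 x : 0 <= Pb x by exact: sumr_ge0.
have E j : cell (fun i => (a i, b i)) j * cell (fun i => (b i, d i)) j /
     (cell (fun i => (a i, b i, d i)) j * cell b j) =
   Pab (a j) (b j) * Pbd (b j) (d j) / (Pabd (a j) (b j) (d j) * Pb (b j)).
  congr (_ * _ / (_ * _)); apply: eq_bigl => i //=; rewrite !xpair_eqE ?andbA//.
under eq_bigr do rewrite E.
rewrite (partition_big (fun j => (a j, b j, d j)) xpredT)//=.
apply: (@le_trans _ _ (\sum_(t : A * B * D) Pab t.1.1 t.1.2 * Pbd t.1.2 t.2 / Pb t.1.2)).
  apply: ler_sum => -[[x y] z] _ /=.
  rewrite (eq_bigr (fun j => p j * (Pab x y * Pbd y z / (Pabd x y z * Pb y)))); last first.
    by move=> j; rewrite !xpair_eqE => /andP[/andP[/eqP-> /eqP->] /eqP->].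
  rewrite -mulr_suml (eq_bigl (fun j => [&& a j == x, b j == y & d j == z])); last first.
    by move=> j; rewrite !xpair_eqE andbA.
  rewrite -/(Pabd x y z) invfM mulrA [_ * (Pab x y * _)]mulrC -!mulrA.
  apply: ler_wpM2l => //; apply: ler_wpM2l => //.
  have [->|n0] := eqVneq (Pabd x y z) 0; first by rewrite !mul0r invr_ge0.
  by rewrite mulrA divff// mul1r.
rewrite -(pair_big xpredT xpredT (fun t z => Pab t.1 t.2 * Pbd t.2 z / Pb t.2))/=.
rewrite -(pair_big xpredT xpredT (fun x y => \sum_z Pab x y * Pbd y z / Pb y))/=.
rewrite exchange_big/= [X in _ <= X](partition_big b xpredT)//=.
apply: ler_sum => y _; rewrite -/(Pb y).
under eq_bigr do rewrite -mulr_suml -mulr_sumr.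
have -> : \sum_z Pbd y z = Pb y by rewrite /Pb (partition_big d xpredT).
rewrite -!mulr_suml.
have -> : \sum_x Pab x y = Pb y.
  rewrite /Pb (partition_big a xpredT)//=; apply: eq_bigr => x _.
  by apply: eq_bigl => i; rewrite andbC.
have [->|n0] := eqVneq (Pb y) 0; first by rewrite !mul0r.
by rewrite mulfK.
Qed.

(** [ln t <= t - 1] is applied at each index to the ratio whose mean is bounded in
    [sum_cell_ratio]. *)
Lemma strong_subadditivity (A B D : finType) (a : J -> A) (b : J -> B) (d : J -> D) :
  fibre_entropy (fun i => (a i, b i, d i)) + fibre_entropy b <= fibre_entropy (fun i => (a i, b i)) + fibre_entropy (fun i => (b i, d i)).
Proof.
rewrite /fibre_entropy -!opprD lerN2 -!big_split/= -subr_ge0 -sumrB.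
have := sum_cell_ratio a b d; rewrite -subr_ge0 -sumrB => /le_trans; apply.
apply: ler_sum => j _; have [pj|pj] := ltP 0 (p j); last first.
  have -> : p j = 0 by apply/eqP; rewrite eq_le pj p0.
  by rewrite !mul0r !addr0 subrr.
have c1 := cell_gt0 (fun i => (a i, b i)) pj; have c2 := cell_gt0 (fun i => (b i, d i)) pj.
have c3 := cell_gt0 (fun i => (a i, b i, d i)) pj; have c4 := cell_gt0 b pj.
rewrite -!mulrDr -mulrBr -{1}[p j]mulr1 -mulrBr ler_wpM2l// -!lnM ?posrE// -ln_div ?posrE ?mulr_gt0//.
rewrite -lerN2 opprB -lnV ?posrE ?divr_gt0 ?mulr_gt0// invf_div.
by apply: ln_le_sub1; rewrite divr_gt0 ?mulr_gt0.
Qed.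
End FiniteEntropy.

(** * Entropy of labellings of a probability space under an invariant map *)

Section PartitionEntropy.
Context (R : realType) (dd : measure_display) (X : measurableType dd).
Variable mu : probability X R.

Definition mlabel (J : eqType) (Z : X -> J) := forall j, measurable (Z @^-1` [set j]).

Definition pr (J : finType) (Z : X -> J) (j : J) : R := fine (mu (Z @^-1` [set j])).

Lemma pr_ge0 (J : finType) (Z : X -> J) j : 0 <= pr Z j.
Proof. by rewrite fine_ge0. Qed.

Lemma mlabel_pred (J : finType) (Z : X -> J) (P : pred J) : mlabel Z ->
  measurable [set x | P (Z x)].
Proof.
move=> mZ; have -> : [set x | P (Z x)] = \bigcup_(j in [set j | P j]) (Z @^-1` [set j]).
  by apply/seteqP; split=> [x Px|x [j /= Pj Zx]]; [exists (Z x)|rewrite Zx].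
by apply: fin_bigcup_measurable => //; exact: finite_finset.
Qed.

Lemma pr_fin (J : finType) (Z : X -> J) j : mlabel Z -> mu (Z @^-1` [set j]) = (pr Z j)%:E.
Proof. by move=> mZ; rewrite fineK// fin_num_measure. Qed.

Lemma mu_seq (J : finType) (Z : X -> J) (s : seq J) : mlabel Z -> uniq s ->
  mu [set x | Z x \in s] = (\sum_(j <- s) pr Z j)%:E.
Proof.
move=> mZ; elim: s => [_|j s IH /= /andP[js us]].
  have -> : [set x | Z x \in [::]] = set0 by apply/seteqP; split.
  by rewrite measure0 big_nil.
have -> : [set x | Z x \in j :: s] = Z @^-1` [set j] `|` [set x | Z x \in s].
  apply/seteqP; split=> x /=; rewrite in_cons; first by move=> /orP[/eqP|]; [left|right].
  by move=> -[->|->]; rewrite ?eqxx ?orbT.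
rewrite measureU; first last.
- by apply/seteqP; split => // x [/= ->]; rewrite (negbTE js).
- exact: (mlabel_pred (mem s) mZ).
- exact: mZ.
by rewrite big_cons EFinD -(IH us) -(pr_fin j mZ).
Qed.

Lemma mu_pred (J : finType) (Z : X -> J) (P : pred J) : mlabel Z ->
  mu [set x | P (Z x)] = (\sum_(j | P j) pr Z j)%:E.
Proof.
move=> mZ; rewrite -big_enum -mu_seq ?enum_uniq//; congr (mu _).
by apply/seteqP; split=> x /=; rewrite mem_enum.
Qed.

Lemma pr_comp (J A : finType) (Z : X -> J) (g : J -> A) a : mlabel Z ->
  pr (g \o Z) a = \sum_(j | g j == a) pr Z j.
Proof.
move=> mZ; rewrite /pr; have := mu_pred (fun j => g j == a) mZ.
have -> : [set x | g (Z x) == a] = (g \o Z) @^-1` [set a].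
  by apply/seteqP; split=> x /=; [move/eqP|move=> ->].
by move=> ->.
Qed.

Lemma mlabel_comp (J A : finType) (Z : X -> J) (g : J -> A) : mlabel Z -> mlabel (g \o Z).
Proof.
move=> mZ a; have -> : (g \o Z) @^-1` [set a] = [set x | g (Z x) == a].
  by apply/seteqP; split=> x /=; [move=> ->|move/eqP].
exact: (@mlabel_pred _ _ (fun j => g j == a)).
Qed.

Lemma mlabel_pair (J A : finType) (Z : X -> J) (Y : X -> A) :
  mlabel Z -> mlabel Y -> mlabel (fun x => (Z x, Y x)).
Proof.
move=> mZ mY [j a].
have -> : (fun x => (Z x, Y x)) @^-1` [set (j, a)] = Z @^-1` [set j] `&` Y @^-1` [set a].
  by apply/seteqP; split=> x /= [-> ->].
exact: measurableI.
Qed.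

Lemma sum_pr (J : finType) (Z : X -> J) : mlabel Z -> \sum_j pr Z j = 1.
Proof.
move=> mZ; apply: EFin_inj; rewrite -(mu_pred xpredT mZ) -(probability_setT mu).
by congr (mu _); apply/seteqP; split.
Qed.

(** Entropies of all coarsenings of one labelling [Z] become finite sums over the labels of [Z], so
    that the inequalities for weights apply to them. *)
Lemma partition_entropy_comp (J A : finType) (Z : X -> J) (g : J -> A) : mlabel Z ->
  partition_entropy mu (g \o Z) = fibre_entropy (pr Z) g.
Proof.
move=> mZ; rewrite /partition_entropy /fibre_entropy; congr (- _).
rewrite [RHS](partition_big g xpredT)//=; apply: eq_bigr => a _.
rewrite -/(pr (g \o Z) a) pr_comp// mulr_suml; apply: eq_bigr => j /eqP gj.
by rewrite /cell gj.
Qed.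

Lemma partition_entropyE (J : finType) (Z : X -> J) : mlabel Z ->
  partition_entropy mu Z = fibre_entropy (pr Z) id.
Proof. by move=> mZ; rewrite -partition_entropy_comp. Qed.

Lemma partition_entropy_ge0 (J : finType) (Z : X -> J) : mlabel Z ->
  0 <= partition_entropy mu Z.
Proof.
move=> mZ; rewrite -oppr_le0 opprK; apply: sumr_le0 => j _.
rewrite mulr_ge0_le0 ?pr_ge0// ln_le0//; rewrite -lee_fin -pr_fin//.
exact: probability_le1.
Qed.

(** The Gibbs inequality against uniform weights. The bound depends on a list containing the labels
    that occur and not on the type [J], which for itineraries is far too large. *)
Lemma partition_entropy_le_ln (J : finType) (Z : X -> J) (s : seq J) : mlabel Z ->
  (forall x, Z x \in s) -> partition_entropy mu Z <= ln (size s)%:R.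
Proof.
move=> mZ Zs; pose t := undup s; pose N : R := (size t)%:R.
have st (F : J -> R) : (forall j, j \notin t -> F j = 0) -> \sum_j F j = \sum_(j <- t) F j.
  move=> F0; rewrite (bigID (mem t))/= [X in _ + X]big1 ?addr0; last by move=> j /F0.
  by rewrite -big_uniq ?undup_uniq.
have p0 j : j \notin t -> pr Z j = 0.
  move=> jt; have E : Z @^-1` [set j] = set0.
    by apply/seteqP; split => // x /= Zx; move: jt; rewrite -Zx mem_undup Zs.
  by rewrite /pr E measure0.
have p1 : \sum_(j <- t) pr Z j = 1 by rewrite -st// sum_pr.
have N0 : 0 < N.
  rewrite ltr0n lt0n; apply/eqP => /size0nil t0.
  by move: p1; rewrite t0 big_nil => /esym/eqP; rewrite oner_eq0.
apply: (@le_trans _ _ (ln N)); last first.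
  by rewrite ler_ln ?posrE//; [rewrite ler_nat size_undup|apply: lt_le_trans N0 _; rewrite ler_nat size_undup].
rewrite /partition_entropy -/(pr Z _) (st (fun j => pr Z j * ln (pr Z j))); last by move=> j /p0 ->; rewrite mul0r.
rewrite -subr_ge0 opprK -[ln N]mul1r -p1 mulr_suml -big_split/=.
apply: (@le_trans _ _ (\sum_(j <- t) (pr Z j - N^-1))).
  by rewrite sumrB p1 big_const_seq count_predT iter_addr_0 -mulr_natl mulfV ?subrr// gt_eqF.
apply: ler_sum => j _; have [pj|pj] := ltP 0 (pr Z j); last first.
  have -> : pr Z j = 0 by apply/eqP; rewrite eq_le pj pr_ge0.
  by rewrite !mul0r addr0 sub0r lerNl oppr0 invr_ge0 ltW.
rewrite -mulrDr -lnM ?posrE// -lerN2 opprB -mulrN -lnV ?posrE ?mulr_gt0//.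
have Np0 : 0 < (N * pr Z j)^-1 by rewrite invr_gt0 mulr_gt0.
apply: (le_trans (ler_wpM2l (ltW pj) (ln_le_sub1 Np0))).
by rewrite mulrBr mulr1 invfM mulrCA mulfV ?mulr1// gt_eqF.
Qed.
Variable T : X -> X.
Hypothesis mT : measurable_fun setT T.
Hypothesis invT : invariant_measure mu T.

Lemma measurable_preT (A : set X) : measurable A -> measurable (T @^-1` A).
Proof. by move=> mA; rewrite -[X in measurable X]setTI; exact: mT. Qed.

Lemma iter_preT n (A : set X) : measurable A ->
  measurable (iter n T @^-1` A) /\ mu (iter n T @^-1` A) = mu A.
Proof.
move=> mA; elim: n => [//|n [mn En]].
have -> : iter n.+1 T @^-1` A = T @^-1` (iter n T @^-1` A).
  by apply/seteqP; split=> x /=; rewrite -iterS iterSr.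
by split; [exact: measurable_preT|rewrite -En -[RHS]invT].
Qed.

Lemma pr_iter (J : finType) (Z : X -> J) n j : mlabel Z -> pr (Z \o iter n T) j = pr Z j.
Proof. by move=> mZ; rewrite /pr; congr fine; have [_ <-] := iter_preT n (mZ j). Qed.

Lemma partition_entropy_iter (J : finType) (Z : X -> J) n : mlabel Z ->
  partition_entropy mu (Z \o iter n T) = partition_entropy mu Z.
Proof.
move=> mZ; rewrite /partition_entropy; congr (- _); apply: eq_bigr => j _.
by rewrite -[fine _]/(pr (Z \o iter n T) j) pr_iter.
Qed.

Lemma mlabel_itinerary k (xi : X -> 'I_k) n : mlabel xi -> mlabel (itinerary T xi n).
Proof.
move=> mxi F.
have -> : itinerary T xi n @^-1` [set F] =
    \bigcap_(i in [set: 'I_n]) (iter i T @^-1` (xi @^-1` [set F i])).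
  apply/seteqP; split=> [x /= <- i _|x h]; first by rewrite /= ffunE.
  by apply/ffunP => i; rewrite ffunE; exact: h.
apply: fin_bigcap_measurable; first exact: finite_finset.
by move=> i _; have [] := iter_preT i (mxi (F i)).
Qed.

Section Restriction.
Context (K : finType) (N : nat).

(** The window of length [n] starting at [s] of a word; [inord] is faithful as long as
    [s + n <= N.+1]. *)
Definition restr s n (F : {ffun 'I_N.+1 -> K}) : {ffun 'I_n -> K} :=
  [ffun i : 'I_n => F (inord (s + i))].

Lemma restrP s n (F G : {ffun 'I_N.+1 -> K}) : restr s n F = restr s n G <->
  forall i, (s <= i < s + n)%N -> F (inord i) = G (inord i).
Proof.
split=> [/ffunP h i /andP[si isn]|h].
  have lt : (i - s < n)%N by rewrite ltn_subLR.
  by have := h (Ordinal lt); rewrite !ffunE/= subnKC.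
by apply/ffunP => i; rewrite !ffunE; apply: h; rewrite leq_addr ltn_add2l ltn_ord.
Qed.
End Restriction.

Lemma restr_itinerary k (xi : X -> 'I_k) N s n x : (s + n <= N.+1)%N ->
  restr s n (itinerary T xi N.+1 x) = itinerary T xi n (iter s T x).
Proof.
move=> h; apply/ffunP => i; rewrite !ffunE inordK; first by rewrite addnC iterD.
by apply: leq_trans h; rewrite ltn_add2l.
Qed.

Lemma partition_entropy_restr k (xi : X -> 'I_k) N s n : mlabel xi -> (s + n <= N.+1)%N ->
  fibre_entropy (pr (itinerary T xi N.+1)) (restr s n) = partition_entropy mu (itinerary T xi n).
Proof.
move=> mxi h; rewrite -partition_entropy_comp; last exact: mlabel_itinerary.
rewrite -[RHS](partition_entropy_iter s); last exact: mlabel_itinerary.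
by congr partition_entropy; apply/funext => x /=; rewrite restr_itinerary.
Qed.

(* The increments of the entropies of the itineraries decrease, hence so do their
   averages: the limit in [entropy_wrt] exists. *)
Lemma entropy_increment k (xi : X -> 'I_k) n : mlabel xi ->
  partition_entropy mu (itinerary T xi n.+2) + partition_entropy mu (itinerary T xi n) <=
  partition_entropy mu (itinerary T xi n.+1) + partition_entropy mu (itinerary T xi n.+1).
Proof.
(* A word of length [n + 2] is split into its first letter, the [n] middle ones and the last; by
   invariance the entropy of a window depends on its length only. *)
move=> mxi; have := strong_subadditivity (pr_ge0 (itinerary T xi n.+2))
  (restr 0 1) (restr 1 n) (restr n.+1 1).
rewrite partition_entropy_restr//.
rewrite (@eq_Hk _ _ _ (pr_ge0 _) _ _ _ (restr 0 n.+2)); last first.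
  move=> F G; split.
    move=> [/restrP a /restrP b /restrP d]; apply/restrP => i /andP[_ i2].
    have [i0|i0] := posnP i; first by apply: a; rewrite i0.
    have [i1|i1] := ltnP i n.+1; first by apply: b; rewrite i0 add1n.
    by apply: d; rewrite i1 addn1.
  move=> /restrP h; congr (_, _, _); apply/restrP => i /andP[i1 i2]; apply: h; lia.
rewrite (@eq_Hk _ _ _ (pr_ge0 _) _ _ (fun i => (restr 0 1 i, restr 1 n i)) (restr 0 n.+1)); last first.
  move=> F G; split.
    move=> [/restrP a /restrP b]; apply/restrP => i /andP[_ i2].
    have [i0|i0] := posnP i; first by apply: a; rewrite i0.
    by apply: b; rewrite i0 add1n.
  move=> /restrP h; congr (_, _); apply/restrP => i /andP[i1 i2]; apply: h; lia.
rewrite (@eq_Hk _ _ _ (pr_ge0 _) _ _ (fun i => (restr 1 n i, restr n.+1 1 i)) (restr 1 n.+1)); last first.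
  move=> F G; split.
    move=> [/restrP a /restrP b]; apply/restrP => i /andP[i1 i2].
    have [i0|i0] := ltnP i n.+1; first by apply: a; rewrite i1 add1n.
    by apply: b; rewrite i0 addn1.
  move=> /restrP h; congr (_, _); apply/restrP => i /andP[i1 i2]; apply: h; lia.
by rewrite !partition_entropy_restr.
Qed.

Lemma cvg_entropy k (xi : X -> 'I_k) : mlabel xi ->
  cvgn (fun n => partition_entropy mu (itinerary T xi n) / n%:R).
Proof.
move=> mxi; pose H n := partition_entropy mu (itinerary T xi n).
have H0 n : 0 <= H n by apply/partition_entropy_ge0/mlabel_itinerary.
have inc n : H n.+2 - H n.+1 <= H n.+1 - H n.
  by rewrite lerBlDr addrAC lerBrDr; exact: entropy_increment.
(* The next increment is at most the average [H n / n], which is what makes the averages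
   decrease. *)
have mean n : n%:R * (H n.+1 - H n) <= H n.
  elim: n => [|n IH]; first by rewrite mul0r.
  rewrite -natr1 mulrDl mul1r -lerBrDr.
  apply: (le_trans (ler_wpM2l (ler0n _ n) (inc n))); apply: (le_trans IH).
  by have := inc n; lra.
(* The term of index [0] is a division by zero; the sequence is monotone from index [1] on. *)
suff /cvg_ex[l hl] : cvgn (fun n => H n.+1 / n.+1%:R).
  apply/cvg_ex; exists l; rewrite -(cvg_shiftS (fun n => H n / n%:R)); exact: hl.
apply: nonincreasing_is_cvgn.
  apply/nonincreasing_seqP => n; rewrite ler_pdivrMr ?ltr0n// mulrAC ler_pdivlMr ?ltr0n//.
  have := mean n.+1; move: (H n.+1) (H n.+2) => a b; rewrite -[n.+2%:R]natr1.
  move: n.+1%:R => c; lra.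
by exists 0 => _ [n _ <-]; rewrite divr_ge0.
Qed.

(** * Estimates of conditional entropy *)

Lemma sub1V_le_ln (t : R) : 0 < t -> 1 - t^-1 <= ln t.
Proof.
move=> t0; rewrite -[t in ln t]invrK lnV ?posrE ?invr_gt0// lerNr opprB.
by apply: ln_le_sub1; rewrite invr_gt0.
Qed.

(** Modulus of continuity of [x ln x] at [0], from [ln s >= 1 - 1 / s] at [s = sqrt x]. *)
Lemma xlnx_ge (x : R) : 0 <= x -> - (x * ln x) <= 2 * Num.sqrt x.
Proof.
rewrite le_eqVlt => /orP[/eqP<-|x0]; first by rewrite mul0r oppr0 sqrtr0 mulr0.
have s0 : 0 < Num.sqrt x by rewrite sqrtr_gt0.
have := sub1V_le_ln s0; rewrite -{3 4}[x](sqr_sqrtr (ltW x0)).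
move: s0; set s := Num.sqrt x => s0 h.
have -> : s ^+ 2 * ln (s ^+ 2) = 2 * (s * s * ln s).
  by rewrite expr2 lnM ?posrE//; move: (ln s) => t; ring.
have : s * s * (1 - s^-1) <= s * s * ln s by rewrite ler_wpM2l// mulr_ge0// ltW.
rewrite mulrBr mulr1 mulfK ?gt_eqF//.
have s2 : 0 <= s * s by rewrite mulr_ge0 ?ltW.
move: (s * s * ln s) (s * s) s2 => a b b0; lra.
Qed.

Section FiniteConditional.
Context (J : finType) (p : J -> R).
Hypothesis p0 : forall j, 0 <= p j.

(** Index by index, the information given by [id] exceeds that given by [g] by
    [ln (cell p g j / p j)], which is at least [ln D] on [S] and nonnegative elsewhere. *)
Lemma Hk_ge_gain (B : eqType) (g : J -> B) (S : pred J) (D : R) : 1 <= D ->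
  (forall j, S j -> p j * D <= cell p g j) ->
  fibre_entropy p g + ln D * \sum_(j | S j) p j <= fibre_entropy p id.
Proof.
move=> D1 h; have D0 : 0 < D by apply: lt_le_trans D1.
have cid j : cell p id j = p j by rewrite /cell (big_pred1 j).
rewrite /fibre_entropy -lerBrDl opprK [X in _ <= X]addrC -sumrB big_mkcond/= mulr_sumr.
apply: ler_sum => j _; rewrite cid -mulrBr.
have [pj|] := ltP 0 (p j); last first.
  by move=> pj; have -> : p j = 0; [apply/eqP; rewrite eq_le pj p0|rewrite if_same mulr0 mul0r].
have cj := cell_gt0 p0 g pj.
case: ifP => [/h hj|_].
  rewrite mulrC; apply: ler_wpM2l; first exact: ltW.
  rewrite lerBrDr -lnM ?posrE// ler_ln ?posrE ?mulr_gt0//.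
  by rewrite mulrC.
rewrite mulr0; apply: mulr_ge0; first exact: ltW.
by rewrite subr_ge0 ler_ln ?posrE// cell_ge.
Qed.
End FiniteConditional.

(** On the diagonal [p ln (cell / p) <= cell - p], and these differences add up to the mass off the
    diagonal, at most [e]; off the diagonal every weight is at most [e] and contributes at most
    [2 sqrt e]. *)
Lemma Hk_diag (K : finType) (p : K * K -> R) (e : R) : (forall j, 0 <= p j) ->
  \sum_j p j <= 1 -> \sum_(j | j.1 != j.2) p j <= e ->
  fibre_entropy p id - fibre_entropy p snd <= #|{: K * K}|%:R * (2 * Num.sqrt e) + e.
Proof.
move=> p0 p1 pe.
have cid j : cell p id j = p j by rewrite /cell (big_pred1 j).
have pj1 (S : pred (K * K)) : \sum_(j | S j) p j <= 1.
  by apply: le_trans p1; rewrite [X in X <= _]big_mkcond; apply: ler_sum => j _; case: ifP.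
have le_e j : j.1 != j.2 -> p j <= e.
  by move=> jj; apply: le_trans pe; rewrite (bigD1 j)//= lerDl sumr_ge0.
have e0 : 0 <= e by apply: le_trans pe; apply: sumr_ge0.
rewrite /fibre_entropy opprK addrC -sumrB.
have -> : #|{: K * K}|%:R * (2 * Num.sqrt e) = \sum_(j : K * K) (2 * Num.sqrt e).
  by rewrite big_const iter_addr_0 mulr_natl.
apply: (@le_trans _ _ (\sum_(j : K * K) (2 * Num.sqrt e) + \sum_(j | j.1 != j.2) p j)); last by rewrite lerD2l.
have -> : \sum_(j | j.1 != j.2) p j = \sum_(j : K * K | j.1 == j.2) (cell p snd j - p j).
  rewrite (partition_big snd xpredT)//= [RHS](partition_big snd xpredT)//=.
  apply: eq_bigr => b _; rewrite [RHS](big_pred1 (b, b)); last first.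
    by move=> [x y]; rewrite /= xpair_eqE; case: (eqVneq y b) => [->|]; rewrite ?andbF ?andbT.
  rewrite /cell [X in _ = X - _](bigD1 (b, b))//= addrAC subrr add0r.
  apply: eq_bigl => -[x y] /=; rewrite xpair_eqE.
  by case: (eqVneq y b) => [->|]; rewrite ?andbF ?andbT//= ?andbT.
rewrite [X in _ <= _ + X]big_mkcond -big_split/=; apply: ler_sum => j _.
rewrite cid -mulrBr; have [pj|] := ltP 0 (p j); last first.
  move=> pj; have -> : p j = 0; first by apply/eqP; rewrite eq_le pj p0.
  by rewrite mul0r addr_ge0 ?mulr_ge0 ?sqrtr_ge0//; case: ifP => // _; rewrite subr0 cell_ge0.
have cj := cell_gt0 p0 snd pj.
case: eqP => [jj|/eqP jj].
  apply: (@le_trans _ _ (cell p snd j - p j)); last by rewrite lerDr mulr_ge0 ?sqrtr_ge0.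
  rewrite -ln_div ?posrE//.
  have r0 : 0 < cell p snd j / p j by rewrite divr_gt0.
  apply: (le_trans (ler_wpM2l (ltW pj) (ln_le_sub1 r0))).
  by rewrite mulrBr mulr1 mulrCA divff ?mulr1// gt_eqF.
rewrite addr0 mulrBr; apply: (@le_trans _ _ (- (p j * ln (p j)))).
  by rewrite gerDr mulr_ge0_le0// ln_le0// pj1.
apply: (le_trans (xlnx_ge (p0 j))); rewrite ler_wpM2l// ler_wsqrtr// le_e//.
Qed.

Lemma partition_entropy_le (J K : finType) (A : X -> J) (B : X -> K) : mlabel A ->
  (forall x y, A x = A y -> B x = B y) ->
  partition_entropy mu B <= partition_entropy mu A.
Proof.
(* The value of [g] at a label that is not taken is irrelevant. *)
move=> mA AB; pose g a := B (xget point [set x | A x = a]).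
have -> : B = g \o A.
  apply/funext => x /=; rewrite /g; case: xgetP => [y _ /= e|/(_ x)/= //].
  exact: AB.
rewrite partition_entropy_comp// partition_entropyE//.
exact: (le_Hk (pr_ge0 A) (fun i k (e : id i = id k) => congr1 g e)).
Qed.

Lemma partition_entropy_ssa (J K L : finType) (A : X -> J) (B : X -> K) (D : X -> L) :
  mlabel A -> mlabel B -> mlabel D ->
  partition_entropy mu (fun x => (A x, B x, D x)) + partition_entropy mu B <=
  partition_entropy mu (fun x => (A x, B x)) + partition_entropy mu (fun x => (B x, D x)).
Proof.
move=> mA mB mD; have mZ := mlabel_pair (mlabel_pair mA mB) mD.
have := strong_subadditivity (pr_ge0 (fun x => (A x, B x, D x)))
  (fun j => j.1.1) (fun j => j.1.2) (fun j => j.2).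
by rewrite -!partition_entropy_comp.
Qed.

Lemma itineraryS k (xi : X -> 'I_k) n x y :
  itinerary T xi n.+1 x = itinerary T xi n.+1 y <->
  itinerary T xi n x = itinerary T xi n y /\ xi (iter n T x) = xi (iter n T y).
Proof.
split=> [/ffunP h|[/ffunP h e]].
  split; last by have := h ord_max; rewrite !ffunE.
  by apply/ffunP => i; have := h (widen_ord (leqnSn n) i); rewrite !ffunE.
apply/ffunP => i; rewrite !ffunE; have [i_n|] := ltnP i n.
  by have := h (Ordinal i_n); rewrite !ffunE.
by move=> ni; have -> : nat_of_ord i = n by apply/eqP; rewrite eqn_leq ni -ltnS ltn_ord.
Qed.

Lemma mlabel_iter (J : finType) (Z : X -> J) n : mlabel Z -> mlabel (Z \o iter n T).
Proof. by move=> mZ j; have [] := iter_preT n (mZ j). Qed.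

(** The joint itinerary is lengthened by a letter of [eta], then by one of [xi]. By strong
    subadditivity the first adds no more than it adds to the itinerary of [eta] alone, the second no
    more than the conditional entropy of [xi] given [eta]. *)
Lemma entropy_approx k l (xi : X -> 'I_k) (eta : X -> 'I_l) n : mlabel xi -> mlabel eta ->
  partition_entropy mu (itinerary T xi n) <= partition_entropy mu (itinerary T eta n) +
    n%:R * (partition_entropy mu (fun x => (xi x, eta x)) - partition_entropy mu eta).
Proof.
move=> mxi meta; set c := _ - _.
have mA m := mlabel_itinerary (n := m) mxi; have mB m := mlabel_itinerary (n := m) meta.
pose HH m := partition_entropy mu (fun x => (itinerary T xi m x, itinerary T eta m x)).
apply: (@le_trans _ _ (HH n)); first by apply: (partition_entropy_le (mlabel_pair (mA n) (mB n))) => x y [].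
elim: n => [|n IH].
  rewrite mul0r addr0; apply: (partition_entropy_le (mB 0)) => x y _.
  by congr (_, _); apply/ffunP => -[].
have mx := mlabel_iter n mxi; have me := mlabel_iter n meta.
have h1 := partition_entropy_ssa (mA n) (mB n) me.
have h2 := partition_entropy_ssa (mlabel_pair (mA n) (mB n)) me mx.
have E1 : partition_entropy mu (fun x => (itinerary T eta n x, (eta \o iter n T) x)) <=
    partition_entropy mu (itinerary T eta n.+1).
  by apply: (partition_entropy_le (mB n.+1)) => x y /itineraryS[-> /= ->].
have E2 : HH n.+1 <= partition_entropy mu (fun x => (itinerary T xi n x, itinerary T eta n x,
    (eta \o iter n T) x, (xi \o iter n T) x)).
  apply: partition_entropy_le => [|x y [] a b u v].
    exact: mlabel_pair (mlabel_pair (mlabel_pair (mA n) (mB n)) me) mx.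
  by congr (_, _); apply/itineraryS.
have E3 : partition_entropy mu (fun x => ((eta \o iter n T) x, (xi \o iter n T) x)) =
    partition_entropy mu (fun x => (xi x, eta x)).
  rewrite -(partition_entropy_iter n (mlabel_pair mxi meta)); apply/eqP.
  rewrite eq_le; apply/andP; split.
    by apply: (partition_entropy_le (mlabel_iter n (mlabel_pair mxi meta))) => x y [] /= -> ->.
  by apply: (partition_entropy_le (mlabel_pair me mx)) => x y [] /= -> ->.
have E4 := partition_entropy_iter n meta.
move: IH h1 h2 E1 E2; rewrite E3 E4 /HH -natr1 mulrDl mul1r /c; lra.
Qed.

Lemma entropy_near k (xi eta : X -> 'I_k) (e : R) : mlabel xi -> mlabel eta ->
  (mu [set x | xi x != eta x] <= e%:E)%E ->
  partition_entropy mu (fun x => (xi x, eta x)) - partition_entropy mu eta <=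
  #|{: 'I_k * 'I_k}|%:R * (2 * Num.sqrt e) + e.
Proof.
move=> mxi meta h; have mZ := mlabel_pair mxi meta.
rewrite (partition_entropyE mZ) -[eta in X in _ - X]/(snd \o (fun x => (xi x, eta x))).
rewrite partition_entropy_comp//; apply: Hk_diag.
- by move=> j; exact: pr_ge0.
- by rewrite sum_pr.
- by rewrite -lee_fin -(mu_pred (fun j => j.1 != j.2) mZ).
Qed.

Lemma entropy_wrt_le k (xi : X -> 'I_k) (h K : R) : mlabel xi ->
  (forall n, partition_entropy mu (itinerary T xi n) <= K + n%:R * h) ->
  entropy_wrt mu T xi <= h.
Proof.
move=> mxi le; apply/ler_addgt0Pr => e e0; apply: limr_le; first exact: cvg_entropy.
near=> n.
have n0 : (0 < n%:R :> R) by rewrite ltr0n; near: n; exact: nbhs_infty_gt.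
rewrite ler_pdivrMr//; apply: (le_trans (le n)).
have : K / e <= n%:R by near: n; exact: nbhs_infty_ger.
rewrite ler_pdivrMr// mulrDl mulrC (mulrC e); lra.
Unshelve. all: by end_near.
Qed.

Lemma entropy_wrt_ge k (xi : X -> 'I_k) (h : R) : mlabel xi ->
  (forall n, partition_entropy mu (itinerary T xi n) + h <=
     partition_entropy mu (itinerary T xi n.+1)) ->
  h <= entropy_wrt mu T xi.
Proof.
move=> mxi le; have ge n : n%:R * h <= partition_entropy mu (itinerary T xi n).
  elim: n => [|n IH]; first by rewrite mul0r; apply/partition_entropy_ge0/mlabel_itinerary.
  by rewrite -natr1 mulrDl mul1r; apply: le_trans (le n); rewrite lerD2r.
apply: limr_ge; first exact: cvg_entropy.
near=> n; rewrite ler_pdivlMr; first by rewrite mulrC.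
by rewrite ltr0n; near: n; exact: nbhs_infty_gt.
Unshelve. all: by end_near.
Qed.

Lemma itinerarySl k (xi : X -> 'I_k) n x y :
  itinerary T xi n.+1 x = itinerary T xi n.+1 y <->
  xi x = xi y /\ itinerary T xi n (T x) = itinerary T xi n (T y).
Proof.
split=> [/ffunP h|[e /ffunP h]].
  split; first by have := h ord0; rewrite !ffunE.
  apply/ffunP => i; have := h (lift ord0 i); by rewrite !ffunE lift0 !iterSr.
apply/ffunP => i; rewrite !ffunE; case: (unliftP ord0 i) => [j|] -> //.
by have := h j; rewrite !ffunE -!iterSr lift0.
Qed.

(** The increment of the entropy is the conditional entropy of [xi] given the itinerary of [T x]; by
    invariance a cell in [S] fills at most a fraction [1 / D] of the preimage of any [A], which
    gives [ln D] on it. *)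
Lemma entropy_wrt_ge_gain k (xi : X -> 'I_k) (S : pred 'I_k) (D c : R) : mlabel xi ->
  1 <= D ->
  (forall j A, S j -> measurable A ->
    (D%:E * mu (xi @^-1` [set j] `&` T @^-1` A) <= mu A)%E) ->
  (c%:E <= mu [set x | S (xi x)])%E ->
  c * ln D <= entropy_wrt mu T xi.
Proof.
move=> mxi D1 gain cS; apply: entropy_wrt_ge => // n.
have mB : mlabel (itinerary T xi n \o T) := mlabel_iter 1 (mlabel_itinerary (n := n) mxi).
have mZ := mlabel_pair mxi mB.
apply: (@le_trans _ _ (partition_entropy mu (fun x => (xi x, (itinerary T xi n \o T) x)))); last first.
  apply: partition_entropy_le; first exact: mlabel_itinerary.
  by move=> x y /itinerarySl[-> /= ->].
rewrite -(partition_entropy_iter 1 (mlabel_itinerary (n := n) mxi)).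
rewrite -[_ \o iter 1 T]/(snd \o (fun x => (xi x, (itinerary T xi n \o T) x))).
rewrite partition_entropy_comp// partition_entropyE//.
apply: (@le_trans _ _ (fibre_entropy (pr (fun x => (xi x, (itinerary T xi n \o T) x))) snd +
    ln D * \sum_(j | S j.1) pr (fun x => (xi x, (itinerary T xi n \o T) x)) j)).
  rewrite lerD2l mulrC ler_wpM2l ?ln_ge0// -lee_fin -(mu_pred (fun j => S j.1) mZ).
  exact: cS.
apply: (Hk_ge_gain (pr_ge0 _)) => //.
move=> [a b] /= Sa; rewrite /cell/=.
have -> : \sum_(i : 'I_k * {ffun 'I_n -> 'I_k} | i.2 == b) pr (fun x => (xi x, (itinerary T xi n \o T) x)) i =
    pr (itinerary T xi n) b.
  rewrite -(pr_iter 1 _ (mlabel_itinerary (n := n) mxi)).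
  by rewrite -(pr_comp (Z := fun x => (xi x, (itinerary T xi n \o T) x)) snd).
rewrite -lee_fin EFinM -!pr_fin//; last exact: mlabel_itinerary.
rewrite muleC; apply: le_trans (gain a _ Sa (mlabel_itinerary (n := n) mxi b)).
have -> // : (fun x => (xi x, (itinerary T xi n \o T) x)) @^-1` [set (a, b)] =
  xi @^-1` [set a] `&` T @^-1` (itinerary T xi n @^-1` [set b]).
by apply/seteqP; split=> x /= [-> ->].
Qed.
End PartitionEntropy.

(** * Lower bound on the entropy of a balanced measure *)

Section LowerBound.
Context (R : realType).
Local Notation C := R[i].
Local Notation sphere := (sphere R).
Implicit Types (mu : probability (borel_sphere R) R) (f : sphere -> sphere).

(** Otherwise coprimality makes [p] divide its own derivative, so that [p] is constant; likewise for
    [q]. *)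
Lemma wronskian_neq0 (p q : {poly C}) : coprimep p q -> (1 < maxn (size p) (size q))%N ->
  p^`() * q - p * q^`() != 0.
Proof.
move=> cpq; apply: contraTneq => /eqP; rewrite subr_eq0 => /eqP pq.
have const (r s : {poly C}) : coprimep r s -> r %| s * r^`() -> (size r <= 1)%N.
  move=> crs; rewrite Gauss_dvdpr// => /dvdp_leq h; rewrite leqNgt; apply/negP => r1.
  have rn0 : r != 0 by rewrite -size_poly_gt0 ltnW.
  have r0 : r^`() != 0.
    apply/eqP => /(congr1 (fun t : {poly C} => t`_((size r).-2))); rewrite coef_deriv coef0 => /eqP.
    by rewrite mulrn_eq0/= prednK ?lead_coef_eq0 ?(negbTE rn0) -?subn1 ?subn_gt0// -lead_coefE lead_coef_eq0 (negbTE rn0).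
  by have := h r0; rewrite leqNgt lt_size_deriv.
rewrite -leqNgt geq_max; apply/andP; split.
  by apply: (const p q cpq); rewrite mulrC pq dvdp_mulr.
by apply: (const q p); [rewrite coprimep_sym|rewrite -pq dvdp_mull].
Qed.

(** A finite point of multiplicity at least two is a double root of [p - a q] or of [q], hence a
    root of the Wronskian; infinity is put on the list in any case. *)
Lemma critical_finite f : rational_map f -> exists L : seq sphere,
  forall x, x \notin L -> (count_mem x (fib f (f x)) <= 1)%N.
Proof.
move=> rf; have [[/= cpq s1 Ef] _] := hrep_ratrep (numdenP rf).
set p := (numden f).1 in cpq s1 Ef; set q := (numden f).2 in cpq s1 Ef.
have w0 := wronskian_neq0 cpq s1; set w := _ - _ in w0.
have [rs Ew] := closed_field_poly_normal w.
exists (None :: map Some rs) => x; rewrite in_cons negb_or => /andP[].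
case: x => // z _; rewrite mem_map; last by move=> ? ? [].
apply: contraR; rewrite -ltnNge count_fib// => m2.
suff : root w z by rewrite Ew rootZ ?lead_coef_eq0// root_prod_XsubC.
have dbl (r : {poly C}) : (1 < mup z r)%N -> r != 0 -> r.[z] = 0 /\ r^`().[z] = 0.
  move=> m r0; rewrite mup_geq// in m; move: m => /dvdpP[t ->].
  by rewrite derivM deriv_exp derivXsubC !hornerE/= subrr; split; ring.
move: m2; rewrite /preim_mult (surjective_pairing (numden f)) -/p -/q.
have pn := hrep_plin_neq0 (f (Some z)) (numdenP rf).
case E : (f (Some z)) pn => [a|] pn /dbl /(_ pn).
  rewrite derivB derivZ !hornerE => -[/eqP h1 /eqP h2].
  move: h1 h2; rewrite !subr_eq0 => /eqP h1 /eqP h2.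
  by apply/rootP; rewrite /w !hornerE h1 h2; ring.
by move=> [h1 h2]; apply/rootP; rewrite /w !hornerE h1 h2; ring.
Qed.

Lemma measurable_find (dd : measure_display) (X : measurableType dd) (I : Type)
    (s : seq I) (W : I -> set X) (j : nat) : (forall i, measurable (W i)) ->
  measurable [set x | find (fun i => `[< W i x >]) s = j].
Proof.
move=> mW; elim: s j => [|i s IH] j /=.
  have [->|j0] := eqVneq j 0%N.
    by have -> : [set x : X | 0%N = 0%N] = setT by apply/seteqP; split.
  by have -> : [set x : X | 0%N = j] = set0 by apply/seteqP; split => // x /= /esym/eqP; rewrite (negbTE j0).
case: j => [|j].
  have -> // : [set x | (if `[< W i x >] then 0%N else (find (fun i => `[< W i x >]) s).+1) = 0%N] = W i.
  by apply/seteqP; split => x /=; case: asboolP.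
have -> : [set x | (if `[< W i x >] then 0%N else (find (fun i => `[< W i x >]) s).+1) = j.+1]
   = ~` W i `&` [set x | find (fun i => `[< W i x >]) s = j].
  by apply/seteqP; split => x /=; case: asboolP => // nW; [move=> [->]|move=> []|move=> [_ ->]].
by apply: measurableI; [exact: measurableC|exact: IH].
Qed.

Lemma KS_entropy_ge mu f : rational_map f -> invariant_measure mu f -> balanced mu f ->
  (forall x, mu [set x] = 0%E) ->
  (forall (A : set sphere) (c : R), (mu A < c%:E)%E ->
         exists U : set sphere, [/\ open U, A `<=` U & (mu U < c%:E)%E]) ->
  ((ln (ratdeg f)%:R)%:E <= KS_entropy mu f)%E.
Proof.
move=> rf inv bal noatom outer.
have d0 : 0 < (ratdeg f)%:R :> R by rewrite ltr0n ratdeg_gt0.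
have d1 : 1 <= (ratdeg f)%:R :> R by rewrite ler1n ratdeg_gt0.
have l0 : 0 <= ln (ratdeg f)%:R :> R by rewrite ln_ge0.
suff gain (e : R) : 0 < e -> (((1 - e) * ln (ratdeg f)%:R)%:E <= KS_entropy mu f)%E.
  apply/lee_addgt0Pr => e e0; pose l : R := ln (ratdeg f)%:R.
  (* This choice makes the loss [e l / (l + 1)] at most [e], also for [l = 0]. *)
  have e1 : 0 < e / (l + 1) by rewrite divr_gt0// ltr_wpDl.
  have := gain _ e1; rewrite -/l => /(leeD2r e%:E); apply: le_trans.
  rewrite -EFinD lee_fin mulrBl mul1r -addrA lerDl addrC subr_ge0.
  rewrite mulrAC ler_pdivrMr ?ltr_wpDl// ler_wpM2l ?lerDl ?ltW//.
move=> e0; have [L Lcrit] := critical_finite rf.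
have muL : mu [set` L] = 0%E.
  elim: (L) => [|x l IH].
    by have -> : [set` ([::] : seq sphere)] = set0 by apply/seteqP; split.
  rewrite set_of_cons; apply/eqP; rewrite -measure_le0.
  apply: (le_trans (measureU2 mu (set1_borel x) (finite_borel l))).
  rewrite [X in (X + _)%E](_ : _ = 0%E); last exact: noatom.
  by rewrite [X in (_ + X)%E](_ : _ = 0%E) ?adde0.
have muLe : (mu [set` L] < e%:E)%E by rewrite muL lte_fin.
have [N [Nop LN muN]] := outer _ _ muLe.
have /choice[W0 W0P] : forall x : sphere, exists W : set sphere, [/\ open W, W x & x \notin L ->
   forall y, (count (fun x => `[< W x >]) (fib f y) <= 1)%N].
  move=> x; have [W [oW Wx cW]] := fib_count_open x rf.
  by exists W; split => // xL y; apply: leq_trans (cW y) (Lcrit _ xL).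
(* The points of [L] are covered by the single set [N] of small mass, the others by sets on which
   [f] is injective. *)
pose W x := if x \in L then N else W0 x.
have oW x : open (W x) by rewrite /W; case: ifP => // _; have [] := W0P x.
have mW x : measurable (W x : set (borel_sphere R)) by exact: open_borel.
have : compact [set: sphere] by exact: sphere_compact.
rewrite compact_cover => /(_ sphere setT W)[||D _ cD]; first by move=> i _; exact: oW.
  move=> x _; exists x => //; rewrite /W; case: ifP => [xL|_]; first exact: LN.
  by have [] := W0P x.
pose s := finmap.enum_fset D; pose n := size s.
pose xi0 (x : borel_sphere R) := find (fun y => `[< W y x >]) s.
have hasW x : has (fun y => `[< W y x >]) s.
  have [y yD Wyx] := cD x I; apply/hasP; exists y => //; exact/asboolP.
have xi_lt x : (xi0 x < n.+1)%N by rewrite ltnW// ltnS -has_find hasW.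
(* [inord] asks for a successor; the label [n] is never taken. *)
pose xi (x : borel_sphere R) : 'I_n.+1 := inord (xi0 x).
have xiE x : xi x = xi0 x :> nat by rewrite inordK.
have WE x : W (nth (point : sphere) s (xi x)) x.
  by rewrite xiE; apply/asboolP; exact: (nth_find (point : sphere) (hasW x)).
have mxi : mlabel xi.
  move=> j; have -> : xi @^-1` [set j] = [set x | xi0 x = j].
    by apply/seteqP; split=> x /=; [move=> <-; rewrite xiE|move=> h; apply: val_inj; rewrite /= xiE].
  exact: measurable_find.
apply: (@le_trans _ _ (entropy_wrt mu f xi)%:E); last first.
  by apply: ereal_sup_ubound; exists n.+1, xi; split.
rewrite lee_fin.
apply: (entropy_wrt_ge_gain (continuous_borel (rational_continuous rf)) inv
   (S := fun j => nth (point : sphere) s j \notin L)) => //.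
  move=> j A jL mA; have [->|/set0P[x0 [/= x0j _]]] := eqVneq (xi @^-1` [set j] `&` f @^-1` A) set0.
    by rewrite measure0 mule0.
  have sub : xi @^-1` [set j] `&` f @^-1` A `<=` W (nth (point : sphere) s j) `&` f @^-1` A.
    by move=> x [/= <- ?]; split.
  have mfA : measurable (f @^-1` A : set (borel_sphere R)).
    rewrite -[X in measurable X]setTI.
    exact: (continuous_borel (rational_continuous rf)).
  apply: (@le_trans _ _ ((ratdeg f)%:R%:E * mu (W (nth (point : sphere) s j) `&` f @^-1` A))%E).
    apply: lee_wpmul2l; first by rewrite lee_fin ltW.
    by apply: le_measure => //; rewrite inE; apply: measurableI.
  have c1 y : (count (fun x => `[< W (nth (point : sphere) s j) x >]) (fib f y) <= 1)%N.
    by rewrite /W (negbTE jL); have [_ _] := W0P (nth (point : sphere) s j); apply.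
  have /(lee_wpmul2l (x := (ratdeg f)%:R%:E)) := bal A _ _ mA (oW _) c1.
  move=> /(_ (ltW d0)) /le_trans; apply.
  by rewrite muleA -EFinM mulrCA divff ?gt_eqF// mulr1 mul1e.
have sub : ~` N `<=` [set x | nth (point : sphere) s (xi x) \notin L].
  move=> x Nx /=; apply/negP => xL; apply: Nx; have := WE x.
  by rewrite /W xL.
apply: (@le_trans _ _ (mu (~` N))).
  rewrite probability_setC; last exact: open_borel.
  by rewrite EFinB; apply: leeB => //; exact: ltW.
apply: le_measure => //; rewrite inE.
  by apply: measurableC; exact: open_borel.
exact: (mlabel_pred (fun j : 'I_n.+1 => nth (point : sphere) s j \notin L) mxi).
Qed.
End LowerBound.

(** * Sampling the components of an open set *)

Section Samples.
Context (R : realType).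
Local Notation C := (Cplx R).
Local Notation sphere := (sphere R).
Local Notation N := (@rnorm R C).
Implicit Types (V A : set sphere) (E : seq sphere) (l : R[i] * R).

(* For [V] open, this says that [A] is relatively open and closed in [V], so that
   [samples V E] means that [E] meets every component of [V]. *)
Definition loc_const V A := forall x : sphere, V x -> \forall y \near x, A y <-> A x.

Definition samples V E := forall A, loc_const V A -> (exists2 x, V x & A x) ->
  exists e, [/\ e \in E, V e & A e].

(** The intermediate value theorem for the indicator of [P], which is continuous and never takes the
    value [1/2]. *)
Lemma lc_interval (P : R -> Prop) (a b : R) : a <= b ->
  (forall t, a <= t <= b -> \forall s \near t, P s <-> P t) -> (P a <-> P b).
Proof.
move=> ab loc; pose h t : R := if `[< P t >] then 1 else 0.
have hc : {within `[a, b], continuous h}.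
  apply: continuous_in_subspaceT => t; rewrite inE/= in_itv/= => tab.
  apply: cvg_near_cst; apply: filterS (loc t tab) => s st.
  by rewrite /h (asbool_equiv_eq st).
have half : ~ (Num.min (h a) (h b) <= 2^-1 <= Num.max (h a) (h b)).
  move=> /(IVT ab hc)[c _]; rewrite /h; case: ifP => _ h2; lra.
split=> Px; apply: contrapT => nP; apply: half; rewrite /h;
  case: (asboolP (P a)) => //; case: (asboolP (P b)) => // _ _; rewrite ge_min le_max; apply/andP; split; apply/orP.
- by right; lra.
- by left; lra.
- by left; lra.
- by right; lra.
Qed.

Lemma affine_near (u v : C) (t : R) (B : set sphere) :
  nbhs (Some (u + t%:C * v) : sphere) B -> \forall s \near t, B (Some (u + s%:C * v)).
Proof.
move=> /nbhs_Some/nbhs_rnorm[r r0 h].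
have k0 : 0 < N v + 1 by rewrite ltr_wpDl// rnorm_ge0.
near=> s; apply: h.
have -> : u + s%:C * v - (u + t%:C * v) = (s - t)%:C * v.
  by rewrite rmorphB/=; ring.
rewrite rnormM rnormR.
have : `|s - t| < r / (N v + 1).
  rewrite distrC; near: s; apply: (@cvgr_dist_lt _ _ _ (nbhs t)); first exact: cvg_id.
  by rewrite divr_gt0.
rewrite ltr_pdivlMr// mulrDr mulr1; apply: le_lt_trans.
by rewrite lerDl.
Unshelve. all: by end_near.
Qed.

Lemma lc_segment V A (z w : C) : loc_const V A ->
  (forall t : R, 0 <= t <= 1 -> V (Some (z + t%:C * (w - z)))) ->
  A (Some z) <-> A (Some w).
Proof.
move=> lcA zw.
have h := @lc_interval (fun t => A (Some (z + t%:C * (w - z)))) 0 1 ler01.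
move: h; rewrite mul0r addr0 mul1r (addrC z) subrK; apply => t t01.
exact: (affine_near (lcA _ (zw t t01))).
Qed.

(* A pair [l = (w, a)] with [w != 0] stands for the line [Re (w z) = a], which is
   parametrized by [lpt l]. *)
Definition side l (z : C) : R := complex.Re (l.1 * z) - l.2.
Definition lpt l (t : R) : C := l.2%:C / l.1 + t%:C * ('i%C / l.1).
Definition off l (x : sphere) : bool := if x is Some z then side l z != 0 else false.

Lemma ReD (z w : R[i]) : complex.Re (z + w) = complex.Re z + complex.Re w.
Proof. by case: z w => [a b] [c d]. Qed.

Lemma ReMr (t : R) (z : R[i]) : complex.Re (t%:C * z) = t * complex.Re z.
Proof. by case: z => a b /=; rewrite mul0r subr0. Qed.

Lemma side_segment l (z w : C) (t : R) :
  side l (z + t%:C * (w - z)) = (1 - t) * side l z + t * side l w.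
Proof.
rewrite /side.
have -> : l.1 * (z + t%:C * (w - z)) = (1 - t)%:C * (l.1 * z) + t%:C * (l.1 * w).
  by rewrite rmorphB rmorph1/=; ring.
by rewrite ReD !ReMr; ring.
Qed.

Lemma side_lpt l t : l.1 != 0 -> side l (lpt l t) = 0.
Proof.
move=> l0; rewrite /side /lpt mulrDr mulrCA mulfV// mulr1 mulrCA (mulrCA l.1) mulfV//.
by rewrite mulr1 ReD ReMr/= mulr0 addr0 subrr.
Qed.

Lemma lptP l z : l.1 != 0 -> side l z = 0 -> z = lpt l (complex.Im (l.1 * z)).
Proof.
move=> l0 /eqP; rewrite subr_eq0 => /eqP s; rewrite /lpt -s.
rewrite mulrA -mulrDl [_%:C * 'i%C]mulrC -complexE.
by rewrite mulrC mulKf.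
Qed.

Lemma side_lip l (z w : C) : `|side l z - side l w| <= N l.1 * N (z - w).
Proof.
have -> : side l z - side l w = complex.Re (l.1 * (z - w)).
  rewrite /side mulrBr; case: (l.1 * z) (l.1 * w) => [a b] [c d] /=; ring.
by rewrite -rnormM; exact: Re_rnorm.
Qed.

Lemma side_near l (z : C) : side l z != 0 ->
  \forall y \near (Some z : sphere), exists2 w, y = Some w & Num.sg (side l w) = Num.sg (side l z).
Proof.
move=> s0; apply/nbhs_Some/nbhs_rnorm.
have k0 : 0 < N l.1 + 1 by rewrite ltr_wpDl// rnorm_ge0.
exists (`|side l z| / (N l.1 + 1)); first by rewrite divr_gt0// normr_gt0.
move=> w; rewrite ltr_pdivlMr// mulrDr mulr1 => h; exists w => //.
have {}h : `|side l w - side l z| < `|side l z|.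
  apply: le_lt_trans h; apply: (le_trans (side_lip _ _ _)).
  by rewrite mulrC lerDl rnorm_ge0.
case: (ltrgtP (side l z) 0) s0 h => // sz _; rewrite ltr_norml.
  by rewrite (ltr0_norm sz) opprK => h; rewrite !ltr0_sg//; lra.
by rewrite (gtr0_norm sz) => h; rewrite !gtr0_sg//; lra.
Qed.

Lemma off_open l : open [set x | off l x].
Proof.
rewrite openE => -[z|] //= s0; apply: filterS (side_near s0) => y [w ->] h.
by rewrite /= -sgr_eq0 h sgr_eq0.
Qed.

Lemma convex_lt (s x y r : R) : 0 <= s -> s <= 1 -> x < r -> y < r ->
  (1 - s) * x + s * y < r.
Proof.
move=> s0 s1 xr yr; have [xy|yx] := leP x y.
  by apply: le_lt_trans yr; nra.
by apply: le_lt_trans xr; nra.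
Qed.

Definition half_disc l (b : bool) (t r : R) : set C :=
  [set z | N (z - lpt l t) < r /\ 0 < (-1) ^+ b * side l z].

(** A half disc is convex. *)
Lemma lc_hd V A l b t r (z w : C) : loc_const V A ->
  (forall u, half_disc l b t r u -> V (Some u)) -> half_disc l b t r z -> half_disc l b t r w ->
  A (Some z) <-> A (Some w).
Proof.
move=> lcA h [z1 z2] [w1 w2]; apply: (lc_segment lcA) => s /andP[s0 s1]; apply: h; split.
  have -> : z + s%:C * (w - z) - lpt l t = (1 - s)%:C * (z - lpt l t) + s%:C * (w - lpt l t).
    by rewrite rmorphB rmorph1/=; ring.
  apply: (le_lt_trans (rnormD _ _)); rewrite !rnormM !rnormR !ger0_norm ?subr_ge0//.
  exact: convex_lt.
rewrite side_segment mulrDr mulrCA [_ * (s * _)]mulrCA.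
rewrite -oppr_lt0 opprD -!mulrN; apply: convex_lt => //; rewrite mulrN oppr_lt0//.
Qed.

(** The displacement is normal to the line, and the factor is chosen to keep its length below
    [r]. *)
Definition half_disc_pt l (b : bool) (t r : R) : C :=
  lpt l t + ((-1) ^+ b * (r / (2 * (N l.1^-1 + 1))))%:C / l.1.

Lemma hd_ptP l b t r : l.1 != 0 -> 0 < r -> half_disc l b t r (half_disc_pt l b t r).
Proof.
move=> l0 r0; have k0 : 0 < N l.1^-1 + 1 by rewrite ltr_wpDl// rnorm_ge0.
have e0 : 0 < r / (2 * (N l.1^-1 + 1)) by rewrite divr_gt0// mulr_gt0.
split; rewrite /half_disc_pt; set e := r / _ in e0 *.
  rewrite addrAC subrr add0r rnormM rnormR normrM normrX normrN normr1 expr1n mul1r gtr0_norm//.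
  have -> : r = e * (2 * (N l.1^-1 + 1)) by rewrite divfK// gt_eqF// mulr_gt0.
  by rewrite ltr_pM2l//; have := @rnorm_ge0 R C l.1^-1; lra.
have -> : side l (lpt l t + ((-1) ^+ b * e)%:C / l.1) = (-1) ^+ b * e.
  rewrite /side mulrDr ReD addrAC -/(side l (lpt l t)) side_lpt// add0r.
  by rewrite mulrCA mulfV// mulr1.
by rewrite signrMK.
Qed.

Definition between (t t' s : R) := (t <= s <= t') || (t' <= s <= t).

Lemma lc_btw (P : R -> Prop) (t t' : R) :
  (forall s, between t t' s -> \forall s' \near s, P s' <-> P s) -> (P t <-> P t').
Proof.
move=> h; have [tt'|/ltW t't] := leP t t'.
  by apply: lc_interval => // s st; apply: h; rewrite /between st.
by apply: iff_sym; apply: lc_interval => // s st; apply: h; rewrite /between st orbT.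
Qed.

(** The image of a relatively open and closed part [A] of the preimage is open because [f] is open,
    and closed in [V] by [fib_tube]. So some [e] in [E] lies in this image, and the fibre of [e]
    meets [A]. *)
Lemma samples_preimage (f : sphere -> sphere) V E : rational_map f -> open V -> samples V E ->
  samples (f @^-1` V) (flatten [seq fib f e | e <- E]).
Proof.
move=> rf oV sE A lcA [x0 Vx0 Ax0].
have [||e [eE Ve [x fx Ax]]] := sE [set y | exists2 x, f x = y & A x].
- move=> y Vy; have [[x fx Ax]|nB] := pselect (exists2 x, f x = y & A x).
    have : nbhs x A.
      by apply: filterS (lcA x _) => [z [_ h]|]; [exact: h|rewrite /= fx].
    rewrite nbhsE => -[U [oU Ux] UA].
    have : nbhs y (f @` U).
      by apply: open_nbhs_nbhs; split; [exact: rational_open|exists x].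
    apply: filterS => z [u Uu <-]; split=> _; first by exists x.
    by exists u => //; exact: UA.
  have : \forall z \near y, forall x, f x = z -> (~` A)° x.
    apply: fib_tube; [exact: rational_continuous|exact: open_interior|].
    move=> x fx; have nA : ~ A x by move=> Ax; apply: nB; exists x.
    by apply: filterS (lcA x _) => [z [h _] /h //|]; rewrite /= fx.
  apply: filterS => z h; split=> // -[x fx Ax].
  by have /interior_subset := h x fx.
- by exists (f x0); [|exists x0].
- exists x; split => //; last by rewrite /= fx.
  apply/flattenP; exists (fib f e); first exact: map_f.
  by rewrite mem_fib// fx eqxx.
Qed.

Lemma size_preimages (f : sphere -> sphere) E : rational_map f ->
  size (flatten [seq fib f e | e <- E]) = (ratdeg f * size E)%N.
Proof.
move=> rf; elim: E => [|e E IH] /=; first by rewrite muln0.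
by rewrite size_cat IH size_fib// mulnS.
Qed.

Lemma samples_setT : samples setT [:: Some (0 : C)].
Proof.
move=> A lcA [x _ Ax]; exists (Some (0 : C)); split=> //; first by rewrite inE.
have fin (z : C) : A (Some z) -> A (Some (0 : C)).
  by move=> Az; apply/(lc_segment (V := setT) (w := z)).
case: x Ax => [z|Ax]; first exact: fin.
have /nbhs_None[_ [r hr]] : nbhs (None : sphere) A.
  by apply: filterS (lcA None I) => z [_ h']; exact: h'.
apply: (fin ((`|r| + 1)%:C)); apply: hr; rewrite rnormR ger0_norm ?addr_ge0//.
by apply: (le_lt_trans (ler_norm r)); rewrite ltrDl.
Qed.

(* The exterior of a disc contains four half planes, each of which meets the
   next one and whose union is a neighbourhood of infinity. *)
Lemma lc_exterior V A (r : R) : 0 <= r -> loc_const V A -> (forall z : C, r < N z -> V (Some z)) ->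
  forall z w : C, r + r < N z -> r + r < N w -> A (Some z) <-> A (Some w).
Proof.
move=> r0 lcA Vr.
have plane (u : C) (z w : C) : (forall z : C, `|complex.Re (u * z)| <= N z) ->
    r < complex.Re (u * z) -> r < complex.Re (u * w) -> A (Some z) <-> A (Some w).
  move=> hu hz hw; apply: (lc_segment lcA) => t /andP[t0 t1]; apply: Vr.
  apply: lt_le_trans (hu _); apply: lt_le_trans (ler_norm _).
  have := side_segment (u, 0) z w t; rewrite /side/= !subr0 => ->.
  by rewrite -ltrN2 opprD -!mulrN; apply: convex_lt => //; rewrite ltrN2.
pose c : C := (r + 1) +i* (r + 1).
pose c' : C := (- (r + 1)) +i* (- (r + 1)).
have u1 (z : C) : `|complex.Re (1 * z)| <= N z by rewrite mul1r Re_rnorm.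
have u2 (z : C) : `|complex.Re (-1 * z)| <= N z.
  by rewrite mulN1r -rnormN Re_rnorm.
have u3 (z : C) : `|complex.Re (- 'i%C * z)| <= N z.
  have -> : complex.Re (- 'i%C * z) = complex.Im z by case: z => a b /=; ring.
  exact: Im_rnorm.
have u4 (z : C) : `|complex.Re ('i%C * z)| <= N z.
  have -> : complex.Re ('i%C * z) = - complex.Im z by case: z => a b /=; ring.
  by rewrite normrN; exact: Im_rnorm.
have cc' : A (Some c) <-> A (Some c').
  pose e : C := (- (r + 1)) +i* (r + 1).
  apply: (iff_trans (B := A (Some e))).
    by apply: (plane _ _ _ u3); rewrite /=; lra.
  by apply: (plane _ _ _ u2); rewrite /=; lra.
(* Since [|z| <= |a| + |b|], a point outside the disc of radius [2 r] has a coordinate larger than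
   [r] in absolute value, so it lies in one of the four half planes. *)
have toc (z : C) : r + r < N z -> A (Some z) <-> A (Some c).
  case: z => a b hz; have {}hz : r + r < `|a| + `|b| by apply: lt_le_trans hz (rnorm_complex _ _).
  have [ha|ha] := ltP r a; first by apply: (plane _ _ _ u1); rewrite /=; lra.
  have [hb|hb] := ltP r b; first by apply: (plane _ _ _ u3); rewrite /=; lra.
  apply: (iff_trans _ (iff_sym cc')).
  have [ha'|ha'] := ltP a (- r); first by apply: (plane _ _ _ u2); rewrite /=; lra.
  have [hb'|hb'] := ltP b (- r); first by apply: (plane _ _ _ u4); rewrite /=; lra.
  have : `|a| <= r by rewrite ler_norml ha' ha.
  have : `|b| <= r by rewrite ler_norml hb' hb.
  by lra.
by move=> z w /toc hz /toc hw; exact: iff_trans hz (iff_sym hw).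
Qed.

(** Near infinity, [A] contains all finite points or none, so it extends across infinity; the extra
    sample [z1] takes the place of infinity when the latter is the sample found. *)
Lemma remove_infty V E : open V -> samples V E -> exists E', (size E' <= (size E).+1)%N /\
  samples (V `&` [set x | x != None]) E'.
Proof.
move=> oV sE; have [VN|nVN] := pselect (V None); last first.
  exists E; split=> // A lcA [x [Vx _] Ax].
  have NE y : V y -> y != None by move=> Vy; apply: contra_not_neq nVN => <-.
  have [||e [eE Ve Ae]] := sE A; [move=> y Vy; apply: lcA|by exists x|by exists e; split=> //; split=> //; exact: NE].
  by split=> //; exact: NE.
have /nbhs_None[_ [r0 hr0]] : nbhs (None : sphere) V by exact: open_nbhs_nbhs.
pose r := `|r0|; have r_ge0 : 0 <= r by rewrite /r.
have hr (z : C) : r < N z -> V (Some z) by move=> h; apply: hr0; exact: le_lt_trans (ler_norm _) h.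
pose z1 : C := (r + r + 1)%:C.
have z1r : r + r < N z1 by rewrite rnormR ger0_norm ?addr_ge0// ltrDl.
exists (Some z1 :: E); split=> // A lcA [x [Vx xN] Ax].
have ext z w := @lc_exterior _ A _ r_ge0 lcA (fun z h => conj (hr z h) isT) z w.
pose A' (y : sphere) := if y is Some _ then A y else A (Some z1).
have [||e [eE Ve Ae]] := sE A'.
- move=> [z|] Vy.
    have := lcA (Some z) (conj Vy isT); move=> /nbhs_Some h; apply/nbhs_Some.
    by apply: filterS h.
  apply/nbhs_None; split=> //; exists (r + r) => z hz /=; exact: ext.
- by exists x => //; case: x xN Ax {Vx}.
case: e eE Ve Ae => [z|] eE Ve Ae; first by exists (Some z); split=> //; rewrite in_cons eE orbT.
exists (Some z1); split=> //; first exact: mem_head.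
by split=> //; apply: hr; apply: le_lt_trans z1r; rewrite lerDl.
Qed.

Lemma off_lpt l t : l.1 != 0 -> ~ off l (Some (lpt l t)).
Proof. by move=> l0; rewrite /off side_lpt// eqxx. Qed.

Lemma lpt_dist l (t s : R) : N (lpt l s - lpt l t) = `|s - t| * N ('i%C / l.1).
Proof.
by rewrite -rnormR -rnormM; congr (N _); rewrite /lpt rmorphB/=; ring.
Qed.

(** If [A] contains no half disc at any point of the line in [V], then [A] off the line is
    relatively open and closed in [V], and [E] meets it. Otherwise [A] contains a half disc on one
    side, and this propagates along the line inside [V] up to a parameter in [T]; hence two samples
    for each element of [T], one on either side. *)
Lemma remove_line V E l (T : seq R) : open V -> ~ V None -> l.1 != 0 -> samples V E ->
  (forall t, V (Some (lpt l t)) -> exists2 t', t' \in T &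
     forall s, between t t' s -> V (Some (lpt l s))) ->
  exists E', (size E' <= size E + 2 * size T)%N /\ samples (V `&` [set x | off l x]) E'.
Proof.
move=> oV nVN l0 sE sT.
have Vr t : exists r, 0 < r /\ (V (Some (lpt l t)) -> forall z, N (z - lpt l t) < r -> V (Some z)).
  have [Vt|nVt] := pselect (V (Some (lpt l t))); last by exists 1; split.
  have /nbhs_Some/nbhs_rnorm[r r0 h] : nbhs (Some (lpt l t) : sphere) V by exact: open_nbhs_nbhs.
  by exists r; split.
have [rad radP] := choice Vr.
pose sm b t : sphere := Some (half_disc_pt l b t (rad t)).
exists (E ++ map (sm false) T ++ map (sm true) T); split.
  by rewrite !size_cat !size_map mul2n addnn.
move=> A lcA [x0 [Vx0 offx0] Ax0].
have hdV b t r z : V (Some (lpt l t)) -> r <= rad t -> half_disc l b t r z -> (V `&` [set x | off l x]) (Some z).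
  move=> Vt rr [zr zs]; split; first by apply: (radP t).2 => //; exact: lt_le_trans zr rr.
  by rewrite /=; apply: contraTneq zs => ->; rewrite mulr0 ltxx.
pose P b t := exists2 r, 0 < r & forall z, half_disc l b t r z -> A (Some z).
have Pall b t : V (Some (lpt l t)) -> P b t -> forall z, half_disc l b t (rad t) z -> A (Some z).
  move=> Vt [r r0 h] z hz; pose m := Num.min r (rad t).
  have m0 : 0 < m by rewrite lt_min r0 (radP t).1.
  have hm := hd_ptP b t l0 m0.
  have hd_sub r1 r2 u : r1 <= r2 -> half_disc l b t r1 u -> half_disc l b t r2 u.
    by move=> rr [u1 u2]; split=> //; exact: lt_le_trans u1 rr.
  apply/(lc_hd lcA (fun u => hdV b t _ u Vt (lexx _)) hz (w := half_disc_pt l b t m)).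
    by apply: hd_sub hm; rewrite ge_min lexx orbT.
  by apply: h; apply: hd_sub hm; rewrite ge_min lexx.
have [[b [t Vt Pbt]]|nP] := pselect (exists b, exists2 t, V (Some (lpt l t)) & P b t).
  have [t' t'T Vtt'] := sT t Vt.
  have Vt' : V (Some (lpt l t')) by apply: Vtt'; rewrite /between !lexx !andbT le_total.
  have Pt' : P b t'.
    (* [P b] is locally constant because half discs with nearby centres overlap. *)
    apply/(lc_btw (P := P b) (t := t)); last by [].
    move=> s /Vtt' Vs; have k0 : 0 < N ('i%C / l.1) + 1 by rewrite ltr_wpDl// rnorm_ge0.
    near=> s'.
    have Vs' : V (Some (lpt l s')) by near: s'; exact: affine_near (open_nbhs_nbhs (conj oV Vs)).
    have ss' : `|s' - s| * N ('i%C / l.1) < rad s.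
      have : `|s' - s| < rad s / (N ('i%C / l.1) + 1).
        rewrite distrC; near: s'; apply: (@cvgr_dist_lt _ _ _ (nbhs s)); first exact: cvg_id.
        by rewrite divr_gt0// (radP s).1.
      rewrite ltr_pdivlMr// mulrDr mulr1; apply: le_lt_trans.
      by rewrite lerDl.
    pose r' := rad s - `|s' - s| * N ('i%C / l.1).
    have r'0 : 0 < r' by rewrite subr_gt0.
    have sub z : half_disc l b s' r' z -> half_disc l b s (rad s) z.
      move=> [z1 z2]; split=> //.
      have -> : z - lpt l s = (z - lpt l s') + (lpt l s' - lpt l s) by ring.
      apply: (le_lt_trans (rnormD _ _)); rewrite lpt_dist.
      by rewrite -ltrBrDr.
    split=> [P1|/(Pall _ _ Vs) P1]; last by exists r' => // z /sub/P1.
    exists (rad s); first exact: (radP s).1.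
    pose m := Num.min r' (rad s').
    have m0 : 0 < m by rewrite lt_min r'0 (radP s').1.
    have [h1 h2] := hd_ptP b s' l0 m0.
    have h3 : half_disc l b s (rad s) (half_disc_pt l b s' m).
      by apply: sub; split=> //; apply: lt_le_trans h1 _; rewrite ge_min lexx.
    have Ah : A (Some (half_disc_pt l b s' m)).
      apply: (Pall _ _ Vs' P1); split=> //; apply: lt_le_trans h1 _.
      by rewrite ge_min lexx orbT.
    move=> z hz.
    by apply/(lc_hd lcA (fun u => hdV b s _ u Vs (lexx _)) hz h3).
  exists (sm b t'); split.
  - by rewrite !mem_cat; case: (b); rewrite (map_f (sm _))// ?orbT.
  - exact: hdV (Vt') (lexx _) (hd_ptP b t' l0 (radP t').1).
  - exact: Pall Vt' Pt' _ (hd_ptP b t' l0 (radP t').1).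
have [||e [eE Ve [Ae offe]]] := sE [set x | A x /\ off l x].
- move=> [z|//] Vz; have [s0|s0] := eqVneq (side l z) 0; last first.
    have nz := @off_open l; have := lcA (Some z) (conj Vz s0).
    have : nbhs (Some z : sphere) [set x | off l x] by apply: open_nbhs_nbhs.
    by apply: filterS2 => y oy [h1 h2]; split=> -[a b]; split => //; [exact: h1|exact: h2].
  have zE := lptP l0 s0; set t := complex.Im _ in zE.
  rewrite zE in Vz *; near=> y.
  have nz : ~ off l (Some (lpt l t)) by exact: off_lpt.
  suff ny : ~ (A y /\ off l y) by split=> [/ny//|[_ /nz]].
  near: y; apply/nbhs_Some/nbhs_rnorm; exists (rad t); first exact: (radP t).1.
  move=> w hw [Aw]; rewrite /off => sw; apply: nP.
  pose b := side l w < 0.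
  have hdw : half_disc l b t (rad t) w.
    split=> //; rewrite /b; case: (ltrgtP (side l w) 0) sw => // h _; rewrite ?expr1 ?expr0; lra.
  exists b, t => //; exists (rad t); first exact: (radP t).1.
  by move=> z' hz'; apply/(lc_hd lcA (fun u => hdV b t _ u Vz (lexx _)) hz' hdw).
- by exists x0.
by exists e; split=> //; rewrite mem_cat eE.
Unshelve. all: by end_near.
Qed.
End Samples.

(** * Traces of grid conditions on a line as polynomial conditions *)

Section LinePolynomials.
Context (R : realType).
Local Notation C := (Cplx R).
Local Notation sphere := (sphere R).
Local Notation N := (@rnorm R C).
Implicit Types (l m : R[i] * R) (p q G : {poly R[i]}) (g : sphere -> sphere).

Definition linepoly l : {poly R[i]} := (l.2%:C / l.1)%:P + ('i%C / l.1) *: 'X.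

Lemma horner_linepoly l (t : R) : (linepoly l).[t%:C] = lpt l t.
Proof. by rewrite /linepoly hornerD hornerC hornerZ hornerX /lpt [_ * t%:C]mulrC. Qed.

Lemma size_linepoly l : l.1 != 0 -> size (linepoly l) = 2%N.
Proof.
move=> l0; have i0 : 'i%C / l.1 != 0 :> R[i].
  by rewrite mulf_neq0 ?invr_eq0// -normr_eq0 normc_def/= expr0n/= add0r expr1n sqrtr1 oner_eq0.
by rewrite /linepoly addrC size_polyDl size_scale// size_polyX// ltnS size_polyC_leq1.
Qed.

Lemma size_on_line D p l : (size p <= D.+1)%N -> l.1 != 0 -> (size (p \Po linepoly l) <= D.+1)%N.
Proof.
move=> sp l0; apply: (leq_trans (size_comp_poly_leq _ _)).
by rewrite size_linepoly// muln1 ltnS; case: (size p) sp.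
Qed.

Lemma horner_conj p (t : R) : (map_poly conjc p).[t%:C] = conjc p.[t%:C].
Proof. by rewrite -{1}(conjc_real t) horner_map. Qed.

Lemma hrep_Some D p q g (z : C) : hrep D p q g -> g (Some z) = pt p.[z] q.[z].
Proof.
move=> [_ sp sq _ h]; rewrite -ptz1 h ?oner_eq0 ?orbT//.
by rewrite !hom_v1.
Qed.

Lemma sizeM_le D p q : (size p <= D.+1)%N -> (size q <= D.+1)%N -> (size (p * q)%R <= (2 * D).+1)%N.
Proof.
move=> sp sq; apply: (leq_trans (size_polyMleq _ _)); rewrite mul2n -addnn -subn1 leq_subLR.
by apply: leq_trans (leq_add sp sq) _; lia.
Qed.

(* On the real parameter [t] of the line, [G] is twice the real part of
   [m.1 p conj(q)] minus [m.2 |q|^2], so it vanishes at the poles as well. *)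
Lemma off_poly D p q g l m : hrep D p q g -> l.1 != 0 ->
  exists G, (size G <= (2 * D).+1)%N /\
    forall t : R, off m (g (Some (lpt l t))) = (G.[t%:C] != 0).
Proof.
move=> hg l0; have [_ sp sq _ _] := hg.
pose P := p \Po linepoly l; pose Q := q \Po linepoly l.
pose P' := map_poly conjc P; pose Q' := map_poly conjc Q.
have sP : (size P <= D.+1)%N by exact: size_on_line.
have sQ : (size Q <= D.+1)%N by exact: size_on_line.
have sP' : (size P' <= D.+1)%N by apply: leq_trans (size_poly _ _) sP.
have sQ' : (size Q' <= D.+1)%N by apply: leq_trans (size_poly _ _) sQ.
exists (m.1 *: (P * Q') + (m.1^*)%C *: (P' * Q) - (2 * m.2)%:C *: (Q * Q')); split.
  have sZ (c : R[i]) (F : {poly R[i]}) : (size F <= (2 * D).+1)%N -> (size (c *: F) <= (2 * D).+1)%N.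
    exact: leq_trans (size_scale_leq _ _).
  apply: (leq_trans (size_polyD _ _)); rewrite geq_max size_polyN !sZ ?sizeM_le// andbT.
  by apply: (leq_trans (size_polyD _ _)); rewrite geq_max !sZ ?sizeM_le.
move=> t; rewrite (hrep_Some _ hg) hornerD hornerN hornerD !hornerZ !hornerM !horner_conj !horner_comp horner_linepoly.
set u := p.[_]; set v := q.[_]; rewrite /pt; have [->|v0] := eqVneq v 0.
  by rewrite rmorph0 !mulr0 addr0 subrr eqxx.
rewrite /off /side; congr negb.
have n0 : v * v^*%C != 0 by rewrite mulf_neq0// conjc_eq0.
rewrite -(inj_eq (@complexI R)) rmorphB rmorph0/=.
have E (w : R[i]) : (complex.Re w)%:C = (w + w^*%C) / 2.
  by case: w => a b; apply/eqP; rewrite eq_complex/=; apply/andP; split; apply/eqP; field.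
set X := (complex.Re _)%:C - _.
suff -> : m.1 * (u * v^*%C) + m.1^*%C * (u^*%C * v) - (2 * m.2)%:C * (v * v^*%C) = 2 * (v * v^*%C) * X.
  by rewrite !mulf_eq0 pnatr_eq0/= -mulf_eq0 (negbTE n0).
rewrite /X E !rmorphM/= fmorphV/=.
have -> : 2%:C = 2 :> R[i] by rewrite rmorph_nat.
by field; rewrite v0 conjc_eq0 v0.
Qed.

Lemma pole_poly D p q g l : hrep D p q g -> l.1 != 0 ->
  exists G, [/\ G != 0, (size G <= D.+1)%N &
    forall t : R, (g (Some (lpt l t)) != None) = (G.[t%:C] != 0)].
Proof.
move=> hg l0; have [_ sp sq _ _] := hg; exists (q \Po linepoly l); split.
- rewrite comp_poly_eq0 ?size_linepoly//.
  exact: hrep_plin_neq0 None hg.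
- exact: size_on_line.
move=> t; rewrite (hrep_Some _ hg) horner_comp horner_linepoly /pt.
by case: (_ == 0).
Qed.

(** The real parts of all complex roots are listed: some may be no zeros, but the degree bounds
    their number. *)
Lemma real_zeros G : G != 0 -> exists Z : seq R, (size Z <= (size G).-1)%N /\
  forall t, G.[t%:C] = 0 -> t \in Z.
Proof.
move=> G0; have [rs EG] := closed_field_poly_normal G.
exists (map (@complex.Re R) rs); split.
  by rewrite size_map EG size_scale ?lead_coef_eq0// size_prod_XsubC.
move=> t /eqP; rewrite EG hornerZ mulf_eq0 lead_coef_eq0 (negbTE G0)/= -rootE root_prod_XsubC => h.
by apply/mapP; exists t%:C.
Qed.

Lemma isolated (Z : seq R) (z : R) : exists2 e : R, 0 < e &
  forall s, z - e <= s <= z + e -> s \in Z -> s = z.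
Proof.
elim: Z => [|y Z [e e0 h]]; first by exists 1.
have [->|yz] := eqVneq y z.
  by exists e => // s sz; rewrite in_cons => /orP[/eqP//|]; exact: h.
have d0 : 0 < `|y - z| / 2 by rewrite divr_gt0// normr_gt0 subr_eq0.
exists (Num.min e (`|y - z| / 2)); first by rewrite lt_min e0.
move=> s /andP[s1 s2]; rewrite in_cons => /orP[/eqP sy|].
  have : `|y - z| <= `|y - z| / 2.
    rewrite -{1}sy ler_norml; have : Num.min e (`|y - z| / 2) <= `|y - z| / 2 by rewrite ge_min lexx orbT.
    by move=> h'; apply/andP; split; lra.
  lra.
have : Num.min e (`|y - z| / 2) <= e by rewrite ge_min lexx.
by move=> h'; apply: h; apply/andP; split; lra.
Qed.

(** A new point [z] adds the samples [z - e] and [z + e], with [e] isolating [z] from the other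
    points: a segment to an old sample that now crosses [z] is replaced by one ending at the new
    sample on the side of [t]. *)
Lemma gap_samples (Z : seq R) : exists T : seq R, (size T <= (2 * size Z).+1)%N /\
  forall t, t \notin Z -> exists2 t', t' \in T & forall s, between t t' s -> s \notin Z.
Proof.
elim: Z => [|z Z [T [sT hT]]].
  by exists [:: 0]; split=> // t _; exists 0 => //; exact: mem_head.
have [e e0 he] := isolated Z z; exists (z - e :: z + e :: T); split.
  by rewrite /= mulnS !addSn add0n !ltnS.
move=> t; rewrite in_cons negb_or => /andP[tz tZ]; have [t' t'T ht'] := hT t tZ.
have [bz|nbz] := boolP (between t t' z); last first.
  exists t'; first by rewrite !in_cons t'T !orbT.
  move=> s bs; rewrite in_cons negb_or ht'// andbT.
  by apply: contraNneq nbz => <-.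
have near_z s : z - e <= s <= z + e -> s != z -> s \notin z :: Z.
  by move=> sz nz; rewrite in_cons negb_or nz/=; apply/negP => /(he s sz)/eqP; rewrite (negbTE nz).
have [tlt|tgt] := ltP t z.
  have zt' : z <= t' by move: bz; rewrite /between => /orP[/andP[]//|/andP[_]]; rewrite leNgt tlt.
  exists (z - e); first exact: mem_head.
  move=> s bs; have [s1|s1] := leP (z - e) s.
    apply: near_z; first by apply/andP; split=> //; move: bs; rewrite /between => /orP[/andP[]|/andP[]]; lra.
    by rewrite lt_eqF//; move: bs; rewrite /between => /orP[/andP[]|/andP[]]; lra.
  rewrite in_cons negb_or (ht' s) ?andbT; first by rewrite lt_eqF//; lra.
  by move: bs; rewrite /between => /orP[/andP[a b]|/andP[a b]]; apply/orP; [left|lra]; apply/andP; split; lra.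
have {}tgt : z < t by rewrite lt_neqAle eq_sym tz.
have zt' : t' <= z by move: bz; rewrite /between => /orP[/andP[]|/andP[]//]; rewrite leNgt tgt.
exists (z + e); first by rewrite !in_cons eqxx orbT.
move=> s bs; have [s1|s1] := leP s (z + e).
  apply: near_z; first by apply/andP; split=> //; move: bs; rewrite /between => /orP[/andP[]|/andP[]]; lra.
  by rewrite gt_eqF//; move: bs; rewrite /between => /orP[/andP[]|/andP[]]; lra.
rewrite in_cons negb_or (ht' s) ?andbT; first by rewrite gt_eqF//; lra.
by move: bs; rewrite /between => /orP[/andP[a b]|/andP[a b]]; apply/orP; [lra|right]; apply/andP; split; lra.
Qed.

(* The zero polynomial is allowed: it covers the lines that miss [V]. *)
Definition alg_trace l (V : set sphere) (B : nat) := exists G, (size G <= B.+1)%N /\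
  forall t : R, V (Some (lpt l t)) <-> G.[t%:C] != 0.

Lemma algT l : alg_trace l setT 0.
Proof. by exists 1; rewrite size_poly1; split=> // t; rewrite hornerE oner_neq0. Qed.

Lemma algI l V W B B' : alg_trace l V B -> alg_trace l W B' -> alg_trace l (V `&` W) (B + B').
Proof.
move=> [G [sG hG]] [H [sH hH]]; exists (G * H); split.
  apply: (leq_trans (size_polyMleq _ _)); rewrite -subn1 leq_subLR.
  by apply: leq_trans (leq_add sG sH) _; lia.
move=> t; rewrite hornerM mulf_eq0 negb_or; split=> [[/hG -> /hH ->]//|/andP[/hG ? /hH ?]//].
Qed.

Lemma alg_le l V B B' : (B <= B')%N -> alg_trace l V B -> alg_trace l V B'.
Proof. by move=> BB' [G [sG hG]]; exists G; split=> //; exact: leq_trans sG _. Qed.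

Lemma alg_off D p q g l m : hrep D p q g -> l.1 != 0 ->
  alg_trace l [set x | off m (g x)] (2 * D).
Proof. by move=> hg l0; have [G [sG hG]] := off_poly m hg l0; exists G; split=> // t; rewrite -hG. Qed.

Lemma alg_gaps l V B : alg_trace l V B -> exists T : seq R, (size T <= (2 * B).+1)%N /\
  forall t, V (Some (lpt l t)) -> exists2 t', t' \in T & forall s, between t t' s -> V (Some (lpt l s)).
Proof.
move=> [G [sG hG]]; have [G0|G0] := eqVneq G 0.
  by exists [::]; split=> // t /hG; rewrite G0 horner0 eqxx.
(* Spurious elements are filtered out, so that [Z'] describes the trace exactly. *)
have [Z [sZ hZ]] := real_zeros G0; pose Z' := [seq t <- Z | G.[t%:C] == 0].
have [T [sT hT]] := gap_samples Z'; exists T; split.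
  apply: (leq_trans sT); rewrite ltnS leq_pmul2l// (leq_trans _ (leq_trans sZ _))//.
    by rewrite size_filter count_size.
  by case: (size G) sG.
have VZ t : V (Some (lpt l t)) <-> t \notin Z'.
  rewrite hG mem_filter negb_and; split=> [->//|/orP[//|]].
  by apply: contra => /eqP/hZ.
by move=> t /VZ/hT[t' t'T h]; exists t' => // s /h/VZ.
Qed.
End LinePolynomials.

(** [ln (t (n + 1)) <= t (n + 1) - 1] absorbs the polynomial factor at a rate [2 t] per step, with
    [t] as small as desired. *)
Lemma ln_growth_le (R : realType) (a D t : R) n : 0 < a -> 0 < D -> 0 < t ->
  ln (n.+1%:R ^+ 2 * a * D ^+ n) <= ln a + 2 * (t - 1 - ln t) + n%:R * (ln D + 2 * t).
Proof.
move=> a0 D0 t0; have n0 : 0 < n%:R + 1 :> R by rewrite ltr_wpDl.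
have h : ln (t * (n%:R + 1)) <= t * (n%:R + 1) - 1 by apply: ln_le_sub1; rewrite mulr_gt0.
have -> : n.+1%:R = n%:R + 1 :> R by rewrite natr1.
rewrite lnM ?posrE ?mulr_gt0 ?exprn_gt0// lnM ?posrE ?exprn_gt0// !lnXn//.
move: h; rewrite lnM ?posrE// -(mulr_natl (ln (n%:R + 1)) 2) -(mulr_natl (ln D) n).
lra.
Qed.

(** * Counting itineraries through a grid of lines *)

Section Counting.
Context (R : realType).
Local Notation C := (Cplx R).
Local Notation sphere := (sphere R).
Variables (f : sphere -> sphere) (ls : seq (R[i] * R)).
Hypothesis rf : rational_map f.
Hypothesis d2 : (1 < ratdeg f)%N.
Hypothesis ls0 : forall l, l \in ls -> l.1 != 0.
Local Notation d := (ratdeg f).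

Definition sgside (l : R[i] * R) (x : sphere) : R := if x is Some z then Num.sg (side l z) else 0.

(** [sgside] is [0] both on a line and at infinity, so infinity is told apart by the first clause.
    Pieces of lines count as cells too: no point of the sphere is left out. *)
Definition same (x y : sphere) := ((x == None) = (y == None)) /\
  forall l, l \in ls -> sgside l x = sgside l y.

Lemma same_sym x y : same x y -> same y x.
Proof. by move=> [a b]; split=> // l /b. Qed.

Lemma same_trans x y z : same x y -> same y z -> same x z.
Proof. by move=> [a b] [a' b']; split=> [|l ll]; rewrite ?a ?b ?b'. Qed.

Definition good (x : sphere) := (x != None) && all (fun l => off l x) ls.

Lemma near_finite (z : C) : \forall y \near (Some z : sphere), y != None.
Proof. by apply/nbhs_Some; exact: filterS filterT. Qed.

Lemma good_open : open [set x | good x].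
Proof.
rewrite openE => -[z|] //= /allP h; rewrite /interior.
have n1 : \forall y \near (Some z : sphere), forall l, l \in ls -> off l y.
  apply: (near_seq (P := fun l => [set y : sphere | off l y])) => l ll.
  by apply: open_nbhs_nbhs; split; [exact: off_open|exact: h].
by apply: filterS2 n1 (near_finite z) => y y1 y2; rewrite /= /good y2; apply/allP.
Qed.

Lemma good_same_near x : good x -> \forall y \near x, same y x.
Proof.
case: x => [z|] //= /allP h.
have n1 : \forall y \near (Some z : sphere), forall l, l \in ls -> sgside l y = sgside l (Some z).
  apply: (near_seq (P := fun l => [set y | sgside l y = sgside l (Some z)])) => l ll.
  by apply: filterS (side_near (h l ll)) => y [w ->].
by apply: filterS2 n1 (near_finite z) => y y1 y2; split; rewrite // (negbTE y2).
Qed.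

Lemma homX u v : hom 1 'X u v = u :> R[i].
Proof.
by rewrite /hom big_ord_recl big_ord1 !coefX !lift0 /= mul0r add0r mul1r expr0 mulr1 expr1.
Qed.

Lemma hom1 u v : hom 1 1 u v = v :> R[i].
Proof.
by rewrite /hom big_ord_recl big_ord1 !coef1 !lift0 /= mul0r addr0 mul1r expr0 mul1r expr1.
Qed.

Lemma iter_hrep k : exists p q, hrep (d ^ k) p q (iter k f).
Proof.
elim: k => [|k [p [q hk]]].
  exists 'X, 1; rewrite expn0; split=> //.
  - by rewrite size_polyX.
  - by rewrite size_poly1.
  - by move=> u v; rewrite homX hom1.
  by move=> u v _; rewrite homX hom1.
have := hrep_comp (numdenP rf) hk; rewrite -expnS => h.
by eexists; eexists; exact: h.
Qed.

Lemma iter_continuous k : continuous (iter k f).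
Proof.
have [p [q /hrep_rational[h _]]] := iter_hrep k; exact: rational_continuous.
Qed.

Definition avoiding k : set sphere := [set x | forall i, (i < k)%N -> good (iter i f x)].

Lemma Vk_open k : open (avoiding k).
Proof.
rewrite openE => x Vx; rewrite /interior.
have : \forall y \near x, forall i, i \in iota 0 k -> good (iter i f y).
  apply: (near_seq (P := fun i => [set y | good (iter i f y)])) => i.
  rewrite mem_iota add0n => /= ik; apply: open_nbhs_nbhs; split; last exact: Vx.
  by apply: open_comp good_open => y _; exact: iter_continuous.
by apply: filterS => y h i ik; apply: h; rewrite mem_iota.
Qed.

Lemma VkS k : avoiding k.+1 = (f @^-1` avoiding k) `&` [set x | good x].
Proof.
apply/seteqP; split=> [x h|x [h1 h2] [|i] ik].
- by split=> [i ik|]; [have := h i.+1 ik; rewrite iterSr|exact: (h 0%N)].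
- exact: h2.
- by rewrite iterSr; exact: h1.
Qed.

(** In units of [d^k], the degree on a line of the condition [good] at time [k]: [2] for each line
    of the grid and [1] for the poles. *)
Let M := (2 * size ls).+1.

Lemma alg_good l k : l.1 != 0 -> alg_trace l [set x | good (iter k f x)] (M * d ^ k).
Proof.
move=> l0; have [p [q hk]] := iter_hrep k.
have -> : [set x | good (iter k f x)] =
    [set x | iter k f x != None] `&` [set x | all (fun m => off m (iter k f x)) ls].
  by apply/seteqP; split=> x /=; rewrite /good => /andP.
rewrite mulSn; apply: algI.
  have [G [_ sG hG]] := pole_poly hk l0; exists G; split=> // t; rewrite -hG//.
elim: ls => [|m s IH] /=.
  by have -> : [set _ : sphere | true] = setT; [apply/seteqP; split|apply: alg_le (algT l)].
have -> : [set x | off m (iter k f x) && all (fun m => off m (iter k f x)) s] =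
   [set x | off m (iter k f x)] `&` [set x | all (fun m => off m (iter k f x)) s].
  by apply/seteqP; split=> x /= /andP.
by rewrite mulnS mulnDl; apply: algI => //; exact: (alg_off m hk).
Qed.

(** The conditions at times [1] to [k] contribute [M d + ... + M d^k], at most [2 M d^k] because
    [d >= 2]. *)
Lemma alg_Vk l k : l.1 != 0 -> alg_trace l (f @^-1` avoiding k) (M * (2 * d ^ k)).
Proof.
move=> l0; elim: k => [|k IH].
  have -> : f @^-1` avoiding 0 = setT by apply/seteqP; split.
  by apply: alg_le (algT l).
have -> : f @^-1` avoiding k.+1 = (f @^-1` avoiding k) `&` [set x | good (iter k.+1 f x)].
  apply/seteqP; split=> [x h|x [h1 h2] i].
    by split=> [i ik|]; [apply: h; exact: ltnW|rewrite /= -iterS iterSr; exact: h].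
  rewrite ltnS leq_eqVlt => /orP[/eqP ->|]; last exact: h1.
  by rewrite -iterSr.
apply: alg_le (algI IH (alg_good k.+1 l0)).
rewrite -mulnDr leq_mul2l expnS orbC; apply/orP; left.
rewrite [X in (_ <= X)%N]mulSn mul1n leq_add2r leq_mul2r.
by rewrite d2 orbT.
Qed.

(** Each line costs [2 |T|] samples with [|T| <= 2 B + 1], and its removal raises by [2] the degree
    of the trace on the lines still to come; hence the common bound [B + 2 * size s]. *)
Lemma remove_lines (s : seq (R[i] * R)) (V : set sphere) (E : seq sphere) B : open V -> ~ V None ->
  (forall l, l \in s -> l.1 != 0) -> (forall l, l \in s -> alg_trace l V B) -> samples V E ->
  exists E', (size E' <= size E + size s * (2 + 4 * (B + 2 * size s)))%N /\
    samples (V `&` [set x | all (fun l => off l x) s]) E'.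
Proof.
elim: s V E B => [|l s IH] V E B oV nVN s0 sB sE.
  exists E; rewrite mul0n addn0; split=> //.
  by have -> : V `&` [set x | all (fun l => off l x) [::]] = V by apply/seteqP; split=> x // [].
have l0 : l.1 != 0 by apply: s0; exact: mem_head.
have [T [sT hT]] := alg_gaps (sB l (mem_head _ _)).
have [E1 [sE1 hE1]] := remove_line oV nVN l0 sE hT.
have [||||E' [sE' hE']] := IH (V `&` [set x | off l x]) E1 (B + 2)%N _ _ _ _ hE1.
- by apply: openI => //; exact: off_open.
- by case.
- by move=> m ms; apply: s0; rewrite in_cons ms orbT.
- move=> m ms; have mls : m \in l :: s by rewrite in_cons ms orbT.
  apply: algI (sB m mls) _; have [p [q h]] := iter_hrep 0.
  by have := alg_off l h (s0 m mls); rewrite expn0.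
exists E'; split; last first.
  have <- // : V `&` [set x | off l x] `&` [set x | all (fun m => off m x) s] =
      V `&` [set x | all (fun m => off m x) (l :: s)].
  by apply/seteqP; split=> x /=; [move=> [[a b] c]; split=> //; rewrite b|move=> [a /andP[b c]]].
apply: (leq_trans sE'); apply: (leq_trans (leq_add sE1 (leqnn _))) => /=.
by move: (size T) (size E) (size s) sT => t e n; nia.
Qed.

(** In units of [d^k], the samples added in one step: one for infinity, and those of [remove_lines]
    with [B = 2 M d^k]. *)
Let K := (1 + size ls * (2 + 8 * M + 8 * size ls))%N.

(** Taking preimages multiplies the number of samples by [d], and removing infinity and the lines
    adds at most [K d^k]. Each step thus contributes the same share, which yields a factor linear in
    [k] only. *)
Lemma Vk_samples k : exists E, (size E <= (1 + k * K) * d ^ k)%N /\ samples (avoiding k) E.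
Proof.
elim: k => [|k [E [sE hE]]].
  exists [:: Some (0 : C)]; split=> //.
  have -> : avoiding 0 = setT by apply/seteqP; split.
  exact: samples_setT.
have oP : open (f @^-1` avoiding k) by apply: open_comp; [move=> y _; exact: rational_continuous|exact: Vk_open].
have [E1 [sE1 hE1]] := remove_infty oP (samples_preimage rf (@Vk_open k) hE).
have [||||E2 [sE2 hE2]] := remove_lines (s := ls) (B := M * (2 * d ^ k)) _ _ _ _ hE1.
- apply: openI => //; rewrite openE => -[z|] //= _.
  by apply/nbhs_Some; exact: filterS filterT.
- by case.
- exact: ls0.
- move=> l /ls0 l0; have [G [sG hG]] := alg_Vk k l0; exists G; split=> // t.
  by rewrite -hG; split=> [[]|].
exists E2; split; last first.
  rewrite VkS; have <- // : f @^-1` avoiding k `&` [set x | x != None] `&` [set x | all (fun m => off m x) ls] =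
      f @^-1` avoiding k `&` [set x | good x].
  apply/seteqP; split=> x /=; rewrite /good.
    by move=> [[a b] c]; split=> //; apply/andP.
  by move=> [a /andP[b c]].
apply: (leq_trans sE2); apply: (leq_trans (leq_add sE1 (leqnn _))).
rewrite size_preimages// expnS.
have dk : (0 < d ^ k)%N by rewrite expn_gt0 ltnW.
move: dk d2 sE; rewrite /K; move: (size ls) (d ^ k)%N (size E) => s D e D0 dd sE.
have h1 : (d * e <= (1 + k * (1 + s * (2 + 8 * M + 8 * s))) * (d * D))%N.
  by rewrite mulnCA leq_mul2l sE orbT.
have h2 : (1 + s * (2 + 4 * (M * (2 * D) + 2 * s)) <= (1 + s * (2 + 8 * M + 8 * s)) * D)%N by nia.
have h3 : ((1 + s * (2 + 8 * M + 8 * s)) * D <= (1 + s * (2 + 8 * M + 8 * s)) * (d * D))%N.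
  by rewrite leq_mul2l leq_pmull ?orbT// ltnW.
move: h1 h2 h3; set Q := (1 + s * (2 + 8 * M + 8 * s))%N; lia.
Qed.

(** Following a given itinerary up to time [k] is a relatively open and closed condition on
    [avoiding k], so the samples realize all of these itineraries. *)
Lemma Vk_words k : exists E : seq sphere, (size E <= (1 + k * K) * d ^ k)%N /\
  forall x, avoiding k x -> exists2 e, e \in E & forall i, (i < k)%N -> same (iter i f e) (iter i f x).
Proof.
have [E [sE hE]] := Vk_samples k; exists E; split=> // x Vx.
have [||e [eE Ve Ae]] := hE [set y | forall i, (i < k)%N -> same (iter i f y) (iter i f x)].
- move=> y Vy.
  have : \forall z \near y, forall i, i \in iota 0 k -> same (iter i f z) (iter i f y).
    apply: (near_seq (P := fun i => [set z | same (iter i f z) (iter i f y)])) => i.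
    rewrite mem_iota add0n => /= ik; exact: (iter_continuous (good_same_near (Vy i ik))).
  apply: filterS => z h; have {}h i : (i < k)%N -> same (iter i f z) (iter i f y).
    by move=> ik; apply: h; rewrite mem_iota.
  split=> A i ik; first exact: same_trans (same_sym (h i ik)) (A i ik).
  exact: same_trans (h i ik) (A i ik).
- by exists x.
by exists e.
Qed.

(** Cells change only at the poles, at most [d^k] of them, or at the zeros of the polynomials of
    [off_poly], at most [2 d^k] for each line. *)
Lemma line_zeros k l : l.1 != 0 -> exists Z : seq R, (size Z <= M * d ^ k)%N /\
  forall t, t \notin Z -> \forall s \near t, same (iter k f (Some (lpt l s))) (iter k f (Some (lpt l t))).
Proof.
move=> l0; have [p [q hk]] := iter_hrep k.
have [Q [Q0 sQ hQ]] := pole_poly hk l0; have [Z0 [sZ0 hZ0]] := real_zeros Q0.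
pose near_line (m : R[i] * R) (t : R) := iter k f (Some (lpt l t)) <> None ->
  \forall s \near t, iter k f (Some (lpt l s)) <> None ->
   sgside m (iter k f (Some (lpt l s))) = sgside m (iter k f (Some (lpt l t))).
have oneline m : exists Z : seq R, (size Z <= 2 * d ^ k)%N /\ forall t, t \notin Z -> near_line m t.
  (* [G = 0] means that the whole line is sent into [m] or infinity; then [sgside] is [0] along it
     and nothing changes. *)
  have [G [sG hG]] := off_poly m hk l0; have [G0|G0] := eqVneq G 0.
    exists [::]; split=> // t _ _; apply: filterS filterT => s _ _.
    have z0 s' : sgside m (iter k f (Some (lpt l s'))) = 0.
      have := hG s'; rewrite G0 horner0 eqxx; case: (iter k f _) => //= z /negbFE/eqP->.
      exact: sgr0.
    by rewrite !z0.
  have [Z [sZ hZ]] := real_zeros G0; exists Z; split.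
    by apply: leq_trans sZ _; case: (size G) sG.
  move=> t tZ _; have : off m (iter k f (Some (lpt l t))).
    by rewrite hG; apply: contraNneq tZ => /hZ.
  case E : (iter k f _) => [z|] // /side_near; rewrite -E => h.
  have := affine_near (iter_continuous h); apply: filterS => s [w ew hw] _.
  by rewrite ew E.
have [Z [sZ hZ]] : exists Z : seq R, (size Z <= size ls * (2 * d ^ k))%N /\
    forall t, t \notin Z -> forall m, m \in ls -> near_line m t.
  elim: (ls) => [|m s [Z [sZ hZ]]]; first by exists [::].
  have [Z' [sZ' hZ']] := oneline m; exists (Z' ++ Z); split.
    by rewrite size_cat mulSn leq_add.
  move=> t; rewrite mem_cat negb_or => /andP[t1 t2] m'; rewrite in_cons => /orP[/eqP->|]; last exact: hZ.
  exact: hZ'.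
exists (Z0 ++ Z); split.
  rewrite size_cat mulSn; apply: leq_add; first by apply: leq_trans sZ0 _; case: (size Q) sQ.
  by rewrite mulnA [(size ls * 2)%N]mulnC in sZ.
move=> t; rewrite mem_cat negb_or => /andP[t0 tZ].
have fin : iter k f (Some (lpt l t)) != None by rewrite hQ; apply: contraNneq t0 => /hZ0.
have oN : open [set x : sphere | x != None].
  by rewrite openE => -[z|] //= _; apply/nbhs_Some; exact: filterS filterT.
have n1 : \forall s \near t, iter k f (Some (lpt l s)) != None.
  have : nbhs (iter k f (Some (lpt l t))) [set x : sphere | x != None] by exact: open_nbhs_nbhs.
  by move=> /iter_continuous/affine_near.
have n2 : \forall s \near t, forall m, m \in ls -> iter k f (Some (lpt l s)) <> None ->
   sgside m (iter k f (Some (lpt l s))) = sgside m (iter k f (Some (lpt l t))).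
  apply: (near_seq (P := fun m => [set s | iter k f (Some (lpt l s)) <> None ->
   sgside m (iter k f (Some (lpt l s))) = sgside m (iter k f (Some (lpt l t)))])) => m mls.
  by apply: hZ => //; exact/eqP.
apply: filterS2 n1 n2 => s s1 s2; split; first by rewrite (negbTE s1) (negbTE fin).
by move=> m mls; apply: s2 => //; exact/eqP.
Qed.

(** There are at most [2 M d^j] exceptional parameters, again by a geometric sum. Each is its own
    sample, and the gaps between them need twice as many samples plus one: in total
    [1 + 6 M d^j]. *)
Lemma line_words j l : l.1 != 0 -> exists F : seq sphere, (size F <= 1 + 6 * M * d ^ j)%N /\
  forall t, exists2 e, e \in F & forall i, (i < j)%N -> same (iter i f e) (iter i f (Some (lpt l t))).
Proof.
move=> l0.
have [Z [sZ hZ]] : exists Z : seq R, (size Z <= M * (2 * d ^ j))%N /\ forall t, t \notin Z ->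
    \forall s \near t, forall i, (i < j)%N -> same (iter i f (Some (lpt l s))) (iter i f (Some (lpt l t))).
  elim: j => [|j [Z [sZ hZ]]].
    by exists [::]; split=> // t _; apply: filterS filterT.
  have [Z' [sZ' hZ']] := line_zeros j l0; exists (Z ++ Z'); split.
    rewrite size_cat expnS; apply: (leq_trans (leq_add sZ sZ')).
    by move: d2 (d ^ j)%N M => ? a b; nia.
  move=> t; rewrite mem_cat negb_or => /andP[/hZ n1 /hZ' n2].
  apply: filterS2 n1 n2 => s h1 h2 i; rewrite ltnS leq_eqVlt => /orP[/eqP->//|]; exact: h1.
have [T [sT hT]] := gap_samples Z; exists (map (fun t => Some (lpt l t)) (Z ++ T)); split.
  rewrite size_map size_cat; apply: (leq_trans (leq_add sZ sT)).
  by rewrite mulnCA -mulnA in sZ *; move: sZ; move: (M * d ^ j)%N (size Z) => a b; lia.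
move=> t; have [tZ|tZ] := boolP (t \in Z).
  by exists (Some (lpt l t)) => //; apply: (map_f (fun t => Some (lpt l t))); rewrite mem_cat tZ.
have [t' t'T ht'] := hT t tZ; exists (Some (lpt l t')).
  by apply: (map_f (fun t => Some (lpt l t))); rewrite mem_cat t'T orbT.
apply/(lc_btw (P := fun s => forall i, (i < j)%N -> same (iter i f (Some (lpt l s))) (iter i f (Some (lpt l t)))) (t := t)); last by [].
move=> s /ht'/hZ; apply: filterS => s' h; split=> A i ij.
  exact: same_trans (same_sym (h i ij)) (A i ij).
exact: same_trans (h i ij) (A i ij).
Qed.

(** In units of [d^j], the words that start at infinity or on a line: one for infinity, and those of
    [line_words] for each line. *)
Let L := (1 + size ls * (1 + 6 * M))%N.

Lemma bad_words j : exists F : seq sphere, (size F <= L * d ^ j)%N /\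
  forall x, ~~ good x -> exists2 e, e \in F & forall i, (i < j)%N -> same (iter i f e) (iter i f x).
Proof.
have dj : (0 < d ^ j)%N by rewrite expn_gt0 ltnW.
have [F [sF hF]] : exists F : seq sphere, (size F <= size ls * (1 + 6 * M * d ^ j))%N /\
    forall l t, l \in ls -> exists2 e, e \in F & forall i, (i < j)%N -> same (iter i f e) (iter i f (Some (lpt l t))).
  suff H s : (forall l, l \in s -> l \in ls) -> exists F : seq sphere,
      (size F <= size s * (1 + 6 * M * d ^ j))%N /\ forall l t, l \in s ->
      exists2 e, e \in F & forall i, (i < j)%N -> same (iter i f e) (iter i f (Some (lpt l t))).
    exact: H.
  elim: s => [|l s IH] s0; first by exists [::]; split.
  have [F [sF hF]] := IH (fun m ms => s0 m (mem_behead (ms : m \in behead (l :: s)))).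
  have [F' [sF' hF']] := line_words j (ls0 (s0 l (mem_head _ _))).
  exists (F' ++ F); split; first by rewrite size_cat; move: (1 + 6 * M * d ^ j)%N sF' sF => B h1 h2; exact: (leq_add h1 h2).
  move=> m t; rewrite in_cons => /orP[/eqP->|ms].
    by have [e eF he] := hF' t; exists e => //; rewrite mem_cat eF.
  by have [e eF he] := hF m t ms; exists e => //; rewrite mem_cat eF orbT.
exists (None :: F); split; first by rewrite /= /L mulnDl mul1n; nia.
move=> x; rewrite /good negb_and negbK => /orP[/eqP->|]; first by exists None; rewrite ?mem_head.
case: x => [z|]; last by exists None; rewrite ?mem_head.
move=> /allPn[l ll /negPn/eqP s0]; have [e eF he] := hF l (complex.Im (l.1 * z)) ll.
exists e; first by rewrite in_cons eF orbT.
by rewrite -lptP in he; [|exact: ls0|].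
Qed.

(* The orbit of [x] follows [w.1.2] until it first meets a line or infinity, at
   time [w.1.1], and [w.2] from then on. *)
Definition spliced (w : nat * sphere * sphere) (i : nat) : sphere :=
  if (i < w.1.1)%N then iter i f w.1.2 else iter (i - w.1.1) f w.2.

(** A cutting time [k <= n] allows at most [(1 + k K) d^k] beginnings and [L d^(n - k)] ends. The
    bound [1 + k K <= (n + 1) (1 + K)] and the [n + 1] values of [k] make up the square. *)
Lemma orbit_words n : exists W : seq (nat * sphere * sphere),
  (size W <= n.+1 ^ 2 * ((1 + K) * L) * d ^ n)%N /\
  forall x, exists2 w, w \in W & forall i, (i < n)%N -> same (spliced w i) (iter i f x).
Proof.
have [E hE] := choice Vk_words; have [F hF] := choice bad_words.
pose W ks := flatten [seq [seq (k, e, y) | e <- E k, y <- F (n - k)%N] | k <- ks].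
exists (W (iota 0 n.+1)); split.
  have step ks : (forall k, k \in ks -> (k <= n)%N) ->
      (size (W ks) <= size ks * (n.+1 * ((1 + K) * L) * d ^ n))%N.
    elim: ks => [|k ks IH] ksn //; rewrite /W/= size_cat size_allpairs mulSn; apply: leq_add; last first.
      by apply: IH => j jks; apply: ksn; rewrite in_cons jks orbT.
    have kn : (k <= n)%N by apply: ksn; exact: mem_head.
    apply: (leq_trans (leq_mul (hE k).1 (hF (n - k)%N).1)).
    rewrite mulnACA -expnD subnKC// leq_mul2r mulnA leq_mul2r; apply/orP; right; apply/orP; right.
    by move: K => a; nia.
  have := step (iota 0 n.+1); rewrite size_iota => /(_ _)/leq_trans; apply.
    by move=> k; rewrite mem_iota ltnS.
  by rewrite !mulnA.
move=> x; pose k := find (fun i => ~~ good (iter i f x)) (iota 0 n).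
have kn : (k <= n)%N by rewrite -[X in (_ <= X)%N](size_iota 0 n) find_size.
have Vx : avoiding k x.
  move=> i ik; have := @before_find _ 0%N (fun i => ~~ good (iter i f x)) (iota 0 n) i ik.
  by rewrite nth_iota ?(leq_trans ik)// add0n => /negbFE.
have [e eE he] := (hE k).2 x Vx.
have [y yF hy] : exists2 y, y \in F (n - k)%N & forall i, (k <= i < n)%N -> same (iter (i - k) f y) (iter i f x).
  have [kn'|kn'] := ltnP k n; last first.
    have [y yF _] := (hF (n - k)%N).2 None isT; exists y => // i /andP[ki i_n].
    by move: (leq_trans kn' ki); rewrite leqNgt i_n.
  have bad : ~~ good (iter k f x).
    have hk : has (fun i => ~~ good (iter i f x)) (iota 0 n) by rewrite has_find size_iota.
    by have := nth_find 0%N hk; rewrite nth_iota.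
  have [y yF hy] := (hF (n - k)%N).2 _ bad; exists y => // i /andP[ki i_n].
  by have := hy (i - k)%N; rewrite ltn_sub2r// -iterD subnK//; apply.
exists (k, e, y).
  apply/flattenP; exists [seq (k, e, y) | e <- E k, y <- F (n - k)%N].
    by apply/mapP; exists k => //; rewrite mem_iota ltnS.
  by apply/allpairsP; exists (e, y).
move=> i i_n; rewrite /spliced/=; case: ltnP => ik; first exact: he.
by apply: hy; rewrite ik.
Qed.

Lemma grid_entropy (mu : probability (borel_sphere R) R) k (eta : sphere -> 'I_k) (t : R) :
  invariant_measure mu f -> mlabel (eta : borel_sphere R -> 'I_k) ->
  (forall x y, same x y -> eta x = eta y) -> 0 < t ->
  exists c : R, forall n,
    partition_entropy mu (itinerary (f : borel_sphere R -> borel_sphere R) (eta : borel_sphere R -> 'I_k) n) <= c + n%:R * (ln d%:R + 2 * t).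
Proof.
move=> inv meta etas t0; pose a : R := ((1 + K) * L)%:R.
have a0 : 0 < a by rewrite ltr0n /L.
exists (ln a + 2 * (t - 1 - ln t)) => n.
have [W [sW hW]] := orbit_words n.
pose s : seq {ffun 'I_n -> 'I_k} := [seq [ffun i : 'I_n => eta (spliced w i)] | w <- W].
have mit := mlabel_itinerary (continuous_borel (rational_continuous rf)) inv (n := n) meta.
have hs x : itinerary (f : borel_sphere R -> borel_sphere R) (eta : borel_sphere R -> 'I_k) n x \in s.
  have [w wW hw] := hW x; apply/mapP; exists w => //.
  by apply/ffunP => i; rewrite !ffunE; apply/esym/etas/hw.
have d0 : 0 < d%:R :> R by rewrite ltr0n ltnW.
have n0 : 0 < n.+1%:R :> R by [].
apply: (le_trans (partition_entropy_le_ln mu mit hs)).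
have s0 : (0 < size s)%N by have := hs (point : sphere); case: (s).
apply: (@le_trans _ _ (ln (n.+1%:R ^+ 2 * a * d%:R ^+ n))).
  rewrite ler_ln ?posrE ?ltr0n// ?mulr_gt0 ?exprn_gt0//.
  by rewrite size_map -!natrX -!natrM ler_nat.
exact: ln_growth_le.
Qed.
End Counting.

(** * Approximation by grid sets and the upper bound *)

Section GridApproximation.
Context (R : realType).
Local Notation C := (Cplx R).
Local Notation sphere := (sphere R).
Local Notation N := (@rnorm R C).
Variable mu : probability (borel_sphere R) R.
Implicit Types (A B : set (borel_sphere R)) (l : R[i] * R).

Definition grid B := measurable B /\ exists ls : seq (R[i] * R),
  (forall l, l \in ls -> l.1 != 0) /\ forall x y : sphere, same ls x y -> B x -> B y.

Lemma same_sub (ls ls' : seq (R[i] * R)) x y : {subset ls <= ls'} -> same ls' x y -> same ls x y.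
Proof. by move=> s [a b]; split=> // l /s/b. Qed.

Lemma gridC B : grid B -> grid (~` B).
Proof.
move=> [mB [ls [ls0 h]]]; split; first exact: measurableC.
by exists ls; split=> // x y /same_sym xy nBx By; apply: nBx; exact: h By.
Qed.

Lemma gridU B B' : grid B -> grid B' -> grid (B `|` B').
Proof.
move=> [mB [ls [ls0 h]]] [mB' [ls' [ls0' h']]]; split; first exact: measurableU.
exists (ls ++ ls'); split=> [l|x y s].
  by rewrite mem_cat => /orP[/ls0|/ls0'].
move=> [Bx|Bx]; [left; apply: h Bx|right; apply: h' Bx]; apply: same_sub s => l lls; rewrite mem_cat lls ?orbT//.
Qed.

Lemma gridI B B' : grid B -> grid B' -> grid (B `&` B').
Proof. by move=> /gridC h /gridC h'; rewrite -[_ `&` _]setCK setCI; apply/gridC/gridU. Qed.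

Lemma grid0 : grid set0.
Proof. by split=> //; exists [::]. Qed.

Definition halfplane l : set sphere := [set x | sgside l x = 1].

Lemma halfplane_open l : open (halfplane l).
Proof.
rewrite openE => -[z|]; last by move=> /esym/eqP; rewrite oner_eq0.
rewrite /halfplane/= => s1; have s0 : side l z != 0 by rewrite -sgr_eq0 s1 oner_eq0.
by apply: filterS (side_near s0) => y [w -> h]; rewrite /= h.
Qed.

Lemma grid_halfplane l : l.1 != 0 -> grid (halfplane l).
Proof.
move=> l0; split; first by apply: open_borel; exact: halfplane_open.
exists [:: l]; split=> [m|x y [_ h]]; first by rewrite inE => /eqP->.
by rewrite /halfplane/= h ?mem_head.
Qed.

(** Boxes contain finite points only; this set, with [P] the statement [U None], accounts for
    infinity in an open set [U]. *)
Lemma grid_infty (P : Prop) : grid [set x : sphere | x = None /\ P].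
Proof.
split.
  have [p|np] := pselect P.
    have -> : [set x : sphere | x = None /\ P] = [set None].
      by apply/seteqP; split=> x /=; [move=> []|move=> ->].
    exact: set1_borel.
  have -> : [set x : sphere | x = None /\ P] = set0 by apply/seteqP; split=> // x [].
  exact: measurable0.
exists [::]; split=> // x y [e _] /= [x0 p]; split=> //.
by apply/eqP; rewrite -e x0.
Qed.

Definition setdiff A B := (A `\` B) `|` (B `\` A).

Definition approx A := measurable A /\
  forall e : R, 0 < e -> exists2 B, grid B & (mu (setdiff A B) <= e%:E)%E.

Lemma measurable_setdiff A B : measurable A -> measurable B -> measurable (setdiff A B).
Proof. by move=> mA mB; apply: measurableU; exact: measurableD. Qed.

Lemma setdiff_id A : setdiff A A = set0.
Proof. by rewrite /setdiff setDv setU0. Qed.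

Lemma grid_approx B : grid B -> approx B.
Proof.
move=> gB; split; first exact: gB.1.
by move=> e e0; exists B => //; rewrite setdiff_id measure0 lee_fin ltW.
Qed.

Lemma approxC A : approx A -> approx (~` A).
Proof.
move=> [mA h]; split; first exact: measurableC.
move=> e /h[B gB le]; exists (~` B); first exact: gridC.
apply: le_trans le; rewrite le_measure ?inE//.
- by apply: measurable_setdiff; apply: measurableC => //; exact: gB.1.
- by apply: measurable_setdiff => //; exact: gB.1.
by move=> x [[/= a /contrapT b]|[/= a /contrapT b]]; [right|left].
Qed.

Lemma approxU A A' : approx A -> approx A' -> approx (A `|` A').
Proof.
move=> [mA h] [mA' h']; split; first exact: measurableU.
move=> e e0; have e2 : 0 < e / 2 by rewrite divr_gt0.
have [B gB le] := h _ e2; have [B' gB' le'] := h' _ e2.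
have [mB mB'] := (gB.1, gB'.1).
have m1 := measurable_setdiff mA mB; have m2 := measurable_setdiff mA' mB'.
exists (B `|` B'); first exact: gridU.
apply: (@le_trans _ _ (mu (setdiff A B `|` setdiff A' B'))).
  apply: le_measure; rewrite ?inE//.
  - by apply: measurable_setdiff; exact: measurableU.
  - exact: measurableU.
  by move=> x; rewrite /setdiff /setU /setD /=; tauto.
apply: (le_trans (measureU2 mu m1 m2)); rewrite (splitr e) EFinD.
exact: leeD.
Qed.

Lemma approx_bigU (F : (set (borel_sphere R))^nat) n : (forall i, approx (F i)) ->
  approx (\bigcup_(i < n) F i).
Proof.
move=> aF; elim: n => [|n IH].
  by rewrite bigcup_mkord big_ord0; apply/grid_approx/grid0.
by rewrite bigcup_mkord big_ord_recr -bigcup_mkord; exact: approxU.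
Qed.

(** The part of the union not reached by the first [n] sets decreases to the empty set, so its mass
    is at most [e / 2] for some [n]. *)
Lemma approx_bigcup (F : (set (borel_sphere R))^nat) : (forall i, approx (F i)) ->
  approx (\bigcup_i F i).
Proof.
move=> aF; have mU : measurable (\bigcup_i F i) by apply: bigcupT_measurable => i; exact: (aF i).1.
split=> // e e0; have e2 : 0 < e / 2 by rewrite divr_gt0.
pose D n := \bigcup_i F i `\` \bigcup_(i < n) F i.
have mD n : measurable (D n) by apply: measurableD => //; exact: (approx_bigU n aF).1.
have [n Dn] : exists n, (mu (D n) <= (e / 2)%:E)%E.
  apply: contrapT => nD.
  have D0 : \bigcap_n D n = set0.
    apply/seteqP; split=> // x Dx; have [[i _ Fix] _] := Dx 0%N I.
    by have [_ h] := Dx i.+1 I; apply: h; exists i => /=.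
  have cD : (mu \o D) @ \oo --> (0 : \bar R).
    rewrite -(measure0 mu) -D0; apply: nonincreasing_cvg_mu => //.
    - by apply: (le_lt_trans (probability_le1 mu (mD 0%N))); rewrite ltry.
    - by rewrite D0.
    move=> n m nm; apply/subsetPset => x [Ux h]; split=> // -[i /= i_n Fix]; apply: h.
    by exists i => //=; exact: leq_trans i_n nm.
  have : ((e / 2)%:E <= limn (mu \o D))%E.
    apply: lime_ge; first by apply/cvg_ex; exists 0%E.
    by near=> n; rewrite leNgt; apply/negP => h; apply: nD; exists n; exact: ltW.
  by rewrite (cvg_lim _ cD)// lee_fin leNgt e2.
have [B gB le] := (approx_bigU n aF).2 _ e2.
have mUn := (approx_bigU n aF).1; have mB := gB.1.
exists B => //; have m2 := measurable_setdiff mUn mB.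
apply: (@le_trans _ _ (mu (D n `|` setdiff (\bigcup_(i < n) F i) B))).
  apply: le_measure; rewrite ?inE//.
  - exact: measurable_setdiff.
  - exact: measurableU.
  move=> x [[[i _ Fx] nBx]|[Bx nU]].
    have [Ux|nUx] := pselect ((\bigcup_(i < n) F i) x); first by right; left.
    by left; split=> //; exists i.
  by right; right; split=> // -[i _ Fx]; apply: nU; exists i.
apply: (le_trans (measureU2 mu (mD n) m2)); rewrite (splitr e) EFinD.
exact: leeD.
Unshelve. all: by end_near.
Qed.

(** A rational rectangle, written with half planes so that it is a grid set; the real part of
    [- i z] is the imaginary part of [z]. *)
Definition box (q : rat * rat * rat * rat) : set sphere :=
  halfplane (1, ratr q.1.1.1) `&` halfplane (-1, - ratr q.1.1.2) `&`
  (halfplane (- 'i%C, ratr q.1.2) `&` halfplane ('i%C, - ratr q.2)).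

Lemma halfplaneE l (z : C) : halfplane l (Some z) <-> 0 < side l z.
Proof.
rewrite /halfplane/=; split=> [h|/gtr0_sg//].
by rewrite -sgr_gt0 h ltr01.
Qed.

Lemma boxE q (x : sphere) : box q x <-> exists z : C, [/\ x = Some z,
  ratr q.1.1.1 < complex.Re z < ratr q.1.1.2 & ratr q.1.2 < complex.Im z < ratr q.2].
Proof.
case: x => [[a b]|]; last first.
  split; first by move=> [[/= /esym/eqP]]; rewrite oner_eq0.
  by move=> [z []].
rewrite /box; split.
  move=> [[/halfplaneE h1 /halfplaneE h2] [/halfplaneE h3 /halfplaneE h4]].
  exists (a +i* b); split=> //=; move: h1 h2 h3 h4; rewrite /side/= => *; apply/andP; split; lra.
move=> [_ [[<-] /= /andP[h1 h2] /andP[h3 h4]]].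
by split; split; apply/halfplaneE; rewrite /side/=; lra.
Qed.

Lemma grid_box q : grid (box q).
Proof.
have i0 : 'i%C != 0 :> R[i] by rewrite eq_complex/= eqxx oner_eq0.
by apply: gridI; apply: gridI; apply: grid_halfplane; rewrite /= ?oppr_eq0 ?oner_eq0.
Qed.

Lemma open_boxes (U : set sphere) (z : C) : open U -> U (Some z) ->
  exists q, box q (Some z) /\ box q `<=` U.
Proof.
move=> oU Uz; have /nbhs_Some/nbhs_rnorm[r r0 h] : nbhs (Some z : sphere) U by exact: open_nbhs_nbhs.
case: z Uz h => a b _ h.
have ra (x : R) : x - r / 2 < x by rewrite ltrBlDr ltrDl divr_gt0.
have rb (x : R) : x < x + r / 2 by rewrite ltrDl divr_gt0.
have [q1 h1] := rat_in_itvoo (ra a); have [q2 h2] := rat_in_itvoo (rb a).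
have [q3 h3] := rat_in_itvoo (ra b); have [q4 h4] := rat_in_itvoo (rb b).
exists (q1, q2, q3, q4); move: h1 h2 h3 h4; rewrite !in_itv/= => /andP[? ?] /andP[? ?] /andP[? ?] /andP[? ?].
split; first by apply/boxE; exists (a +i* b); split=> //=; apply/andP.
move=> x /boxE[[u v] [-> /= /andP[? ?] /andP[? ?]]]; apply: h.
have -> : (u +i* v)%C - (a +i* b)%C = (u - a) +i* (v - b) by [].
apply: (le_lt_trans (rnorm_complex _ _)); rewrite [X in _ < X](splitr r).
by apply: ltrD; rewrite ltr_norml; apply/andP; split; lra.
Qed.

(** The finite part of an open set is a countable union of rational boxes, enumerated by
    [unpickle]. *)
Lemma approx_open (U : set sphere) : open U -> approx U.
Proof.
move=> oU; pose F n : set sphere := if unpickle n is Some q then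
   (if `[< box q `<=` U >] then box q else set0) else set0.
have -> : U = [set x : sphere | x = None /\ U None] `|` \bigcup_n F n.
  apply/seteqP; split=> [[z|] Ux|x [[-> //]|[n _]]].
  - right; have [q [qz qU]] := open_boxes oU Ux; exists (pickle q); first exact: I.
    by rewrite /F pickleK asboolT; [exact: qz|exact: qU].
  - by left.
  by rewrite /F; case: (unpickle n) => // q; case: asboolP => // qU /qU.
apply: approxU; first exact/grid_approx/grid_infty.
apply: approx_bigcup => n; apply: grid_approx; rewrite /F; case: (unpickle n) => [q|]; last exact: grid0.
by case: asboolP => _; [exact: grid_box|exact: grid0].
Qed.

(** The approximable sets form a sigma-algebra that contains the open sets. *)
Lemma approx_measurable A : measurable A -> approx A.
Proof.
apply: smallest_sub; last by move=> U; exact: approx_open.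
split; first exact/grid_approx/grid0.
- by move=> B aB; rewrite setTD; exact: approxC.
exact: approx_bigcup.
Qed.

Lemma measure_seq_le (I : eqType) (s : seq I) (F : I -> set (borel_sphere R)) (a : R) :
  (forall i, measurable (F i)) -> (forall i, mu (F i) <= a%:E)%E ->
  measurable [set x | exists2 i, i \in s & F i x] /\
  (mu [set x | exists2 i, i \in s & F i x] <= ((size s)%:R * a)%:E)%E.
Proof.
move=> mF Fa; elim: s => [|i s [mS IH]].
  have -> : [set x | exists2 i, i \in [::] & F i x] = set0 by apply/seteqP; split=> // x [].
  by rewrite measure0 mul0r.
have -> : [set x | exists2 j, j \in i :: s & F j x] = F i `|` [set x | exists2 i, i \in s & F i x].
  apply/seteqP; split=> x /=.
    by move=> [j]; rewrite in_cons => /orP[/eqP->|js]; [left|right; exists j].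
  by move=> [Fx|[j js Fx]]; [exists i; rewrite ?mem_head|exists j; rewrite ?in_cons ?js ?orbT].
split; first exact: measurableU.
apply: (le_trans (measureU2 mu (mF i) mS)).
by rewrite /= -[(size s).+1%:R]natr1 mulrDl mul1r addrC EFinD leeD.
Qed.

(** The sets [B j] that approximate the cells need be neither disjoint nor covering; a point is
    labelled by some [j] with [B j x], if there is one. Outside the symmetric differences, of total
    mass at most [k * (e / k)], [B j x] holds for [j = xi x] only. *)
Lemma grid_label k (xi : borel_sphere R -> 'I_k) (e : R) : mlabel xi -> 0 < e ->
  exists (eta : borel_sphere R -> 'I_k) (ls : seq (R[i] * R)),
  [/\ mlabel eta, forall l, l \in ls -> l.1 != 0, forall x y, same ls x y -> eta x = eta y &
      (mu [set x | xi x != eta x] <= e%:E)%E].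
Proof.
move=> mxi e0; have k0 : 0 < (k%:R : R).
  by rewrite ltr0n; apply: leq_ltn_trans (leq0n _) (ltn_ord (xi (point : borel_sphere R))).
have ek : 0 < e / k%:R by rewrite divr_gt0.
have ex j : exists B, grid B /\ (mu (setdiff (xi @^-1` [set j]) B) <= (e / k%:R)%:E)%E.
  by have [B gB le] := (approx_measurable (mxi j)).2 _ ek; exists B.
have [B hB] := choice ex.
have exl j : exists ls : seq (R[i] * R), (forall l, l \in ls -> l.1 != 0) /\
    forall x y : sphere, same ls x y -> B j x -> B j y by exact: (hB j).1.2.
have [lj hl] := choice exl.
pose Z x : {ffun 'I_k -> bool} := [ffun j => `[< B j x >]].
pose g (F : {ffun 'I_k -> bool}) := odflt (xi (point : borel_sphere R)) [pick j | F j].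
have mZ : mlabel Z.
  move=> F; have -> : Z @^-1` [set F] = \bigcap_(j in [set: 'I_k]) (if F j then B j else ~` B j).
    apply/seteqP; split=> [x /= <- j _|x h].
      by rewrite ffunE; case: asboolP.
    by apply/ffunP => j; rewrite ffunE; have := h j I; case: (F j) => h'; [rewrite asboolT|rewrite asboolF].
  apply: fin_bigcap_measurable; first exact: finite_finset.
  by move=> j _; case: (F j); [exact: (hB j).1.1|apply: measurableC; exact: (hB j).1.1].
exists (g \o Z), (flatten [seq lj j | j <- enum 'I_k]); split.
- exact: mlabel_comp.
- by move=> l /flatten_mapP[j _ /(hl j).1].
- move=> x y s; congr g; apply/ffunP => j; rewrite !ffunE; apply: asbool_equiv_eq.
  have sj : same (lj j) x y.
    by apply: same_sub s => l ll; apply/flatten_mapP; exists j; rewrite ?mem_enum.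
  by split; [exact: (hl j).2|apply: (hl j).2; exact: same_sym].
have [mS] := measure_seq_le (enum 'I_k)
  (fun j => measurable_setdiff (mxi j) (hB j).1.1) (fun j => (hB j).2).
rewrite size_enum_ord mulrCA divff ?gt_eqF// mulr1; apply: le_trans.
apply: le_measure; rewrite ?inE//.
  exact: (mlabel_pred (fun j => j.1 != j.2) (mlabel_pair mxi (mlabel_comp g mZ))).
move=> x /= /eqP ne; apply: contrapT => nS; apply: ne.
have H j : xi x = j <-> B j x.
  split=> h; apply: contrapT => h'; apply: nS; exists j; rewrite ?mem_enum//; first by left.
  by right.
rewrite /g; case: pickP => [j|/(_ (xi x))]; rewrite ffunE; first by move=> /asboolP/H.
by rewrite asboolT//; apply/H.
Qed.

(** With [t = s^2] and [s <= 1], the left-hand side is at most [s (2 M + 1)]. *)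
Lemma small_error (M e : R) : 0 <= M -> 0 < e -> exists2 t : R, 0 < t & M * (2 * Num.sqrt t) + t <= e.
Proof.
move=> M0 e0; have K0 : 0 < 2 * M + 1 by rewrite ltr_wpDl// mulr_ge0.
pose s := Num.min 1 (e / (2 * M + 1)).
have s0 : 0 < s by rewrite lt_min ltr01 divr_gt0.
have s1 : s <= 1 by rewrite ge_min lexx.
have s2 : s * (2 * M + 1) <= e by rewrite -ler_pdivlMr// ge_min lexx orbT.
exists (s ^+ 2); first by rewrite exprn_gt0.
by rewrite sqrtr_sqr (ger0_norm (ltW s0)); apply: le_trans s2; nra.
Qed.

Lemma KS_entropy_le (f : sphere -> sphere) : rational_map f -> (1 < ratdeg f)%N ->
  invariant_measure mu f -> (KS_entropy mu f <= (ln (ratdeg f)%:R)%:E)%E.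
Proof.
move=> rf d2 inv; apply: ge_ereal_sup => _ [k [xi [mxi ->]]]; rewrite lee_fin.
have mf := continuous_borel (rational_continuous rf).
apply/ler_addgt0Pr => e e0; have e2 : 0 < e / 2 by rewrite divr_gt0.
(* [grid_entropy] loses [2 * (e / 4)] per step, and replacing the partition by one of grid sets
   loses [e / 2]. *)
have e4 : 0 < e / 4 by rewrite divr_gt0.
have [t t0 ht] := small_error (ler0n R #|{: 'I_k * 'I_k}|) e2.
have [eta [ls [meta ls0 etas le]]] := grid_label mxi t0.
have [c hc] := grid_entropy rf d2 ls0 inv meta etas e4.
apply: (entropy_wrt_le mf inv mxi (K := c)) => n.
apply: (le_trans (entropy_approx mf inv n mxi meta)).
apply: (le_trans (lerD (hc n) (ler_wpM2l (ler0n _ n) (le_trans (entropy_near mxi meta le) ht)))).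
rewrite -addrA -mulrDr lerD2l ler_wpM2l//.
by move: (ln _) => x; lra.
Qed.
End GridApproximation.

Theorem theorem3 (R : realType) (S : ratsemigroup R)
    (S_amenable : right_amenable (lyubich_rep S))
    (S_nonexc : exists f : sphere R -> sphere R,
      [/\ ratsg_set S f, ~ exceptional f &
          ~ exists p, mobius_conj f (polymap p)]) :
  exists mu : probability (borel_sphere R) R,
    (forall s : sphere R -> sphere R, ratsg_set S s -> invariant_measure mu s) /\
    (forall P : sphere R -> sphere R, ratsg_set S P -> (1 < ratdeg P)%N ->
      maximal_entropy mu P).
Proof.
have [mu [outer inv bal]] := amenable_measure S_amenable.
have rat s : ratsg_set S s -> rational_map s by exact: ratsg_rational.
have cont s : ratsg_set S s -> continuous s by move=> /rat; exact: rational_continuous.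
have invS s : ratsg_set S s -> invariant_measure mu s.
  by move=> Ss; apply: open_invariant (cont s Ss) _ => U; exact: inv.
have balS s : ratsg_set S s -> balanced mu s.
  by move=> Ss; apply: open_balanced (cont s Ss) outer _ => U W k oU oW; exact: bal.
(* The nonexceptional map serves here only: the absence of atoms is a property of [mu], hence
   available for every [P] in [S]. *)
have noatom x : mu [set x] = 0%E.
  have [f [Sf nexc npoly]] := S_nonexc.
  apply/eqP/negPn/negP => mux.
  have mux0 : (0 < mu [set x])%E by rewrite lt0e mux measure_ge0.
  have [y [n [n0 yn ram]]] := atom_cycle (rat f Sf) (balS f Sf) mux0.
  exact: (no_ramified_cycle (rat f Sf) nexc npoly n0 yn) ram.
exists mu; split=> // P SP d2; split; first exact: invS.
move=> nu nuP; apply: le_trans (KS_entropy_le (rat P SP) d2 nuP) _.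
exact: (KS_entropy_ge (rat P SP) (invS P SP) (balS P SP) noatom outer).
Qed.
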